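(* Let $n\in\mathbb N$, $k\in(1,+\infty]$ and $A\in[0,+\infty)$. Then every nontrivial convolution operator $L: Exp_{0,A}^k(\mathbb C^n)\to Exp_{0,A}^k(\mathbb C^n)$ is mixing.
   Context: $\mathbb C^n$ is regarded as a complex Banach space with a fixed norm, $\mathbb N_0=\mathbb N\cup\{0\}$, and $\mathcal P({}^j\mathbb C^n)$ is the space of $j$-homogeneous polynomials $\mathbb C^n\to\mathbb C$ with $\|P\|=\sup_{\|x\|\le1}|P(x)|$. For $f$ holomorphic near $0$ with Taylor expansion $f=\sum_jP_j$ at $0$, $\hat d^jf(0)=j!P_j$; $B_r(0)$ is the open ball of center $0$ and radius $r$, with $B_{1/0}(0)=\mathbb C^n$. For $k\in[1,+\infty)$, $Exp_{0,A}^k(\mathbb C^n)$ is the space of all entire functions $f$ on $\mathbb C^n$ with $\|f\|_{k,\rho}=\sum_{j=0}^\infty\rho^{-j}\left(\frac{j}{ke}\right)^{j/k}\left\|\frac1{j!}\hat d^jf(0)\right\|<\infty$ for all $\rho>A$ (the weight being $1$ for $j=0$), with the topology given by the norms $\|\cdot\|_{k,\rho}$, $\rho>A$. For $k=+\infty$, $Exp_{0,A}^\infty(\mathbb C^n)$ is the space of all holomorphic functions $f$ on $B_{1/A}(0)$ with $\limsup_{j\to\infty}\|\frac1{j!}\hat d^jf(0)\|^{1/j}\le A$, with the topology given by the seminorms $p^\infty_\rho(f)=\sum_j\rho^{-j}\|\frac1{j!}\hat d^jf(0)\|$, $\rho>A$. These are Fréchet spaces. A convolution operator on $Exp_{0,A}^k(\mathbb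 C^n)$ is a continuous linear map $L$ of $Exp_{0,A}^k(\mathbb C^n)$ into itself such that $d(Lf)(\cdot)a=L(df(\cdot)a)$ for all $a\in\mathbb C^n$ and all $f$, where $df(\cdot)a$ is the directional derivative $x\mapsto df(x)(a)$ (which belongs to $Exp_{0,A}^k(\mathbb C^n)$). It is nontrivial if it is not a scalar multiple of the identity. A continuous linear operator $T:X\to X$ on a topological vector space is mixing if for any non-empty open sets $U,V\subset X$ there is $n_0\in\mathbb N$ with $T^n(U)\cap V\neq\emptyset$ for all $n\ge n_0$. *)

(* Defs.v *)
From HB Require Import structures.
From mathcomp Require Import all_boot all_order all_algebra.
From mathcomp Require Import all_classical all_reals all_analysis.
From mathcomp Require Import complex ring lra.
From mathcomp Require Import -(notations) mpoly.
Import Order.TTheory GRing.Theory Num.Theory.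
Import numFieldNormedType.Exports.
Set Implicit Arguments.
Unset Strict Implicit.
Unset Printing Implicit Defensive.
Local Open Scope classical_set_scope.
Local Open Scope ring_scope.

(* The topology of R[i] is the one of its modulus. *)
HB.instance Definition _ (R : realType) :=
  GRing.ComAlgebra.copy R[i] R[i]^o.
HB.instance Definition _ (R : realType) := Vector.copy R[i] R[i]^o.
HB.instance Definition _ (R : realType) := NormedModule.copy R[i] R[i]^o.

(* The R-valued modulus (`|z| is R[i]-valued). *)
Notation cabs := Normc.normc.

Section Norm.
Context (R : realType) (n : nat).

Record cnorm := CNorm {
  cnorm_fun :> 'rV[R[i]]_n -> R ;
  cnormD : forall x y, cnorm_fun (x + y) <= cnorm_fun x + cnorm_fun y ;
  cnormZ : forall c x, cnorm_fun (c *: x) = cabs c * cnorm_fun x ;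
  cnorm_eq0 : forall x, cnorm_fun x = 0 -> x = 0 }.

End Norm.

Section Taylor.
Context (R : realType) (n : nat) (N : cnorm R n).
Local Notation C := R[i].
Local Notation V := 'rV[C]_n.

Definition homog_poly (j : nat) (P : V -> C) : Prop :=
  exists2 p : mpoly n C, p \is ishomog1 j (@mdeg n) &
    forall x, P x = meval (fun i => x 0 i) p.

Definition hnorm (P : V -> C) : \bar R :=
  ereal_sup [set (cabs (P x))%:E | x in [set x | N x <= 1]].

(* P is the sequence of the j-homogeneous terms of a power series expansion
   of f around a: the series converges uniformly to f on some ball. *)
Definition taylor_expansion (f : V -> C) (a : V) (P : nat -> V -> C) : Prop :=
  (forall j, homog_poly j (P j)) /\
  exists2 r : R, 0 < r &
    {uniform [set x | N (x - a) < r],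
      (fun m (x : V) => \sum_(j < m) P j (x - a)) @ \oo --> f}.

Definition holomorphic_on (D : set V) (f : V -> C) : Prop :=
  forall a, D a -> exists P, taylor_expansion f a P.

(* The j-th Taylor polynomial P_j of f at a, that is \hat d^j f(a) / j!;
   it is unique by taylor_expansion_unique below. *)
Definition taylor (f : V -> C) (a : V) : nat -> V -> C :=
  xget (fun=> fun=> 0) [set P | taylor_expansion f a P].

End Taylor.

Section ExpSet.
Context (R : realType) (n : nat) (N : cnorm R n).
Variables (k : \bar R) (A : {nonneg R}).
Local Notation C := R[i].
Local Notation V := 'rV[C]_n.

(* The order k ranges over [1, +oo]; other values are not meaningful.
   For j = 0 the weight is 1, because 0 `^ 0 = 1. *)
Definition exp_weight (j : nat) : R :=
  if k is r%:E then (j%:R / (r * expR 1)) `^ (j%:R / r) else 1.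

Definition expnorm (rho : R) (f : V -> C) : \bar R :=
  (\sum_(0 <= j <oo)
    (rho ^- j * exp_weight j)%:E * hnorm N (taylor N f 0 j))%E.

Definition expdom : set V :=
  if k is +oo%E then
    if A%:num == 0 then setT else [set x | N x < (A%:num)^-1]
  else setT.

Definition exp_growth (f : V -> C) : Prop :=
  if k is +oo%E then
    (limn_esup (fun j => hnorm N (taylor N f 0 j) `^ (j%:R^-1))
      <= (A%:num)%:E)%E
  else forall rho, A%:num < rho -> (expnorm rho f < +oo)%E.

(* A function on expdom is represented by its extension by 0. *)
Definition expset (f : V -> C) : Prop :=
  [/\ holomorphic_on N expdom f, (forall x, ~ expdom x -> f x = 0)
    & exp_growth f].

End ExpSet.

Section TaylorTheory.
Context (R : realType) (n : nat) (N : cnorm R n).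
Local Notation C := R[i].
Local Notation V := 'rV[C]_n.
Implicit Types (f g : V -> C) (P Q : nat -> V -> C).

Lemma cabs_ge0 (z : C) : 0 <= cabs z.
Proof. by case: z => a b; exact: sqrtr_ge0. Qed.

Lemma cabsN (z : C) : cabs (- z) = cabs z.
Proof. exact: normcN. Qed.

Lemma ler_cabsD (x y : C) : cabs (x + y) <= cabs x + cabs y.
Proof. exact: le_normcD. Qed.

Lemma ler_cabsB (x y : C) : cabs (x - y) <= cabs x + cabs y.
Proof. by rewrite -(cabsN y) ler_cabsD. Qed.

Lemma ler_cabs_sum I (s : seq I) (p : pred I) (F : I -> C) :
  cabs (\sum_(i <- s | p i) F i) <= \sum_(i <- s | p i) cabs (F i).
Proof.
elim/big_rec2 : _ => [|i x y _ h]; first by rewrite Normc.normc0.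
by apply: le_trans (ler_cabsD _ _) _; rewrite lerD2l.
Qed.

Lemma cabsX (z : C) j : cabs (z ^+ j) = cabs z ^+ j.
Proof.
elim: j => [|j IH]; first by rewrite !expr0 Normc.normc1.
by rewrite !exprS Normc.normcM IH.
Qed.

Lemma cabs_real (t : R) : 0 <= t -> cabs (t%:C)%C = t.
Proof. by move=> t0; rewrite /= expr0n /= addr0 sqrtr_sqr ger0_norm. Qed.

Lemma cnorm0 : N 0 = 0.
Proof. by rewrite -(scale0r (0 : V)) cnormZ Normc.normc0 mul0r. Qed.

Lemma cnormN x : N (- x) = N x.
Proof. by rewrite -scaleN1r cnormZ cabsN Normc.normc1 mul1r. Qed.

Lemma cnorm_ge0 x : 0 <= N x.
Proof.
have := cnormD N x (- x).
by rewrite subrr cnorm0 cnormN -mulr2n pmulrn_lge0.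
Qed.

Lemma homog_polyZ j (P : V -> C) c x :
  homog_poly j P -> P (c *: x) = c ^+ j * P x.
Proof.
case=> p hp E; rewrite !E !mevalE big_distrr /=.
rewrite big_seq [RHS]big_seq; apply: eq_bigr => m mp.
have <- : mdeg m = j by move/dhomogP: hp; apply.
rewrite mulrCA; congr (_ * _).
under eq_bigr do rewrite mxE exprMn.
rewrite big_split /=; congr (_ * _).
by rewrite mdegE prodrXr.
Qed.

Lemma homog_poly_lin j (P Q : V -> C) c :
  homog_poly j P -> homog_poly j Q -> homog_poly j (c *: P + Q).
Proof.
move=> [p hp EP] [q hq EQ]; exists (c *: p + q).
  by apply: dhomogD => //; exact: dhomogZ.
by move=> x; rewrite mevalD mevalZ -EP -EQ.
Qed.

Lemma homog_poly0 j : homog_poly j (0 : V -> C).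
Proof. by exists 0 => [|x]; [exact: dhomog0 | rewrite meval0]. Qed.

Lemma uniform_cabsP (B : set V) (F : nat -> V -> C) f :
  {uniform B, F @ \oo --> f} <->
  (forall e : R, 0 < e -> \forall m \near \oo,
     forall x, B x -> cabs (f x - F m x) < e).
Proof.
split=> [h e e0|h P /uniform_nbhs [E [+ EP]]].
  have : nbhs (f : {uniform` B -> C})
      [set g : V -> C | forall x, B x -> cabs (f x - g x) < e].
    apply/uniform_nbhs; exists [set xy : C * C | `|xy.1 - xy.2| < e%:C%C].
    split; last first.
      move=> g /= H x /H; rewrite normc_def ltcR => h'.
      by case: (f x - g x) h' => a b.
    rewrite -entourage_ballE; exists e%:C%C => //=.
    by rewrite ltcR.
  exact: h.
rewrite -entourage_ballE => -[e /= e0 eE].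
have e1 : e = (complex.Re e)%:C%C.
  by apply/esym/RRe_real/gtr0_real.
apply: filterS (h (complex.Re e) _); last by rewrite -ltcR -e1.
move=> m H; apply: EP => x Bx; apply: eE => /=.
rewrite /ball /= e1 normc_def ltcR.
by move: (H x Bx); case: (f x - F m x) => a b.
Qed.

Lemma coef0_unique (c : nat -> C) (d : R) : 0 < d ->
  (forall t : R, 0 < t < d -> forall e, 0 < e ->
    \forall m \near \oo, cabs (\sum_(j < m) c j * (t%:C%C) ^+ j) < e) ->
  forall j, c j = 0.
Proof.
move=> d0 H; elim/ltn_ind => j IH.
pose s := d / 2.
have s0 : 0 < s by rewrite divr_gt0.
have sd : 0 < s < d by rewrite s0 ltr_pdivrMr // ltr_pMr // ltr1n.
have absT (t : R) i : 0 <= t -> cabs (c i * t%:C%C ^+ i) = cabs (c i) * t ^+ i.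
  by move=> t0; rewrite Normc.normcM cabsX cabs_real.
have [K K0 HK] : exists2 K : R, 0 < K & forall i, cabs (c i) * s ^+ i <= K.
  have [M _ HM] := H s sd _ (@ltr01 R).
  pose T := \sum_(i < M) cabs (c i) * s ^+ i.
  have Tge0 : 0 <= T.
    by apply: sumr_ge0 => i _; rewrite mulr_ge0 ?cabs_ge0 ?exprn_ge0 ?ltW.
  exists (2 + T) => [|i]; first by rewrite ltr_wpDr.
  have [iM|Mi] := ltnP i M.
    rewrite /T (bigD1 (Ordinal iM)) //= addrCA lerDl addr_ge0 //.
    by apply: sumr_ge0 => l _; rewrite mulr_ge0 ?cabs_ge0 ?exprn_ge0 ?ltW.
  rewrite -(absT _ _ (ltW s0)) ler_wpDr //.
  have h1 := HM i Mi; have h2 := HM i.+1 (leqW Mi).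
  have -> : c i * s%:C%C ^+ i =
    \sum_(l < i.+1) c l * s%:C%C ^+ l - \sum_(l < i) c l * s%:C%C ^+ l.
    by rewrite big_ord_recr /= addrAC subrr add0r.
  apply: le_trans (ler_cabsB _ _) _; rewrite /= in h1 h2; lra.
apply: Normc.eq0_normc; apply/eqP; rewrite eq_le cabs_ge0 andbT.
rewrite -(pmulr_lle0 _ (exprn_gt0 j s0)).
apply/ler_addgt0Pr => e e0; rewrite add0r.
pose q := Num.min (2^-1) (e / (4 * K)).
have q0 : 0 < q by rewrite lt_min invr_gt0 ltr0n divr_gt0 // mulr_gt0.
have q2 : q <= 2^-1 by rewrite ge_min lexx.
have qe : 4 * K * q <= e.
  rewrite mulrC -ler_pdivlMr ?mulr_gt0 //.
  by rewrite ge_min lexx orbT.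
have qs : 0 < q * s < d.
  rewrite mulr_gt0 //=; apply: le_lt_trans (_ : s < d); last by case/andP: sd.
  by rewrite ler_piMl ?ltW //; lra.
have eq0 : 0 < q ^+ j * (e / 2) by rewrite mulr_gt0 ?exprn_gt0 ?divr_gt0.
have qs0 : 0 <= q * s by rewrite mulr_ge0 ?ltW.
have [M _ HM] := H _ qs _ eq0.
pose m := maxn M j.+1.
have := HM m (leq_maxl _ _); rewrite /=.
have jm : (j < m)%N by rewrite leq_max ltnSn orbT.
rewrite (bigID (fun i : 'I_m => (i <= j)%N)) /=.
rewrite (bigD1 (Ordinal jm)) //= big1 ?addr0; last first.
  move=> i /andP[ij]; rewrite -val_eqE /= => nij.
  by rewrite IH ?mul0r // ltn_neqAle nij.
set S := \sum_(i | _) _ => hS.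
have SK : cabs S <= K * q ^+ j.+1 * 2.
  apply: le_trans (ler_cabs_sum _ _ _) _.
  apply: le_trans (_ : \sum_(j.+1 <= i < m) K * q ^+ i <= _).
    rewrite -(big_mkord (fun i => ~~ (i <= j)%N)
      (fun i => cabs (c i * (q * s)%:C%C ^+ i))).
    rewrite [leRHS](big_nat_widenl _ 0) //= big_mkcond [leRHS]big_mkcond /=.
    apply: ler_sum => i _; rewrite -ltnNge; case: ifP => // _; rewrite (absT _ _ qs0).
    by rewrite exprMn mulrCA mulrC ler_wpM2r ?exprn_ge0 // ltW.
  rewrite -mulr_sumr -mulrA ler_pM2l //.
  have hq l : \sum_(j.+1 <= i < j.+1 + l) q ^+ i <= q ^+ j.+1 * (2 - 2 * q ^+ l).
    elim: l => [|l IHl].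
      by rewrite addn0 big_geq // expr0 mulr1 subrr mulr0.
    rewrite addnS big_nat_recr ?leq_addr //= exprD (exprS q l).
    have := lerD IHl (lexx (q ^+ j.+1 * q ^+ l)); move/le_trans; apply.
    rewrite -mulrDr ler_pM2l ?exprn_gt0 //.
    have := exprn_ge0 l (ltW q0); set u := q ^+ l => u0; nra.
  have -> : m = (j.+1 + (m - j.+1))%N by rewrite subnKC.
  apply: le_trans (hq _) _; rewrite ler_pM2l ?exprn_gt0 //.
  by rewrite lerBlDr lerDl mulr_ge0 // exprn_ge0 // ltW.
have : cabs (c j * (q * s)%:C%C ^+ j) <= q ^+ j * (e / 2) + K * q ^+ j.+1 * 2.
  rewrite -[X in cabs X](addrK S); apply: le_trans (ler_cabsB _ _) _.
  by rewrite lerD // ltW.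
rewrite (absT _ _ qs0) exprMn exprS.
have -> : q ^+ j * (e / 2) + K * (q * q ^+ j) * 2 =
          q ^+ j * (e / 2 + 2 * K * q) by ring.
rewrite mulrCA ler_pM2l ?exprn_gt0 // mulrC => /le_trans; apply.
lra.
Qed.

Lemma taylor_expansion_lin f g a P Q c :
  taylor_expansion N f a P -> taylor_expansion N g a Q ->
  taylor_expansion N (c *: f + g) a (fun j => c *: P j + Q j).
Proof.
move=> [hP [r r0 Pf]] [hQ [s s0 Qg]]; split.
  by move=> j; exact: homog_poly_lin.
exists (Num.min r s); first by rewrite lt_min r0.
apply/uniform_cabsP => e e0.
pose d := e / (2 * (cabs c + 1)).
have c1 : 0 < cabs c + 1 by rewrite ltr_wpDl ?cabs_ge0.
have d0 : 0 < d by rewrite divr_gt0 ?mulr_gt0.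
have e2 : 0 < e / 2 by rewrite divr_gt0.
move/uniform_cabsP : Pf => /(_ _ d0) Pf.
move/uniform_cabsP : Qg => /(_ _ e2) Qg.
near=> m => x /= ; rewrite lt_min => /andP[xr xs].
under eq_bigr do rewrite /GRing.add /GRing.scale /=.
rewrite big_split /= -scaler_sumr.
have -> : (c *: f + g) x = c * f x + g x by [].
have -> : c * f x + g x - (c *: (\sum_(i < m) P i (x - a))
   + \sum_(i < m) Q i (x - a)) = c * (f x - \sum_(i < m) P i (x - a)) +
  (g x - \sum_(i < m) Q i (x - a)).
  by rewrite /GRing.scale /=; ring.
apply: le_lt_trans (ler_cabsD _ _) _; rewrite Normc.normcM.
have h1 : cabs (f x - \sum_(i < m) P i (x - a)) < d.
  by move: x xr {xs}; near: m.
have h2 : cabs (g x - \sum_(i < m) Q i (x - a)) < e / 2.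
  by move: x xs {xr h1}; near: m.
have h3 : cabs c * cabs (f x - \sum_(i < m) P i (x - a)) <= e / 2.
  apply: le_trans (_ : (cabs c + 1) * d <= _).
    by apply: ler_pM; rewrite ?cabs_ge0 ?lerDl // ltW.
  rewrite le_eqVlt; apply/orP; left; apply/eqP.
  by rewrite /d; field; exact: lt0r_neq0.
lra.
Unshelve. all: by end_near. Qed.

Lemma taylor_expansion0 a : taylor_expansion N 0 a (fun=> 0).
Proof.
split=> [j|]; first exact: homog_poly0.
exists 1 => //; apply/uniform_cabsP => e e0; near=> m => x _.
by rewrite big1 // subr0 Normc.normc0.
Unshelve. all: by end_near. Qed.

Lemma taylor_expansion_unique f a P Q :
  taylor_expansion N f a P -> taylor_expansion N f a Q -> P = Q.
Proof.
move=> hP hQ; have := taylor_expansion_lin (-1) hP hQ.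
rewrite scaleN1r addNr => -[hD [r r0 /uniform_cabsP HD]].
apply/funext => j; apply/funext => x.
set D := (fun j => -1 *: P j + Q j) in hD HD.
suff : D j x = 0 by rewrite /D scaleN1r => /eqP; rewrite addrC subr_eq0 => /eqP.
have Nx1 : 0 < N x + 1 by rewrite ltr_wpDl ?cnorm_ge0.
apply: (@coef0_unique (fun i => D i x) (r / (N x + 1))) => [|t /andP[t0 tr] e e0].
  by rewrite divr_gt0.
apply: filterS (HD e e0) => m /(_ (t%:C%C *: x + a)).
rewrite /= addrK cnormZ cabs_real ?(ltW t0) //.
have ht : t * N x < r.
  apply: le_lt_trans (_ : t * (N x + 1) < r).
    by rewrite ler_pM2l // lerDl.
  by rewrite -ltr_pdivlMr.
move=> /(_ ht); rewrite sub0r cabsN.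
by under eq_bigr do rewrite (homog_polyZ _ _ (hD _)) mulrC.
Qed.

Lemma taylorE f a P : taylor_expansion N f a P -> taylor N f a = P.
Proof. by move=> hP; apply: xget_unique => // Q hQ; exact: taylor_expansion_unique hQ hP. Qed.

Lemma taylorP f a : (exists P, taylor_expansion N f a P) ->
  taylor_expansion N f a (taylor N f a).
Proof. exact: xgetPex. Qed.

Lemma hnorm_ge0 (P : V -> C) : (0 <= hnorm N P)%E.
Proof.
apply: le_trans (_ : (cabs (P 0))%:E <= _)%E; first by rewrite lee_fin cabs_ge0.
by apply: ereal_sup_ubound; exists 0 => //=; rewrite cnorm0.
Qed.

Lemma hnorm0 : hnorm N 0 = 0%E.
Proof.
apply/eqP; rewrite eq_le hnorm_ge0 andbT; apply: ge_ereal_sup => _ [x _ <-].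
by rewrite lee_fin Normc.normc0.
Qed.

Lemma hnorm_lin (P Q : V -> C) c :
  (hnorm N (c *: P + Q)%R <= (cabs c)%:E * hnorm N P + hnorm N Q)%E.
Proof.
apply: ge_ereal_sup => _ [x /= x1 <-].
apply: le_trans (_ : (cabs c * cabs (P x))%:E + (cabs (Q x))%:E <= _)%E.
  by rewrite lee_fin -Normc.normcM ler_cabsD.
apply: leeD; last by apply: ereal_sup_ubound; exists x.
rewrite EFinM lee_wpmul2l ?lee_fin ?cabs_ge0 //.
by apply: ereal_sup_ubound; exists x.
Qed.

End TaylorTheory.

Section ExpSpace.
Context (R : realType) (n : nat) (N : cnorm R n).
Variables (k : \bar R) (A : {nonneg R}).
Local Notation C := R[i].
Local Notation V := 'rV[C]_n.

Lemma exp_weight_ge0 j : 0 <= exp_weight k j.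
Proof. by rewrite /exp_weight; case: k => *; rewrite ?powR_ge0. Qed.

Lemma expnorm_lin (rho : R) (c : C) (f g : V -> C) P Q : 0 <= rho ->
  taylor_expansion N f 0 P -> taylor_expansion N g 0 Q ->
  (expnorm N k rho (c *: f + g)%R
    <= (cabs c)%:E * expnorm N k rho f + expnorm N k rho g)%E.
Proof.
move=> rho0 hP hQ; rewrite /expnorm (taylorE (taylor_expansion_lin c hP hQ)).
rewrite (taylorE hP) (taylorE hQ).
have w0 j : (0 <= (rho ^- j * exp_weight k j)%:E)%E.
  by rewrite lee_fin mulr_ge0 ?exp_weight_ge0 // invr_ge0 exprn_ge0.
have t0 j (S : V -> C) : (0 <= (rho ^- j * exp_weight k j)%:E * hnorm N S)%E.
  by rewrite mule_ge0 // hnorm_ge0.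
rewrite -nneseriesZl; last by move=> *; exact: t0.
rewrite -nneseriesD; first last.
- by move=> *; exact: t0.
- by move=> *; rewrite mule_ge0 ?lee_fin ?cabs_ge0.
apply: lee_nneseries => [j _ _|j _]; first exact: t0.
rewrite muleCA -ge0_muleDr ?mule_ge0 ?hnorm_ge0 ?lee_fin ?cabs_ge0 //.
by rewrite lee_wpmul2l // hnorm_lin.
Qed.

Lemma limn_esup_leP (u : nat -> \bar R) (a : R) :
  (limn_esup u <= a%:E)%E <->
  forall b : R, a < b -> \forall j \near \oo, (u j <= b%:E)%E.
Proof.
split=> [h b ab|h].
  have : (limn_esup u < b%:E)%E by apply: le_lt_trans h _; rewrite lte_fin.
  move=> /ereal_inf_lt [_ [B hB <-]] supB.
  apply: filterS hB => j Bj; apply: le_trans (ltW supB).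
  by apply: ereal_sup_ubound; exists j.
apply/lee_addgt0Pr => e e0.
have hb : a < a + e by rewrite ltrDl.
apply: le_trans (_ : ereal_sup [set u j | j in
    [set j | (u j <= (a + e)%:E)%E]] <= _)%E.
  by apply: ereal_inf_lbound; eexists => //; exact: h.
by apply: ge_ereal_sup => _ [j /= uj <-].
Qed.

Lemma esup_root_lin (u v w : nat -> \bar R) (a c : R) : 0 <= a -> 0 <= c ->
  (forall j, 0 <= u j)%E -> (forall j, 0 <= v j)%E -> (forall j, 0 <= w j)%E ->
  (forall j, w j <= c%:E * u j + v j)%E ->
  (limn_esup (fun j => u j `^ (j%:R^-1)) <= a%:E)%E ->
  (limn_esup (fun j => v j `^ (j%:R^-1)) <= a%:E)%E ->
  (limn_esup (fun j => w j `^ (j%:R^-1)) <= a%:E)%E.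
Proof.
move=> a0 c0 u0 v0 w0 wuv /limn_esup_leP hu /limn_esup_leP hv.
apply/limn_esup_leP => b ab.
pose r := (a + b) / 2.
have ar : a < r by rewrite /r; lra.
have rb : r < b by rewrite /r; lra.
have r0 : 0 < r by apply: le_lt_trans ar.
have b0 : 0 < b by apply: lt_trans rb.
have root (x : \bar R) (j : nat) (d : R) : (0 <= x)%E -> (0 < j)%N -> 0 <= d ->
    (x `^ (j%:R^-1) <= d%:E)%E <-> (x <= (d ^+ j)%:E)%E.
  move=> x0 j0 d0; have jn0 : (j%:R : R) != 0 by rewrite pnatr_eq0 -lt0n.
  have EX : ((d ^+ j)%:E = d%:E `^ (j%:R))%E by rewrite poweR_EFin powR_mulrn.
  split=> h.
    rewrite -[x]poweRe1 // -(mulVf jn0) poweRrM EX.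
    apply: gt0_ler_poweR => //; rewrite ?ler0n // in_itv /= ?poweR_ge0 ?leey //.
    by rewrite lee_fin d0.
  have -> : (d%:E = (d ^+ j)%:E `^ (j%:R^-1))%E.
    by rewrite EX -poweRrM mulfV // poweRe1 // lee_fin.
  apply: gt0_ler_poweR => //; rewrite ?invr_ge0 ?ler0n // in_itv /= ?leey ?x0 //.
  by rewrite lee_fin exprn_ge0.
pose q := b / r - 1.
have q0 : 0 < q by rewrite subr_gt0 ltr_pdivlMr // mul1r.
near=> j.
have j0 : (0 < j)%N by near: j; exact: nbhs_infty_gt.
have ju : (u j <= (r ^+ j)%:E)%E.
  by apply/(root _ _ _ (u0 j) j0 (ltW r0)); near: j; exact: hu.
have jv : (v j <= (r ^+ j)%:E)%E.
  by apply/(root _ _ _ (v0 j) j0 (ltW r0)); near: j; exact: hv.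
apply/(root _ _ _ (w0 j) j0 (ltW b0)).
apply: le_trans (wuv j) _.
apply: le_trans (_ : (c%:E * (r ^+ j)%:E + (r ^+ j)%:E <= _)%E).
  by apply: leeD => //; rewrite lee_wpmul2l // lee_fin.
rewrite -EFinM -EFinD lee_fin.
have jq : c <= j%:R * q.
  rewrite -ler_pdivrMr //; near: j; exact: nbhs_infty_ger.
have bern m : 1 + m%:R * q <= (1 + q) ^+ m.
  elim: m => [|m IH]; first by rewrite mul0r addr0 expr0.
  rewrite exprS; apply: le_trans (_ : (1 + q) * (1 + m%:R * q) <= _).
    have : 0 <= m%:R * q by rewrite mulr_ge0 // ltW.
    by rewrite -natr1; nra.
  by rewrite ler_pM2l // addr_gt0.
have -> : b ^+ j = (1 + q) ^+ j * r ^+ j.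
  by rewrite -exprMn; congr (_ ^+ _); rewrite /q; field; exact: lt0r_neq0.
have bj := bern j.
rewrite -[X in _ + X <= _]mul1r -mulrDl ler_pM2r ?exprn_gt0 //; lra.
Unshelve. all: by end_near. Qed.

Lemma expdom0 : expdom N k A 0.
Proof.
rewrite /expdom; case: k => //=; case: eqP => //= /eqP A0.
by rewrite cnorm0 invr_gt0 lt_neqAle eq_sym A0 /=.
Qed.

Lemma expset_submod : submod_closed [pred f : V -> C | `[< expset N k A f >]].
Proof.
split=> [|c f g /asboolP [fh f0 fg] /asboolP [gh g0 gg]]; apply/asboolP; split.
- by move=> a _; exists (fun=> 0); exact: taylor_expansion0.
- by [].
- have T0 := taylorE (taylor_expansion0 N 0).
  rewrite /exp_growth /expnorm T0; case: (k) => [r rho Arho||rho Arho].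
  + by rewrite eseries0 // => j _ _; rewrite hnorm0 mule0.
  + apply/limn_esup_leP => b Ab; near=> j.
    rewrite hnorm0 poweR0r ?lee_fin; first exact: le_trans (ltW Ab).
    by rewrite invr_eq0 pnatr_eq0 -lt0n; near: j; exact: nbhs_infty_gt.
  + by rewrite eseries0 // => j _ _; rewrite hnorm0 mule0.
- move=> a Da; have [P hP] := fh a Da; have [Q hQ] := gh a Da.
  by eexists; exact: taylor_expansion_lin hP hQ.
- move=> x nx; have -> : (c *: f + g) x = c * f x + g x by [].
  by rewrite f0 // g0 // mulr0 addr0.
- have [P hP] := fh 0 expdom0; have [Q hQ] := gh 0 expdom0.
  have H rho : A%:num < rho -> (expnorm N k rho f < +oo)%E ->
      (expnorm N k rho g < +oo)%E -> (expnorm N k rho (c *: f + g)%R < +oo)%E.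
    move=> Arho hf hg; have rho0 : 0 <= rho by apply: le_trans (ltW Arho).
    apply: le_lt_trans (expnorm_lin c rho0 hP hQ) _.
    apply: lte_add_pinfty; last exact: hg.
    by apply: lte_mul_pinfty; [rewrite lee_fin cabs_ge0|by []|exact: hf].
  move: fg gg H; rewrite /exp_growth; case: (k) => [r||] fg gg H.
  + by move=> rho Arho; apply: H; [|exact: fg|exact: gg].
  + rewrite (taylorE (taylor_expansion_lin c hP hQ)).
    rewrite (taylorE hP) in fg; rewrite (taylorE hQ) in gg.
    apply: (esup_root_lin (c := cabs c)) fg gg.
    * by [].
    * exact: cabs_ge0.
    * by move=> j; exact: hnorm_ge0.
    * by move=> j; exact: hnorm_ge0.
    * by move=> j; exact: hnorm_ge0.
    * by move=> j; exact: hnorm_lin.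
  + by move=> rho Arho; apply: H; [|exact: fg|exact: gg].
Unshelve. all: by end_near. Qed.

Record Exp := MkExp { exp_fun :> V -> C ; _ : `[< expset N k A exp_fun >] }.

HB.instance Definition _ := [isSub for exp_fun].
HB.instance Definition _ := [Choice of Exp by <:].
HB.instance Definition _ :=
  GRing.SubChoice_isSubLmodule.Build C (V -> C) _ Exp expset_submod.
HB.instance Definition _ := isPointed.Build Exp 0.

(* The topology given by the seminorms expnorm rho, rho > A: all the balls
   of these seminorms form a subbase of open sets. *)
HB.instance Definition _ := isSubBaseTopological.Build Exp
  [set i : Exp * R * R | A%:num < i.1.2 /\ 0 < i.2]
  (fun i => [set f : Exp | (expnorm N k i.1.2 (f - i.1.1)%R < i.2%:E)%E]).

(* The equation d(Lf)(.)a = L(df(.)a): df(.)a is the element g of Exp that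
   coincides with the directional derivative on the domain of f. *)
Definition convolution_operator (L : Exp -> Exp) : Prop :=
  [/\ linear L, continuous L &
    forall (a : V) (f g : Exp),
      (forall x, expdom N k A x -> g x = 'D_a f x) ->
      forall x, expdom N k A x -> L g x = 'D_a (L f) x].

Definition nontrivial_operator (L : Exp -> Exp) : Prop :=
  ~ exists c : C, forall f, L f = c *: f.

End ExpSpace.

Definition mixing (T : topologicalType) (F : T -> T) : Prop :=
  forall U W : set T, open U -> U !=set0 -> open W -> W !=set0 ->
    exists n0 : nat, forall m, (n0 <= m)%N -> (iter m F @` U) `&` W !=set0.

(* Main.v *)
Require Import Defs.
From mathcomp Require Import all_boot all_order all_algebra.
From mathcomp Require Import all_classical all_reals all_analysis.
From mathcomp Require Import complex ring lra.
From mathcomp Require Import -(notations) mpoly.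
Import Order.TTheory GRing.Theory Num.Theory.
Import numFieldNormedType.Exports.
Set Implicit Arguments.
Unset Strict Implicit.
Unset Printing Implicit Defensive.
Local Open Scope classical_set_scope.
Local Open Scope ring_scope.

(** Write [phi c x] for the sum of the [c_i x_i].  Since [k > 1], the weights of
    the seminorms are small with respect to [j!], so every exponential
    [e^(phi c)] lies in [Exp] ([exp_weight_fact], [restrict_mexp_expset]).  A
    convolution operator [L] commutes with directional derivatives, hence
    [L e^(phi c)] solves the same first order equations as [e^(phi c)] and is
    [symbol c] times it ([conv_expc]).  On every complex line the symbol is an
    entire function of one variable ([symbol_expands]).  If the symbol were
    constant, [L] would be a scalar on the exponentials, whose span is dense,
    hence everywhere ([conv_scalar]).  A nontrivial [L] thus has a symbol that
    is nonconstant on some line, and by Liouville's theorem, applied to the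
    symbol and to its inverse, it takes values of modulus less than 1 and of
    modulus greater than 1 ([entire_value_lt1], [entire_value_gt1]).  The set
    of the [c] with [`|symbol c| < 1], as well as that with [`|symbol c| > 1],
    is nonempty and open along every line, which suffices for its exponentials
    to span a dense subspace ([expc_dense]).

    Mixing follows as in the criteria of Kitai and of Godefroy and Shapiro
    ([conv_mixing]).  Given nonempty open sets [U] and [W], take [x] in [U] in
    the span of the exponentials with [`|symbol c| < 1], and [y] in [W] in the
    span of those with [`|symbol c| > 1].  Then [L^m x] tends to 0, and
    [y = L^m y_m] where [y_m] tends to 0; so [x + y_m] is in [U] and its image
    by [L^m] is in [W] for all large [m].

    The seminorms of [Exp] only depend on the Taylor sequence at 0, so the
    approximation arguments are carried out on sequences of homogeneous
    polynomials ([snorm], [mexp_taylor]); an identity theorem ([exp_ext])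
    leads back to functions.  The complex analysis in one variable rests on
    power series alone: the power series of the symbol at each point of a line
    is the image by [L] of the expansion of [e^(phi (c + t b))] in powers of
    [t], and Liouville's theorem comes from the maximum principle, which only
    needs the leading term of a function at each point. *)

(** * Convergent series of complex numbers *)

Section CSum.
Context (R : realType).
Local Notation C := R[i].
Implicit Types (c d : nat -> C) (w z : C).

(** A relation rather than a limit operator: convergence and value are proved
    together. *)
Definition csum c w := forall e : R, 0 < e ->
  \forall m \near \oo, cabs (w - \sum_(j < m) c j) < e.

Lemma cabs0 : cabs (0 : C) = 0. Proof. exact: Normc.normc0. Qed.
Lemma cabs1 : cabs (1 : C) = 1. Proof. exact: Normc.normc1. Qed.
Lemma cabsM z w : cabs (z * w) = cabs z * cabs w.
Proof. exact: Normc.normcM. Qed.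
Lemma cabsV z : cabs z^-1 = (cabs z)^-1. Proof. exact: Normc.normcV. Qed.
Lemma cabs_eq0 z : (cabs z == 0) = (z == 0).
Proof.
by apply/eqP/eqP => [/Normc.eq0_normc|->]; rewrite ?cabs0.
Qed.
Lemma cabs_gt0 z : (0 < cabs z) = (z != 0).
Proof. by rewrite lt_neqAle cabs_ge0 andbT eq_sym cabs_eq0. Qed.
Lemma cabsBC z w : cabs (z - w) = cabs (w - z).
Proof. by rewrite -cabsN opprB. Qed.
Lemma cabs_nat m : cabs (m%:R : C) = m%:R.
Proof. by rewrite -(rmorph_nat (real_complex R)) cabs_real. Qed.

Lemma ler_cabs_tri z w : cabs z <= cabs w + cabs (z - w).
Proof. by rewrite -[X in cabs X <= _](subrKC w); exact: ler_cabsD. Qed.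

Lemma Re_le_cabs z : `|complex.Re z| <= cabs z.
Proof.
case: z => a b /=; rewrite -sqrtr_sqr ler_wsqrtr //.
by rewrite lerDl sqr_ge0.
Qed.

Lemma Im_le_cabs z : `|complex.Im z| <= cabs z.
Proof.
case: z => a b /=; rewrite -sqrtr_sqr ler_wsqrtr //.
by rewrite lerDr sqr_ge0.
Qed.

Lemma cabs_le_ReIm z : cabs z <= `|complex.Re z| + `|complex.Im z|.
Proof.
case: z => a b /=; rewrite -[leRHS]ger0_norm ?addr_ge0 // -sqrtr_sqr.
rewrite ler_wsqrtr // sqrrD !real_normK ?num_real //.
by have : 0 <= `|a| * `|b| by []; lra.
Qed.

Lemma sum_half_nat (m M : nat) :
  \sum_(m <= j < M) (2^-1 : R) ^+ j <= 2 * 2^-1 ^+ m.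
Proof.
have [Mm|mM] := leqP M m.
  by rewrite big_geq // mulr_ge0 // exprn_ge0 // invr_ge0.
have hq l : \sum_(m <= j < m + l) (2^-1 : R) ^+ j
    = 2 * 2^-1 ^+ m - 2 * 2^-1 ^+ (m + l).
  elim: l => [|l IH]; first by rewrite addn0 big_geq // subrr.
  rewrite addnS big_nat_recr ?leq_addr //= IH exprS.
  by field.
rewrite -(subnKC (ltnW mM)) hq lerBlDr lerDl.
by rewrite mulr_ge0 // exprn_ge0 // invr_ge0.
Qed.

Lemma sum_half_ord M : \sum_(j < M) (2^-1 : R) ^+ j <= 2.
Proof.
by have := sum_half_nat 0 M; rewrite big_mkord expr0 mulr1.
Qed.

Lemma half_ge0 m : 0 <= (2^-1 : R) ^+ m.
Proof. by rewrite exprn_ge0 // invr_ge0. Qed.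

Lemma half_small (e : R) : 0 < e -> \forall m \near \oo, (2^-1 : R) ^+ m < e.
Proof.
move=> e0; have h : `|2^-1 : R| < 1 by rewrite ger0_norm; lra.
have /cvgrPdist_lt /(_ e e0) := cvg_expr h.
by apply: filterS => m; rewrite sub0r normrN ger0_norm // half_ge0.
Qed.

Lemma csum_ext c d w : c =1 d -> csum c w -> csum d w.
Proof. by move=> /funext ->. Qed.

Lemma csum_unique c w z : csum c w -> csum c z -> w = z.
Proof.
move=> hw hz; apply/eqP; rewrite -subr_eq0 -cabs_eq0 eq_le cabs_ge0 andbT.
apply/ler_addgt0Pr => e e0; rewrite add0r.
have e2 : 0 < e / 2 by lra.
have [m [H1 H2]] : exists m, cabs (w - \sum_(j < m) c j) < e / 2 /\
    cabs (z - \sum_(j < m) c j) < e / 2.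
  by near \oo => m; exists m; split; near: m; [exact: hw|exact: hz].
have -> : w - z = (w - \sum_(j < m) c j) - (z - \sum_(j < m) c j) by ring.
apply: le_trans (ler_cabsB _ _) _; lra.
Unshelve. all: by end_near. Qed.

Lemma csum_lin (a b : C) c d w z : csum c w -> csum d z ->
  csum (fun j => a * c j + b * d j) (a * w + b * z).
Proof.
move=> hw hz e e0.
pose K := cabs a + cabs b + 1.
have K0 : 0 < K by rewrite ltr_wpDl // addr_ge0 // cabs_ge0.
have e2 : 0 < e / (2 * K) by rewrite divr_gt0 // mulr_gt0.
near=> m.
have h1 : cabs (w - \sum_(j < m) c j) < e / (2 * K) by near: m; exact: hw.
have h2 : cabs (z - \sum_(j < m) d j) < e / (2 * K) by near: m; exact: hz.
rewrite big_split /= -!mulr_sumr.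
have -> : a * w + b * z - (a * \sum_(i < m) c i + b * \sum_(i < m) d i) =
  a * (w - \sum_(i < m) c i) + b * (z - \sum_(i < m) d i) by ring.
apply: le_lt_trans (ler_cabsD _ _) _; rewrite !cabsM.
have h3 : cabs a * cabs (w - \sum_(j < m) c j) <= K * (e / (2 * K)).
  apply: ler_pM; rewrite ?cabs_ge0 ?ltW // /K.
  by have := cabs_ge0 b; lra.
have h4 : cabs b * cabs (z - \sum_(j < m) d j) <= cabs b * (e / (2 * K)).
  by apply: ler_wpM2l; rewrite ?cabs_ge0 ?ltW.
have h5 : cabs a * cabs (w - \sum_(j < m) c j) <= cabs a * (e / (2 * K)).
  by apply: ler_wpM2l; rewrite ?cabs_ge0 ?ltW.
have h6 : K * (e / (2 * K)) = e / 2 by field; exact: lt0r_neq0.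
have : (cabs a + cabs b) * (e / (2 * K)) <= K * (e / (2 * K)).
  by rewrite ler_pM2r // /K lerDl.
lra.
Unshelve. all: by end_near. Qed.

Lemma csumZ (a : C) c w : csum c w -> csum (fun j => a * c j) (a * w).
Proof.
move=> hw; have := csum_lin a 0 hw hw; rewrite mul0r addr0.
by under [X in csum X]eq_fun do rewrite mul0r addr0.
Qed.

(** Every tail estimate below is a comparison with the geometric series of
    ratio 1/2. *)
Lemma csum_le c w (K : R) m : csum c w ->
  (forall j, (m <= j)%N -> cabs (c j) <= K * 2^-1 ^+ j) ->
  cabs (w - \sum_(j < m) c j) <= 2 * K * 2^-1 ^+ m.
Proof.
move=> hw hc; apply/ler_addgt0Pr => e e0.
have K0 : 0 <= K.
  by have := le_trans (cabs_ge0 _) (hc m (leqnn m)); rewrite pmulr_lge0 ?exprn_gt0.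
near \oo => M.
have mM : (m <= M)%N by near: M; exact: nbhs_infty_ge.
have h1 : cabs (w - \sum_(j < M) c j) < e by near: M; exact: hw.
have -> : w - \sum_(j < m) c j = (w - \sum_(j < M) c j) + \sum_(m <= j < M) c j.
  rewrite -!(big_mkord xpredT c) (big_cat_nat (leq0n _) mM) /=; ring.
apply: le_trans (ler_cabsD _ _) _.
rewrite addrC lerD // ?(ltW h1) //; apply: le_trans (ler_cabs_sum _ _ _) _.
apply: le_trans (_ : \sum_(m <= j < M) K * 2^-1 ^+ j <= _).
  by rewrite big_nat [leRHS]big_nat; apply: ler_sum => j /andP[mj _]; exact: hc.
by rewrite -mulr_sumr (mulrC 2) -mulrA ler_wpM2l // sum_half_nat.
Unshelve. all: by end_near. Qed.

Lemma csum_bounded c w : csum c w -> exists K, 0 <= K /\ forall j, cabs (c j) <= K.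
Proof.
move=> hw; have [M _ HM] := hw 1 ltr01.
pose T := \sum_(i < M) cabs (c i).
have T0 : 0 <= T by apply: sumr_ge0 => *; exact: cabs_ge0.
exists (2 + T); split; first by lra.
move=> j; have [jM|Mj] := ltnP j M.
  rewrite /T (bigD1 (Ordinal jM)) //= addrCA lerDl addr_ge0 //.
  by apply: sumr_ge0 => *; exact: cabs_ge0.
have h1 := HM j Mj; have h2 := HM j.+1 (leqW Mj); rewrite /= in h1 h2.
have -> : c j = (w - \sum_(l < j) c l) - (w - \sum_(l < j.+1) c l).
  by rewrite big_ord_recr /=; ring.
apply: le_trans (ler_cabsB _ _) _; lra.
Qed.

(** The series of real parts and the series of imaginary parts converge
    absolutely. *)
Lemma csum_exists c (K : R) :
  (forall j, cabs (c j) <= K * 2^-1 ^+ j) -> exists w, csum c w.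
Proof.
move=> hc.
have cvgu (u : nat -> R) : (forall j, `|u j| <= cabs (c j)) ->
    cvgn (series u).
  move=> hu; apply: normed_cvg.
  apply: (@series_le_cvg _ _ (geometric K 2^-1)) => [j|j|j|].
  - exact: normr_ge0.
  - by apply: le_trans (hc j); exact: cabs_ge0.
  - exact: le_trans (hu j) (hc j).
  - by apply: is_cvg_geometric_series; rewrite ger0_norm; lra.
have hR := cvgu (fun j => complex.Re (c j)) (fun j => Re_le_cabs _).
have hI := cvgu (fun j => complex.Im (c j)) (fun j => Im_le_cabs _).
move: hR hI => /cvg_ex[a /cvgrPdist_lt ha] /cvg_ex[b /cvgrPdist_lt hb].
exists (Complex a b) => e e0; have e2 : 0 < e / 2 by lra.
near=> m.
have h1 : `|a - series (fun j => complex.Re (c j)) m| < e / 2.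
  by near: m; exact: ha.
have h2 : `|b - series (fun j => complex.Im (c j)) m| < e / 2.
  by near: m; exact: hb.
have -> : \sum_(j < m) c j = Complex (series (fun j => complex.Re (c j)) m)
     (series (fun j => complex.Im (c j)) m).
  rewrite /series /= !big_mkord.
  elim/big_rec3 : _ => // i x y z _ ->.
  by case: (c i).
apply: le_lt_trans (cabs_le_ReIm _) _ => /=; lra.
Unshelve. all: by end_near. Qed.

Lemma csum_recl c w : csum c w -> csum (fun j => c j.+1) (w - c 0%N).
Proof.
move=> hw e e0; have [M _ HM] := hw e e0; exists M => //= m Mm.
have := HM m.+1 (leqW Mm); rewrite big_ord_recl /= opprD addrA.
by under [X in _ - X]eq_bigr do rewrite /bump leq0n add1n.
Qed.

Lemma csum_finite c m : (forall j, (m <= j)%N -> c j = 0) ->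
  csum c (\sum_(j < m) c j).
Proof.
move=> hc e e0; exists m => // M /= mM.
rewrite -!(big_mkord xpredT c) (big_cat_nat (leq0n _) mM) /=.
have -> : \sum_(m <= i < M) c i = 0.
  by rewrite big_nat big1 // => j /andP[mj _]; exact: hc.
by rewrite addr0 subrr cabs0.
Qed.

(** * The complex exponential *)

Lemma pow_fact_le (T : R) j : 0 <= T -> T ^+ j / j`!%:R <= expR T.
Proof.
move=> T0; case: j => [|j]; first by rewrite expr0 fact0 divr1 -expR0 ler_expR.
by have := expR_ge1Dxn j T0; lra.
Qed.

(** Doubling [T] turns the boundedness of [T ^+ j / j`!] into geometric decay. *)
Lemma pow_fact_half (T : R) j : 0 <= T ->
  T ^+ j / j`!%:R <= expR (2 * T) * 2^-1 ^+ j.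
Proof.
move=> T0; have T20 : 0 <= 2 * T by lra.
have := @pow_fact_le _ j T20; rewrite -(ler_pM2r (exprn_gt0 j (_ : 0 < 2^-1))) //.
apply: le_trans; rewrite exprMn mulrAC (mulrAC (2 ^+ j)) -exprMn mulfV //.
by rewrite expr1n mul1r.
Qed.

Lemma cabs_fact (z : C) j : cabs (z ^+ j / j`!%:R) = cabs z ^+ j / j`!%:R.
Proof. by rewrite cabsM cabsX cabsV cabs_nat. Qed.

Lemma cabs_fact_half (z : C) (T : R) j : cabs z <= T ->
  cabs (z ^+ j / j`!%:R) <= expR (2 * T) * 2^-1 ^+ j.
Proof.
move=> zT; have T0 : 0 <= T by apply: le_trans zT; exact: cabs_ge0.
rewrite cabs_fact; apply: le_trans (pow_fact_half j T0).
by rewrite ler_pM2r ?invr_gt0 ?ltr0n ?fact_gt0 // lerXn2r ?nnegrE ?cabs_ge0.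
Qed.

Lemma cexp_exists (z : C) : exists w, csum (fun j => z ^+ j / j`!%:R) w.
Proof.
by apply: csum_exists => j; exact: (@cabs_fact_half _ (cabs z)).
Qed.

Definition cexp (z : C) : C := sval (cid (cexp_exists z)).

Lemma cexpE z : csum (fun j => z ^+ j / j`!%:R) (cexp z).
Proof. by rewrite /cexp; case: cid. Qed.

(** Both sides run over the pairs [(i, j)] with [i + j < m]. *)
Lemma triangle_sum (F : nat -> nat -> C) m :
  \sum_(l < m) \sum_(i < l.+1) F i (l - i)%N =
  \sum_(i < m) \sum_(j < m - i) F i j.
Proof.
elim: m => [|m IH]; first by rewrite !big_ord0.
rewrite big_ord_recr /= IH.
transitivity (\sum_(i < m.+1) (\sum_(j < m - i) F i j + F i (m - i)%N)).
  by rewrite big_split /= [in RHS]big_ord_recr /= subnn big_ord0 addr0.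
apply: eq_bigr => i _; rewrite subSn; last by rewrite -ltnS.
by rewrite big_ord_recr.
Qed.

(** The binomial theorem in terms of divided powers. *)
Lemma exprD_fact (z w : C) l :
  (z + w) ^+ l / l`!%:R =
  \sum_(i < l.+1) (z ^+ i / i`!%:R) * (w ^+ (l - i) / (l - i)`!%:R).
Proof.
have F0 i : (i`!%:R : C) != 0 by rewrite pnatr_eq0 -lt0n fact_gt0.
rewrite addrC exprDn big_distrl /=; apply: eq_bigr => i _.
have il : (i <= l)%N by rewrite -ltnS.
have : ('C(l, i) * (i`! * (l - i)`!))%:R = l`!%:R :> C by rewrite bin_fact.
rewrite !natrM => <-; rewrite -mulr_natr.
have B0 : ('C(l, i)%:R : C) != 0 by rewrite pnatr_eq0 -lt0n bin_gt0.
by field; rewrite !F0 B0.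
Qed.

Lemma cabs_mulB (z w a b : C) (d : R) : d <= 1 ->
  cabs (z - a) <= d -> cabs (w - b) <= d ->
  cabs (z * w - a * b) <= (cabs z + cabs w + 1) * d.
Proof.
move=> d1 za wb.
have -> : z * w - a * b = (z - a) * w + a * (w - b) by ring.
apply: le_trans (ler_cabsD _ _) _; rewrite !cabsM.
have hd : 0 <= d by apply: le_trans za; exact: cabs_ge0.
have aB : cabs a <= cabs z + 1.
  apply: le_trans (ler_cabs_tri a z) _; rewrite lerD2l cabsBC.
  exact: le_trans za d1.
have h1 : cabs (z - a) * cabs w <= cabs w * d.
  by rewrite mulrC ler_wpM2l ?cabs_ge0.
have h2 : cabs a * cabs (w - b) <= (cabs z + 1) * d.
  by apply: ler_pM; rewrite ?cabs_ge0.
have -> : (cabs z + cabs w + 1) * d = cabs w * d + (cabs z + 1) * d by ring.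
exact: lerD.
Qed.

(** Cauchy product.  The product of two partial sums of length [m] and the
    partial sum at [z + w] differ by the terms of index [(i, j)] with
    [i + j >= m], and each of these is at most [K^2 4^-i 4^-j]. *)
Lemma cexpD (z w : C) : cexp (z + w) = cexp z * cexp w.
Proof.
apply: csum_unique (cexpE _) _ => e e0.
pose T := Num.max (cabs z) (cabs w); pose K := expR (2 * (2 * T)).
have T0 : 0 <= T by rewrite le_max cabs_ge0.
have K0 : 0 < K by exact: expR_gt0.
pose ez j := z ^+ j / j`!%:R; pose ew j := w ^+ j / j`!%:R.
have quart (u : C) j : cabs u <= T ->
    cabs (u ^+ j / j`!%:R) <= K * 2^-1 ^+ j * 2^-1 ^+ j.
  move=> uT; have := @cabs_fact_half (2%:R * u) (2 * T) j.
  rewrite cabsM cabs_nat ler_pM2l // => /(_ uT).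
  rewrite exprMn -[_ / _]mulrA [cabs (2 ^+ j * _)]cabsM.
  rewrite [cabs (2 ^+ j)]cabsX (cabs_nat 2).
  rewrite -(ler_pM2r (exprn_gt0 j (_ : 0 < 2^-1))) //; apply: le_trans.
  by rewrite mulrAC -exprMn mulfV // expr1n mul1r.
have hz j : cabs (ez j) <= K * 2^-1 ^+ j * 2^-1 ^+ j.
  by apply: quart; rewrite /T le_max lexx.
have hw j : cabs (ew j) <= K * 2^-1 ^+ j * 2^-1 ^+ j.
  by apply: quart; rewrite /T le_max lexx orbT.
have D m : cabs ((\sum_(i < m) ez i) * (\sum_(j < m) ew j) -
    \sum_(l < m) (z + w) ^+ l / l`!%:R) <= 4 * K ^+ 2 * 2^-1 ^+ m.
  under [X in _ - X]eq_bigr do rewrite exprD_fact.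
  rewrite (triangle_sum (fun i j => ez i * ew j)) big_distrl /= -sumrB.
  apply: le_trans (ler_cabs_sum _ _ _) _.
  apply: le_trans (_ : \sum_(i < m) K * 2^-1 ^+ i * (2 * K * 2^-1 ^+ m) <= _).
    apply: ler_sum => i _; rewrite -mulr_sumr -mulrBr cabsM.
    have -> : \sum_(j < m) ew j - \sum_(j < m - i) ew j =
        \sum_(m - i <= j < m) ew j.
      rewrite -!(big_mkord xpredT ew) (big_cat_nat (leq0n _) (leq_subr i m)) /=.
      by ring.
    apply: le_trans (_ : K * 2^-1 ^+ i * 2^-1 ^+ i *
       \sum_(m - i <= j < m) (K * 2^-1 ^+ (m - i) * 2^-1 ^+ j) <= _).
      apply: ler_pM; rewrite ?cabs_ge0 ?hz //.
      apply: le_trans (ler_cabs_sum _ _ _) _.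
      rewrite big_nat [leRHS]big_nat; apply: ler_sum => j /andP[mj _].
      apply: le_trans (hw j) _; rewrite ler_wpM2r ?half_ge0 //.
      rewrite ler_wpM2l ?(ltW K0) // ler_wiXn2l ?invr_ge0 //; lra.
    rewrite -mulr_sumr -[leLHS]mulrA ler_wpM2l ?mulr_ge0 ?half_ge0 ?(ltW K0) //.
    apply: le_trans (_ : 2^-1 ^+ i * (K * 2^-1 ^+ (m - i) * 2) <= _).
      rewrite ler_wpM2l ?half_ge0 // ler_wpM2l ?mulr_ge0 ?half_ge0 ?(ltW K0) //.
      apply: le_trans (sum_half_nat _ _) _.
      rewrite ler_piMr // exprn_ile1 ?invr_ge0 //; lra.
    have -> : 2^-1 ^+ m = 2^-1 ^+ i * 2^-1 ^+ (m - i) :> R.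
      by rewrite -exprD subnKC // ltnW.
    by rewrite le_eqVlt; apply/orP; left; apply/eqP; ring.
  rewrite -mulr_suml -mulr_sumr.
  apply: le_trans (_ : K * 2 * (2 * K * 2^-1 ^+ m) <= _).
    rewrite ler_wpM2r ?mulr_ge0 ?half_ge0 ?(ltW K0) // ler_wpM2l ?(ltW K0) //.
    exact: sum_half_ord.
  by rewrite le_eqVlt; apply/orP; left; apply/eqP; ring.
have := cexpE w; have := cexpE z; move: (cexp z) (cexp w) => x y hx hy.
pose B := cabs x + cabs y + 1.
have B0 : 0 < B by rewrite ltr_wpDl // addr_ge0 // cabs_ge0.
have e1 : 0 < e / (2 * B) by rewrite divr_gt0 // mulr_gt0.
pose d := Num.min 1 (e / (2 * B)).
have d0 : 0 < d by rewrite lt_min ltr01 e1.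
have e2 : 0 < e / (8 * K ^+ 2) by rewrite divr_gt0 // mulr_gt0 // exprn_gt0.
near=> m.
have h1 : cabs (x - \sum_(j < m) ez j) < d by near: m; exact: hx.
have h2 : cabs (y - \sum_(j < m) ew j) < d by near: m; exact: hy.
have h3 : (2^-1 : R) ^+ m < e / (8 * K ^+ 2) by near: m; exact: half_small.
have h4 := D m.
have d1 : d <= 1 by rewrite ge_min lexx.
have := cabs_mulB d1 (ltW h1) (ltW h2).
have Bd : B * d <= e / 2.
  apply: le_trans (_ : B * (e / (2 * B)) <= _).
    by rewrite ler_pM2l // ge_min lexx orbT.
  by rewrite le_eqVlt; apply/orP; left; apply/eqP; field; exact: lt0r_neq0.
have h5 : 4 * K ^+ 2 * 2^-1 ^+ m < e / 2.
  have -> : e / 2 = 4 * K ^+ 2 * (e / (8 * K ^+ 2)).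
    by field; exact: lt0r_neq0.
  by rewrite ltr_pM2l // mulr_gt0 // exprn_gt0.
move/le_trans => /(_ _ Bd) h6.
rewrite -(subrKA ((\sum_(j < m) ez j) * (\sum_(j < m) ew j))).
apply: le_lt_trans (ler_cabsD _ _) _.
rewrite [ltRHS]splitr; apply: ler_ltD => //; exact: (le_lt_trans h4 h5).
Unshelve. all: by end_near. Qed.

Lemma cexp_tail (z : C) (T : R) m : cabs z <= T ->
  cabs (cexp z - \sum_(j < m) z ^+ j / j`!%:R) <=
    2 * expR (2 * T) * 2^-1 ^+ m.
Proof. by move=> zT; apply: csum_le (cexpE _) _ => j _; exact: cabs_fact_half. Qed.

End CSum.

(** * Power series and leading terms in one complex variable *)

Section LocalOrder.
Context (R : realType).
Local Notation C := R[i].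
Implicit Types (F H g : C -> C) (a c : C).

(** [F] is given at [a] by a power series of infinite radius of convergence. *)
Definition expands F a := exists d : nat -> C,
  forall s, csum (fun j => d j * s ^+ j) (F (a + s)).

(** [c s^m] is the leading term of [H] at 0: the error has order [m + 1]. *)
Definition leads H m c := exists K d : R, 0 < d /\
  forall s, cabs s <= d -> cabs (H s - c * s ^+ m) <= K * cabs s ^+ m.+1.

Lemma csum_pow_bounded (d : nat -> C) (s w : C) :
  csum (fun j => d j * s ^+ j) w ->
  exists K, 0 <= K /\ forall j, cabs (d j) * cabs s ^+ j <= K.
Proof.
move=> /csum_bounded[K [K0 HK]]; exists K; split => // j.
by rewrite -cabsX -cabsM.
Qed.

(** The terms of index greater than [m] are bounded at radius [r], hence their
    sum at [s] is of order [(|s| / r)^(m + 1)]. *)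
Lemma csum_leads (d : nat -> C) H m (r : R) : 0 < r ->
  (forall s, cabs s <= r -> csum (fun j => d j * s ^+ j) (H s)) ->
  (forall j, (j < m)%N -> d j = 0) -> leads H m (d m).
Proof.
move=> r0 hd dm; have [|K [K0 HK]] := @csum_pow_bounded d r%:C%C (H r%:C%C).
  by apply: hd; rewrite cabs_real // ltW.
rewrite cabs_real ?(ltW r0) // in HK.
exists (2 * K / r ^+ m.+1), (r / 2); split; first by rewrite divr_gt0.
move=> s sr; have sr' : cabs s <= r by apply: le_trans sr _; lra.
have -> : d m * s ^+ m = \sum_(j < m.+1) d j * s ^+ j.
  by rewrite big_ord_recr /= big1 ?add0r // => j _; rewrite dm ?mul0r.
pose L := K * (cabs s / r) ^+ m.+1 * 2 ^+ m.+1.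
have L0 : 0 <= L by rewrite !mulr_ge0 ?exprn_ge0 // divr_ge0 ?cabs_ge0 // ltW.
apply: le_trans (_ : 2 * L * 2^-1 ^+ m.+1 <= _).
  apply: csum_le (hd s sr') _ => j mj.
  rewrite cabsM cabsX -(subnKC mj).
  set l := (j - m.+1)%N.
  have -> : L * 2^-1 ^+ (m.+1 + l) = K * (cabs s / r) ^+ m.+1 * 2^-1 ^+ l.
    rewrite /L exprD mulrA -[X in X * 2^-1 ^+ l]mulrA -exprMn mulfV //.
    by rewrite expr1n mulr1.
  have -> : cabs (d (m.+1 + l)%N) * cabs s ^+ (m.+1 + l) =
     (cabs (d (m.+1 + l)%N) * r ^+ (m.+1 + l)) *
       ((cabs s / r) ^+ m.+1 * (cabs s / r) ^+ l).
    rewrite -exprD expr_div_n mulrA mulrAC mulfK // expf_neq0 //.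
    exact: lt0r_neq0.
  rewrite -[leRHS]mulrA; apply: ler_pM;
      rewrite ?HK ?mulr_ge0 ?exprn_ge0 ?cabs_ge0 ?divr_ge0 ?cabs_ge0 ?(ltW r0) //.
  rewrite ler_wpM2l ?exprn_ge0 ?divr_ge0 ?cabs_ge0 ?(ltW r0) //.
  rewrite lerXn2r ?nnegrE ?divr_ge0 ?cabs_ge0 ?(ltW r0) ?invr_ge0 //.
  by rewrite ler_pdivrMr // mulrC.
rewrite /L -!mulrA -exprMn mulfV // expr1n mulr1 expr_div_n.
by rewrite (mulrC (cabs s ^+ _)).
Qed.

Lemma leads_div H g m c (g0 : C) (K' : R) : g0 != 0 -> leads H m c ->
  (exists2 d' : R, 0 < d' & forall s, cabs s <= d' -> cabs (g s - g0) <= K' *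
      cabs s) ->
  leads (fun s => H s / g s) m (c / g0).
Proof.
move=> g00 [K [d [d0 Hd]]] [d' d'0 gd].
have G0 : 0 < cabs g0 by rewrite cabs_gt0.
pose K1 := `|K'| + 1.
have K10 : 0 < K1 by rewrite ltr_wpDl.
exists ((cabs g0 * K + cabs c * K1) / (cabs g0 * (cabs g0 / 2))).
exists (Num.min (Num.min d d') (cabs g0 / (2 * K1))).
have e0 : 0 < cabs g0 / (2 * K1) by rewrite divr_gt0 // mulr_gt0.
split; first by rewrite !lt_min d0 d'0.
move=> s; rewrite !le_min => /andP[/andP[sd sd'] sg].
have gs : cabs (g s - g0) <= K1 * cabs s.
  apply: le_trans (gd s sd') _; rewrite ler_wpM2r ?cabs_ge0 // /K1.
  by apply: le_trans (ler_norm _) _; rewrite lerDl.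
have gs2 : cabs g0 / 2 <= cabs (g s).
  have h : K1 * cabs s <= cabs g0 / 2.
    apply: le_trans (ler_wpM2l (ltW K10) sg) _.
    by rewrite le_eqVlt; apply/orP; left; apply/eqP; field; exact: lt0r_neq0.
  by have := ler_cabs_tri g0 (g s); rewrite cabsBC; lra.
have gs0 : 0 < cabs (g s) by apply: lt_le_trans gs2; rewrite divr_gt0.
have gsn : g s != 0 by rewrite -cabs_gt0.
have -> : H s / g s - c / g0 * s ^+ m =
   (g0 * (H s - c * s ^+ m) - c * s ^+ m * (g s - g0)) / (g0 * g s).
  by field; rewrite g00 gsn.
rewrite cabsM cabsV cabsM ler_pdivrMr ?mulr_gt0 //.
apply: le_trans (ler_cabsB _ _) _.
rewrite !cabsM cabsX.
have h1 := Hd s sd.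
have h2 : cabs g0 * cabs (H s - c * s ^+ m) <= cabs g0 * K * cabs s ^+ m.+1.
  by rewrite -mulrA ler_wpM2l ?cabs_ge0.
have h3 : cabs c * cabs s ^+ m * cabs (g s - g0) <= cabs c * K1 * cabs s ^+ m.+1.
  apply: le_trans (_ : cabs c * cabs s ^+ m * (K1 * cabs s) <= _).
    by rewrite ler_wpM2l // mulr_ge0 ?exprn_ge0 ?cabs_ge0.
  by rewrite le_eqVlt exprS; apply/orP; left; apply/eqP; ring.
apply: le_trans (lerD h2 h3) _; rewrite -mulrDl.
set T := _ + _; have T0 : 0 <= T * cabs s ^+ m.+1.
  rewrite /T mulrDl; apply: addr_ge0; last first.
    by rewrite !mulr_ge0 ?exprn_ge0 ?cabs_ge0 // ltW.
  by apply: le_trans h2; rewrite mulr_ge0 ?cabs_ge0.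
have -> : T / (cabs g0 * (cabs g0 / 2)) * cabs s ^+ m.+1 * (cabs g0 * cabs (g s))
  = T * cabs s ^+ m.+1 * (cabs (g s) / (cabs g0 / 2)).
  by field; exact: lt0r_neq0.
by rewrite ler_peMr // ler_pdivlMr ?divr_gt0 // mul1r.
Qed.

(** The leading term is that of the first nonzero coefficient. *)
Lemma expands_leads F a : expands F a ->
  (forall z, F z = 0) \/ exists m c, c != 0 /\ leads (fun s => F (a + s)) m c.
Proof.
move=> [d hd]; have [d0|/existsNP[j dj]] := pselect (forall j, d j = 0).
  left=> z; apply: csum_unique (_ : csum (fun j => d j * (z - a) ^+ j) _) _.
    by have := hd (z - a); rewrite subrKC.
  move=> e e0; near=> m; rewrite big1 ?subrr ?cabs0 // => i _.
  by rewrite d0 mul0r.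
right; have ex : exists j, d j != 0 by exists j; apply/eqP.
have [m dm mmin] := ex_minnP ex.
exists m, (d m); split => //; apply: (@csum_leads d (fun s => F (a + s)) m 1) => //.
by move=> i im; apply/eqP; apply: contraTT im => /mmin; rewrite leqNgt.
Unshelve. all: by end_near. Qed.

Lemma csum_lip (d : nat -> C) H (r : R) : 0 < r ->
  (forall s, cabs s <= r -> csum (fun j => d j * s ^+ j) (H s)) ->
  exists K, exists2 d' : R, 0 < d' & forall s, cabs s <= d' ->
    cabs (H s - H 0) <= K * cabs s.
Proof.
move=> r0 hd.
have H0 : H 0 = d 0%N.
  have r0' : cabs (0 : C) <= r by rewrite cabs0 ltW.
  apply: csum_unique (hd _ r0') _.
  have := @csum_finite _ (fun j => d j * 0 ^+ j) 1; rewrite big_ord1 mulr1.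
  by apply=> -[//|j] _; rewrite expr0n mulr0.
have [K [d' [d'0 Hd]]] := csum_leads r0 hd (fun j (h : (j < 0)%N) => ltac:(by [])).
exists K, d' => // s sd; have := Hd s sd.
by rewrite expr0 mulr1 expr1 H0.
Qed.

Lemma expands_lip F a : expands F a ->
  exists K, exists2 d' : R, 0 < d' & forall s, cabs s <= d' ->
    cabs (F (a + s) - F a) <= K * cabs s.
Proof.
move=> [d hd]; have := @csum_lip d (fun s => F (a + s)) 1 ltr01 (fun s _ => hd s).
by rewrite addr0.
Qed.

Lemma expands_lin F g (x y : C) a : expands F a -> expands g a ->
  expands (fun z => x * F z + y * g z) a.
Proof.
move=> [d hd] [e he]; exists (fun j => x * d j + y * e j) => s.
have := csum_lin x y (hd s) (he s).
by under eq_fun do rewrite !mulrA -mulrDl.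
Qed.

Lemma expands_cst c a : expands (fun=> c) a.
Proof.
exists (fun j => if j == 0%N then c else 0) => s.
have := @csum_finite _ (fun j => (if j == 0%N then c else 0) * s ^+ j) 1.
by rewrite big_ord1 mulr1; apply => -[//|j] _; rewrite mul0r.
Qed.

Lemma csum_shift (d : nat -> C) (s w : C) : csum (fun j => d j * s ^+ j) w ->
  csum (fun j => (if j is i.+1 then d i else 0) * s ^+ j) (s * w).
Proof.
move=> hw e e0.
have e1 : 0 < e / (cabs s + 1) by rewrite divr_gt0 // ltr_wpDl ?cabs_ge0.
have [M _ HM] := hw _ e1; exists M.+1 => // -[//|m] /= Mm.
rewrite big_ord_recl mul0r add0r.
have -> : \sum_(i < m) (if bump 0 i is i0.+1 then d i0 else 0) * s ^+ bump 0 i =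
   s * \sum_(i < m) d i * s ^+ i.
  by rewrite mulr_sumr; apply: eq_bigr => i _; rewrite /bump leq0n add1n exprS;
      ring.
rewrite -mulrBr cabsM;
    apply: le_lt_trans (_ : (cabs s + 1) * cabs (w - \sum_(i < m) d i * s ^+ i)
    < _).
  by rewrite ler_wpM2r ?cabs_ge0 // lerDl.
by rewrite mulrC -ltr_pdivlMr ?ltr_wpDl ?cabs_ge0 //; exact: HM.
Qed.

Lemma expands_mulX F a : expands F a -> expands (fun z => z * F z) a.
Proof.
move=> [d hd]; exists (fun j => a * d j + (if j is i.+1 then d i else 0)) => s.
have := csum_lin a 1 (hd s) (csum_shift (hd s)).
rewrite mul1r -mulrDl.
by under eq_fun do rewrite mul1r mulrA -mulrDl.
Qed.

Lemma csum_zero_coef (d : nat -> C) (r : R) : 0 < r ->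
  (forall t : R, 0 < t < r -> csum (fun j => d j * (t%:C%C) ^+ j) 0) ->
  forall j, d j = 0.
Proof.
move=> r0 hd; apply: coef0_unique r0 _ => t tr e e0.
by have := hd t tr e e0; apply: filterS => m; rewrite sub0r cabsN.
Qed.

End LocalOrder.

(** * The maximum principle and Liouville's theorem *)

Section Liouville.
Context (R : realType).
Local Notation C := R[i].
Implicit Types (q p f : C -> C).

Lemma leads_at0 q m (c : C) : leads q m c -> q 0 = if m == 0 then c else 0.
Proof.
move=> [K [d [d0 H]]]; have := H 0; rewrite cabs0 (ltW d0) => /(_ isT).
rewrite exprS mul0r mulr0 => /le_lt_trans h.
apply/eqP; rewrite -subr_eq0 -cabs_eq0 eq_le cabs_ge0 andbT.
apply/ler_addgt0Pr => e e0; rewrite add0r.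
by have := h e e0; case: m {H h} => [|m];
    rewrite ?expr0 ?mulr1 ?exprS ?mul0r ?mulr0 => /ltW.
Qed.

Lemma leads_lip q m (c : C) : (0 < m)%N -> leads q m c ->
  exists L d : R, [/\ 0 <= L, 0 < d & forall s, cabs s <= d -> cabs (q s) <= L
      * cabs s].
Proof.
case: m => // m _ [K [d [d0 H]]].
exists (cabs c + `|K|), (Num.min d 1); split.
- by rewrite addr_ge0 // cabs_ge0.
- by rewrite lt_min d0 ltr01.
move=> s; rewrite le_min => /andP[sd s1].
have := ler_cabs_tri (q s) (c * s ^+ m.+1); move/le_trans; apply.
have sm l : cabs s ^+ l <= 1 by rewrite exprn_ile1 // cabs_ge0.
rewrite mulrDl; apply: lerD.
  rewrite cabsM cabsX ler_wpM2l ?cabs_ge0 // exprS.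
  by rewrite ler_piMr ?cabs_ge0.
apply: le_trans (H s sd) _.
apply: le_trans (_ : `|K| * cabs s ^+ m.+2 <= _).
  by rewrite ler_wpM2r ?exprn_ge0 ?cabs_ge0 // ler_norm.
by rewrite ler_wpM2l // exprS ler_piMr ?cabs_ge0.
Qed.

Let cpl (u : R * R) : C := Complex u.1 u.2.

(** Squares rather than discs, because a product of two segments is compact. *)
Lemma square_max q (r : R) : 0 <= r ->
  (forall a, exists L d : R, [/\ 0 <= L, 0 < d &
     forall s, cabs s <= d -> cabs (q (a + s) - q a) <= L * cabs s]) ->
  exists a, [/\ `|complex.Re a| <= r, `|complex.Im a| <= r &
    forall z, `|complex.Re z| <= r -> `|complex.Im z| <= r ->
      cabs (q z) <= cabs (q a)].
Proof.
move=> r0 hq; pose h (u : R * R) : R := cabs (q (cpl u)).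
pose A := `[- r, r]%classic `*` `[- r, r]%classic.
have cA : compact A by apply: compact_setX; exact: segment_compact.
have A0 : A !=set0.
  by exists (0, 0); split; rewrite /= in_itv /= oppr_le0 r0.
have ch : continuous h.
  move=> u; apply/cvgrPdist_lt => e e0.
  have [L [d [L0 d0 H]]] := hq (cpl u).
  pose t := Num.min d (e / (L + 1)).
  have t0 : 0 < t by rewrite lt_min d0 divr_gt0 // ltr_wpDl.
  have t2 : 0 < t / 2 by rewrite divr_gt0.
  exists (ball u.1 (t / 2), ball u.2 (t / 2)).
    by split; exact: nbhsx_ballx.
  move=> v [/= v1 v2]; rewrite /h.
  have Ev : cpl v = cpl u + (cpl v - cpl u) by rewrite subrKC.
  have sv : cabs (cpl v - cpl u) < t.
    apply: le_lt_trans (cabs_le_ReIm _) _ => /=.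
    rewrite (splitr t); apply: ltrD; rewrite -normrN opprB //.
  have svd : cabs (cpl v - cpl u) <= d.
    by apply: le_trans (ltW sv) _; rewrite ge_min lexx.
  have := H _ svd; rewrite -Ev => hv.
  have : L * cabs (cpl v - cpl u) < e.
    apply: le_lt_trans (_ : L * t < e) => //.
      by rewrite ler_wpM2l // ltW.
    apply: le_lt_trans (_ : L * t <= L * (e / (L + 1))) _.
      by rewrite ler_wpM2l // ge_min lexx orbT.
    rewrite mulrA ltr_pdivrMr ?ltr_wpDl // mulrC ltr_pM2l //; lra.
  apply: le_lt_trans; apply: le_trans hv.
  have h1 := ler_cabs_tri (q (cpl u)) (q (cpl v)).
  have h2 := ler_cabs_tri (q (cpl v)) (q (cpl u)).
  rewrite cabsBC in h1.
  by rewrite ler_norml; apply/andP; split; lra.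
have [u uA umax] := compact_EVT_max A0 cA (continuous_subspaceT ch).
move: uA; rewrite inE => -[/=]; rewrite !in_itv /= => u1 u2.
exists (cpl u); split; rewrite /= ?ler_norml //.
move=> [z1 z2] /=; rewrite !ler_norml => h1 h2.
apply: (umax (z1, z2)); rewrite inE; split; by rewrite /= in_itv.
Qed.

(** Let the modulus of [q] be maximal and nonzero at [a] on the square of half
    side [r].  If [|a| < r] and [q] is not constant, then [q (a + s)] is close to
    [q a + c s^m], and taking [s] with [c s^m] a positive multiple of [q a]
    increases the modulus.  So [|a| >= r], or [q] is constant; the bound holds
    at [a] in both cases. *)
Lemma max_modulus q (r b : R) : 0 < r -> 0 <= b ->
  (forall a, (forall z, q z = q a) \/
    exists m c, [/\ (0 < m)%N, c != 0 & leads (fun s => q (a + s) - q a) m c]) ->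
  (forall z, r <= cabs z -> cabs (q z) <= b) -> forall z, cabs (q z) <= b.
Proof.
move=> r0 b0 hq hb z; have [|zr] := leP r (cabs z); first exact: hb.
have lip a : exists L d : R, [/\ 0 <= L, 0 < d &
     forall s, cabs s <= d -> cabs (q (a + s) - q a) <= L * cabs s].
  have [E|[m [c [m0 c0 H]]]] := hq a; last exact: leads_lip H.
  by exists 0, 1; split => // s _; rewrite E subrr cabs0 mul0r.
have [a [a1 a2 amax]] := square_max (ltW r0) lip.
suff : cabs (q a) <= b.
  apply: le_trans; apply: amax; apply: le_trans (ltW zr).
    exact: Re_le_cabs.
  exact: Im_le_cabs.
have [ra|ar] := leP r (cabs a); first exact: hb.
have [E|[m [c [m0 c0 [K [d [d0 H]]]]]]] := hq a.
  by rewrite -(E r%:C%C); apply: hb; rewrite cabs_real // ltW.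
have [qa0|qa0] := eqVneq (q a) 0; first by rewrite qa0 cabs0.
have Q0 : 0 < cabs (q a) by rewrite cabs_gt0.
(* The direction in which the leading term increases the modulus of q. *)
have [w wm] : exists w : C, c * w ^+ m = q a.
  by exists (m.-root (q a / c)); rewrite rootCK // mulrC divfK.
pose W := cabs w + 1; have W0 : 0 < W by rewrite ltr_wpDl ?cabs_ge0.
pose K1 := `|K| * W ^+ m.+1 + 1.
have K10 : 0 < K1 by rewrite ltr_wpDl // mulr_ge0 // exprn_ge0 // ltW.
(* The three bounds keep a + t w within the range of the expansion and inside
   the square, and the remainder below half of the gain t^m |q a|. *)
pose t := Num.min (Num.min (d / W) ((r - cabs a) / W)) (cabs (q a) / (2 * K1)).
have t0 : 0 < t.
  by rewrite !lt_min !divr_gt0 ?subr_gt0 // mulr_gt0.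
have tw : cabs (t%:C%C * w) <= t * W.
  by rewrite cabsM cabs_real ?(ltW t0) // ler_pM2l // /W lerDl.
have tWd : t * W <= d.
  by rewrite -ler_pdivlMr // !ge_min lexx.
have tWr : t * W <= r - cabs a.
  by rewrite -ler_pdivlMr // !ge_min lexx orbT.
have tK : K1 * t <= cabs (q a) / 2.
  rewrite mulrC -ler_pdivlMr //; apply: le_trans (_ : cabs (q a) / (2 * K1) <= _).
    by rewrite !ge_min lexx orbT.
  by rewrite invfM mulrA.
have := H _ (le_trans tw tWd); rewrite exprMn mulrCA wm => hh.
have ar' : cabs (a + t%:C%C * w) <= r.
  by apply: le_trans (ler_cabsD _ _) _; lra.
have M : cabs (q (a + t%:C%C * w)) <= cabs (q a).
  apply: amax; apply: le_trans ar'; [exact: Re_le_cabs|exact: Im_le_cabs].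
have tm0 : 0 < t ^+ m by rewrite exprn_gt0.
have h2 : K * cabs (t%:C%C * w) ^+ m.+1 <= t ^+ m * (cabs (q a) / 2).
  apply: le_trans (_ : t ^+ m * (K1 * t) <= _); last by rewrite ler_pM2l.
  apply: le_trans (_ : `|K| * (t * W) ^+ m.+1 <= _).
    apply: le_trans (_ : `|K| * cabs (t%:C%C * w) ^+ m.+1 <= _).
      by rewrite ler_wpM2r ?exprn_ge0 ?cabs_ge0 // ler_norm.
    by rewrite ler_wpM2l // lerXn2r ?nnegrE ?cabs_ge0 // mulr_ge0 // ltW.
  have -> : `|K| * (t * W) ^+ m.+1 = t ^+ m * (`|K| * W ^+ m.+1 * t).
    by rewrite exprMn (exprS t); ring.
  by rewrite ler_pM2l // ler_pM2r // /K1 lerDl.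
have h3 : cabs (q a + t%:C%C ^+ m * q a) = (1 + t ^+ m) * cabs (q a).
  rewrite -[X in X + _]mul1r -mulrDl cabsM -rmorphXn -(rmorph1 (real_complex R)).
  by rewrite -rmorphD cabs_real // addr_ge0 // ltW.
have h4 := ler_cabs_tri (q a + t%:C%C ^+ m * q a) (q (a + t%:C%C * w)).
have h5 : cabs (q a + t%:C%C ^+ m * q a - q (a + t%:C%C * w))
    <= t ^+ m * (cabs (q a) / 2).
  apply: le_trans h2; apply: le_trans hh; rewrite cabsBC.
  by rewrite le_eqVlt; apply/orP; left; apply/eqP; congr cabs; ring.
have : t ^+ m * cabs (q a) <= t ^+ m * (cabs (q a) / 2).
  have : (1 + t ^+ m) * cabs (q a) <= cabs (q a) + t ^+ m * (cabs (q a) / 2).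
    by rewrite -h3; apply: le_trans h4 (lerD M h5).
  by rewrite mulrDl mul1r lerD2l.
by rewrite ler_pM2l // => {}hh; exfalso; lra.
Qed.

(** Write [p z = z * p1 z].  The quotient [q = p1 / f] is bounded by [B / |z|],
    so the maximum principle bounds it everywhere by arbitrarily small numbers.
    The increments of [q] at [a] have leading terms, because
    [z * (p1 z - q a * f z) = p z - q a * z * f z] is a combination of
    functions that are given by power series at each point. *)
Lemma bounded_quotient_eq0 p f (B : R) : (forall a, expands p a) ->
  (forall a, expands f a) -> (forall z, f z != 0) ->
  (forall z, cabs (p z) <= B * cabs (f z)) -> p 0 = 0 -> forall z, p z = 0.
Proof.
move=> hp hf f0 pB p0.
have [dp hdp] := hp 0; have [df hdf] := hf 0.
pose p1 z := if z == 0 then dp 1%N else p z / z.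
have p1E z : p z = z * p1 z.
  rewrite /p1; case: eqP => [->|/eqP z0]; first by rewrite p0 mul0r.
  by rewrite mulrC divfK.
have coef0 (d : nat -> C) (H : C -> C) :
    (forall s, csum (fun j => d j * s ^+ j) (H (0 + s))) -> d 0%N = H 0.
  move=> hd; apply/eqP; rewrite -subr_eq0; apply/eqP.
  have [K [d' [d'0 H']]] := @csum_leads _ d H 0 1 ltr01
     (fun s _ => ltac:(by have := hd s;
         rewrite add0r)) (fun j (h : (j < 0)%N) => ltac:(by [])).
  have := H' 0; rewrite cabs0 (ltW d'0) expr0 mulr1 expr1 mulr0 => /(_ isT) h.
  apply/eqP; rewrite -cabs_eq0 eq_le cabs_ge0 andbT cabsBC; exact: h.
pose q z := p1 z / f z.
pose D (q0 z : C) := p1 z - q0 * f z.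
have ex0 (q0 : C) : exists d, forall s, csum (fun j => d j * s ^+ j) (D q0 s).
  exists (fun j => dp j.+1 - q0 * df j) => s; rewrite /D.
  have h1 : csum (fun j => dp j.+1 * s ^+ j) (p1 s).
    rewrite /p1; case: eqP => [->|/eqP s0].
      have := @csum_finite _ (fun j => dp j.+1 * 0 ^+ j) 1.
      by rewrite big_ord1 mulr1; apply => -[//|j] _; rewrite expr0n mulr0.
    have := csumZ s^-1 (csum_recl (hdp s)).
    rewrite add0r expr0 mulr1 (coef0 _ _ hdp) p0 subr0 mulrC.
    rewrite (_ : (fun _ => _) = (fun j => dp j.+1 * s ^+ j)) //.
    by apply/funext => j; rewrite exprS; field.
  have := csum_lin 1 (- q0) h1 (hdf s).
  rewrite add0r mul1r mulNr.
  by under eq_fun do rewrite mul1r mulrA -mulrDl mulNr.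
have exF (q0 a : C) : expands (fun z => z * D q0 z) a.
  have := expands_lin 1 (- q0) (hp a) (expands_mulX (hf a)).
  rewrite (_ : (fun _ => _) = (fun z => z * D q0 z)) //.
  by apply/funext => z; rewrite p1E /D; ring.
have zF (q0 : C) : (forall z, z * D q0 z = 0) -> forall z, D q0 z = 0.
  move=> h z; have [->|z0] := eqVneq z 0; last first.
    by have /eqP := h z; rewrite mulf_eq0 (negPf z0) => /eqP.
  have [d hd] := ex0 q0.
  have d0 : forall j, d j = 0.
    apply: (csum_zero_coef (@ltr01 R)) => t /andP[t0 _].
    have tn : t%:C%C != 0 by rewrite -cabs_eq0 cabs_real ?(ltW t0) // lt0r_neq0.
    have := hd t%:C%C.
    by have /eqP := h t%:C%C; rewrite mulf_eq0 (negPf tn) /= => /eqP ->.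
  apply: csum_unique (hd 0) _; have := @csum_finite _ (fun j => d j * 0 ^+ j) 0.
  by rewrite big_ord0; apply => j _; rewrite d0 mul0r.
have leadsD (q0 a : C) : (forall z, D q0 z = 0) \/
    exists m c, c != 0 /\ leads (fun s => D q0 (a + s)) m c.
  have [->|a0] := eqVneq a 0.
    have [d hd] := ex0 q0; have : expands (D q0) 0.
      by exists d => s; rewrite add0r.
    by move/expands_leads.
  have [/zF|[m [c [c0 H]]]] := expands_leads (exF q0 a); [by left|right].
  exists m, (c / a); split; first by rewrite mulf_neq0 // invr_eq0.
  have := @leads_div _ _ (fun s => a + s) m c a 1 a0 H.
  case.
    by exists 1 => // s _; rewrite addrAC subrr add0r mul1r.
  move=> K [d [d0 Hd]]; exists K, (Num.min d (cabs a / 2)); split.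
    by rewrite lt_min d0 divr_gt0 // cabs_gt0.
  move=> s; rewrite le_min => /andP[/Hd hs sa]; apply: le_trans hs.
  have as0 : a + s != 0.
    rewrite -cabs_gt0; have := ler_cabs_tri a (a + s).
    rewrite opprD addrA subrr add0r cabsN; have : 0 < cabs a by rewrite cabs_gt0.
    by move: (cabs a) (cabs s) (cabs _) sa => x y z; lra.
  by rewrite [(a + s) * _]mulrC mulfK.
have leadsq a : (forall z, q z = q a) \/
    exists m c, [/\ (0 < m)%N, c != 0 & leads (fun s => q (a + s) - q a) m c].
  have qD z : q z - q a = D (q a) z / f z.
    by rewrite /D /q mulrBl mulfK.
  have [H|[m [c [c0 H]]]] := leadsD (q a) a.
    by left=> z; apply/eqP; rewrite -subr_eq0 qD H mul0r.
  right; exists m, (c / f a).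
  have [K [d' d'0 hd']] := expands_lip (hf a).
  have L : leads (fun s => q (a + s) - q a) m (c / f a).
    have := leads_div (f0 a) H (ex_intro2 _ _ d' d'0 hd').
    by rewrite (_ : (fun _ => _) = (fun s => q (a + s) - q a)) //;
        apply/funext => s; rewrite qD.
  split => //; last by rewrite mulf_neq0 // invr_eq0.
  have := leads_at0 L; rewrite addr0 subrr; case: (m) => //= /esym/eqP.
  by rewrite mulf_eq0 invr_eq0 (negPf c0) (negPf (f0 a)).
have q0 z : q z = 0.
  apply/eqP; rewrite -cabs_eq0 eq_le cabs_ge0 andbT.
  apply/ler_addgt0Pr => e e0; rewrite add0r.
  pose r := (`|B| + 1) / e.
  have r0 : 0 < r by rewrite divr_gt0 // ltr_wpDl.
  apply: (max_modulus r0 (ltW e0) leadsq) => {}z rz.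
  have z0 : 0 < cabs z by apply: lt_le_trans rz.
  have zn : z != 0 by rewrite -cabs_gt0.
  rewrite /q /p1 (negPf zn) !cabsM !cabsV ler_pdivrMr ?cabs_gt0 // ler_pdivrMr //.
  apply: le_trans (pB z) _; rewrite mulrAC ler_wpM2r ?cabs_ge0 //.
  apply: le_trans (_ : e * r <= _); last by rewrite ler_pM2l.
  rewrite /r mulrC divfK ?lt0r_neq0 //.
  by apply: le_trans (ler_norm _) _; rewrite lerDl.
move=> z; rewrite p1E; have := q0 z; rewrite /q => /eqP.
by rewrite mulf_eq0 invr_eq0 (negPf (f0 z)) orbF => /eqP ->; rewrite mulr0.
Qed.

(** Liouville's theorem for the quotient of [f - f 0] by [g]. *)
Lemma bounded_quotient_cst f g (B : R) : (forall a, expands f a) ->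
  (forall a, expands g a) -> (forall z, g z != 0) ->
  (forall z, cabs (f z - f 0) <= B * cabs (g z)) -> forall z, f z = f 0.
Proof.
move=> hf hg g0 fB z; apply/eqP; rewrite -subr_eq0; apply/eqP.
have E : (fun z => 1 * f z + (- f 0) * 1) = (fun z => f z - f 0).
  by apply/funext => t; rewrite mul1r mulr1.
apply: (@bounded_quotient_eq0 (fun z => f z - f 0) g B) => //.
  by move=> a; rewrite -E; apply: expands_lin (hf a) (expands_cst _ _).
by rewrite subrr.
Qed.

Lemma entire_value_gt1 f : (forall a, expands f a) -> (exists z, f z <> f 0) ->
  exists z, 1 < cabs (f z).
Proof.
move=> hf [z fz]; apply/not_existsP => H; apply: fz.
have f1 t : cabs (f t) <= 1 by rewrite leNgt; apply/negP; exact: H.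
apply: (bounded_quotient_cst hf (expands_cst 1) (B := 2)) => t.
  exact: oner_neq0.
rewrite cabs1 mulr1; apply: le_trans (ler_cabsB _ _) _.
by have := f1 t; have := f1 0; lra.
Qed.

(** If [f] had modulus at least 1 everywhere, then [|f z - f 0|] would be at
    most [(1 + |f 0|) |f z|]. *)
Lemma entire_value_lt1 f : (forall a, expands f a) -> (exists z, f z <> f 0) ->
  exists z, cabs (f z) < 1.
Proof.
move=> hf [z fz]; apply/not_existsP => H; apply: fz.
have f1 t : 1 <= cabs (f t) by rewrite leNgt; apply/negP; exact: H.
apply: (bounded_quotient_cst hf hf (B := 1 + cabs (f 0))) => t.
  by rewrite -cabs_gt0; apply: lt_le_trans (f1 t).
apply: le_trans (ler_cabsB _ _) _; rewrite mulrDl mul1r lerD2l.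
by rewrite ler_peMr ?cabs_ge0.
Qed.

End Liouville.

(** * Equivalence of norms on C^n *)

Section NormEquivalence.
Context (R : realType) (n : nat) (N : cnorm R n).
Local Notation C := R[i].
Local Notation V := 'rV[C]_n.

Lemma cnorm_sum I (s : seq I) (F : I -> V) :
  N (\sum_(i <- s) F i) <= \sum_(i <- s) N (F i).
Proof.
elim/big_rec2 : _ => [|i x y _ h]; first by rewrite cnorm0.
by apply: le_trans (cnormD _ _ _) _; rewrite lerD2l.
Qed.

Lemma cnorm_le_coord (x : V) :
  N x <= \sum_i cabs (x 0 i) * N (delta_mx 0 i).
Proof.
rewrite {1}(row_sum_delta x); apply: le_trans (cnorm_sum _ _) _.
by apply: ler_sum => i _; rewrite cnormZ.
Qed.

Let vec (v : 'rV[R]_(n + n)) : V :=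
  \row_j Complex (v 0 (lshift n j)) (v 0 (rshift n j)).

(** In the real coordinates, this face of the unit polydisc lies in a product of
    points and of segments, which is compact and avoids 0. *)
Lemma cnorm_face_min (j : 'I_n) : exists2 m : R, 0 < m &
  forall x : V, x 0 j = 1 -> (forall i, cabs (x 0 i) <= 1) -> m <= N x.
Proof.
pose S (i : 'I_(n + n)) : set R := if i == lshift n j then [set 1]
  else if i == rshift n j then [set 0] else `[-1, 1]%classic.
pose A := [set v : 'rV[R]_(n + n) | forall i, S i (v ord0 i)].
have cA : compact A.
  apply: (@rV_compact _ _ S) => i; rewrite /S.
  by do 2![case: eqP => _; first exact: compact_set1]; exact: segment_compact.
have A0 : A !=set0.
  exists (\row_i if i == lshift n j then 1 else 0) => i.
  by rewrite mxE /S; do 2![case: eqP => // _]; rewrite /= in_itv /=; lra.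
pose h v := N (vec v).
have ch : continuous h.
  move=> u; have FF : Filter (nbhs u) by exact: nbhs_filter.
  apply/(@cvgrPdist_lt _ _ _ (nbhs u) FF) => e e0.
  pose M := \sum_i N (delta_mx 0 i) + 1.
  have M0 : 0 < M by rewrite ltr_wpDl // sumr_ge0 // => i _; exact: cnorm_ge0.
  pose t := e / M / 2.
  have t0 : 0 < t by rewrite !divr_gt0.
  exists (fun i k => ball (u i k) t); first by move=> i k; exact: nbhsx_ballx.
  move=> v uv.
  have d i : cabs ((vec v - vec u) 0 i) <= e / M.
    apply: le_trans (cabs_le_ReIm _) _; rewrite !mxE /=.
    have h1 := uv 0 (lshift n i); have h2 := uv 0 (rshift n i).
    rewrite (splitr (e / M)) -/t.
    by apply: lerD; rewrite -normrN opprB ltW.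
  have Nd : N (vec v - vec u) < e.
    apply: le_lt_trans (cnorm_le_coord _) _.
    apply: le_lt_trans (_ : \sum_i e / M * N (delta_mx 0 i) < _).
      by apply: ler_sum => i _; rewrite ler_wpM2r ?cnorm_ge0.
    rewrite -mulr_sumr mulrAC ltr_pdivrMr // ltr_pM2l // /M ltrDl //.
  rewrite /h; apply: le_lt_trans Nd.
  have h1 := cnormD N (vec u) (vec v - vec u); rewrite subrKC in h1.
  have h2 := cnormD N (vec v) (vec u - vec v); rewrite subrKC in h2.
  rewrite -(cnormN N (vec u - vec v)) opprB in h2.
  by rewrite ler_norml; apply/andP; split; lra.
have [u uA umin] := compact_EVT_min A0 cA (continuous_subspaceT ch).
exists (h u).
  rewrite lt_neqAle cnorm_ge0 andbT; apply/negP => /eqP/esym/cnorm_eq0/rowP/(_ j).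
  move: uA; rewrite inE => /(_ (lshift n j)); rewrite /S eqxx /= !mxE => -> /= [].
  by move/eqP; rewrite oner_eq0.
move=> x xj x1.
pose w : 'rV[R]_(n + n) :=
  row_mx (\row_i complex.Re (x 0 i)) (\row_i complex.Im (x 0 i)).
have -> : x = vec w.
  by apply/rowP => i; rewrite /vec /w mxE row_mxEl row_mxEr !mxE; case: (x 0 i).
apply: umin; rewrite inE => i; rewrite /S.
case: (split_ordP i) => k ->; rewrite /w ?row_mxEl ?row_mxEr mxE.
  rewrite eq_lshift eq_lrshift; case: eqP => [->|_]; first by rewrite xj.
  by rewrite /= in_itv /= -ler_norml (le_trans (Re_le_cabs _) (x1 k)).
rewrite eq_rlshift eq_rshift; case: eqP => [->|_]; first by rewrite xj.
by rewrite /= in_itv /= -ler_norml (le_trans (Im_le_cabs _) (x1 k)).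
Qed.

(** Dividing [x] by a coordinate of maximal modulus moves it to a face of the
    polydisc. *)
Lemma cnorm_coord_bound : exists2 b : R, 0 < b &
  forall (x : V) i, cabs (x 0 i) <= b * N x.
Proof.
have ex (j : 'I_n) : {m : R | 0 < m /\
  forall x : V, x 0 j = 1 -> (forall i, cabs (x 0 i) <= 1) -> m <= N x}.
  by apply: cid; have [m m0 H] := cnorm_face_min j; exists m.
pose b := \sum_j (sval (ex j))^-1 + 1.
have b0 (j : 'I_n) : 0 <= (sval (ex j))^-1.
  by case: (ex j) => m /= [m0 _]; rewrite invr_ge0 ltW.
have B0 : 0 < b by rewrite ltr_wpDl // sumr_ge0.
exists b => // x i.
pose j := [arg max_(j > i) cabs (x 0 j)]%O.
have jmax l : cabs (x 0 l) <= cabs (x 0 j).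
  by rewrite /j; case: arg_maxP => // k _; apply.
apply: le_trans (jmax i) _.
have [xj|xj] := eqVneq (x 0 j) 0;
    first by rewrite xj cabs0 mulr_ge0 ?cnorm_ge0 // ltW.
have X0 : 0 < cabs (x 0 j) by rewrite cabs_gt0.
case E : (ex j) => [m [m0 H]].
have := H ((x 0 j)^-1 *: x); rewrite mxE mulVf // => /(_ erefl).
have h i' : cabs (((x 0 j)^-1 *: x) 0 i') <= 1.
  by rewrite mxE cabsM cabsV mulrC ler_pdivrMr // mul1r.
move=> /(_ h); rewrite cnormZ cabsV mulrC ler_pdivlMr // => hm.
have mb : m^-1 <= b.
  rewrite /b (bigD1 j) //= E /= -addrA lerDl addr_ge0 //.
  by apply: sumr_ge0.
apply: le_trans (_ : m^-1 * N x <= _); last by rewrite ler_wpM2r ?cnorm_ge0.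
by rewrite mulrC ler_pdivlMr // mulrC.
Qed.

End NormEquivalence.

(** * Homogeneous polynomials and linear forms *)

Section Homogeneous.
Context (R : realType) (n : nat) (N : cnorm R n).
Local Notation C := R[i].
Local Notation V := 'rV[C]_n.
Implicit Types (P Q : V -> C) (c x y : V).

Lemma homog_poly_cst (a : C) : homog_poly 0 (fun _ : V => a).
Proof.
exists (mpolyC n a) => [|x]; last by rewrite mevalC.
by apply/dhomogP => m; rewrite msuppC; case: ifP => // _;
    rewrite inE => /eqP ->; exact: mdeg0.
Qed.

Lemma homog_polyM j l P Q : homog_poly j P -> homog_poly l Q ->
  homog_poly (j + l) (fun x => P x * Q x).
Proof.
move=> [p hp EP] [q hq EQ]; exists (p * q); first exact: dhomogM.
by move=> x; rewrite mevalM -EP -EQ.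
Qed.

Lemma homog_poly_ext j P Q : P =1 Q -> homog_poly j P -> homog_poly j Q.
Proof. by move=> PQ [p hp E]; exists p => // x; rewrite -PQ E. Qed.

Lemma homog_poly_scale j (a : C) P : homog_poly j P -> homog_poly j (fun x => a
    * P x).
Proof. exact: homog_polyM (homog_poly_cst a). Qed.

Lemma homog_poly_sum j I (s : seq I) (F : I -> V -> C) :
  (forall i, homog_poly j (F i)) -> homog_poly j (fun x => \sum_(i <- s) F i x).
Proof.
move=> hF; elim: s => [|i s IH].
  by apply: (@homog_poly_ext j 0) => [x|]; [by rewrite big_nil|exact: homog_poly0].
apply: homog_poly_ext _ (homog_poly_lin 1 (hF i) IH) => x.
by rewrite big_cons scale1r.
Qed.

Lemma homog_polyX j m P : homog_poly j P -> homog_poly (j * m) (fun x => P x ^+ m).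
Proof.
move=> hP; elim: m => [|m IH].
  by rewrite muln0; apply: homog_poly_ext _ (homog_poly_cst 1) => x.
by rewrite mulnS; apply: homog_poly_ext _ (homog_polyM hP IH) => x; rewrite exprS.
Qed.

Lemma homog_coord (i : 'I_n) : homog_poly 1 (fun x : V => x 0 i).
Proof.
exists (mpolyX C (mnm1 i)) => [|x]; last by rewrite mevalXU.
by rewrite dhomogX; apply/eqP; exact: mdeg1.
Qed.

Definition phi c x : C := \sum_i c 0 i * x 0 i.

Lemma phiD c x y : phi c (x + y) = phi c x + phi c y.
Proof. by rewrite -big_split; apply: eq_bigr => i _; rewrite mxE mulrDr. Qed.
Lemma phiDl c y x : phi (c + y) x = phi c x + phi y x.
Proof. by rewrite -big_split; apply: eq_bigr => i _; rewrite mxE mulrDl. Qed.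
Lemma phiZl c (a : C) x : phi (a *: c) x = a * phi c x.
Proof. by rewrite mulr_sumr; apply: eq_bigr => i _; rewrite mxE mulrA. Qed.
Lemma phi_delta (i : 'I_n) x : phi (delta_mx 0 i) x = x 0 i.
Proof.
rewrite /phi (bigD1 i) //= mxE !eqxx mul1r big1 ?addr0 // => j ji.
by rewrite mxE (negPf ji) andbF mul0r.
Qed.

Lemma homog_phi c : homog_poly 1 (phi c).
Proof. by apply: homog_poly_sum => i; apply: homog_poly_scale;
    exact: homog_coord. Qed.

Lemma phi_bound c : exists2 T : R, 0 <= T & forall x, cabs (phi c x) <= T * N x.
Proof.
have [b b0 hb] := cnorm_coord_bound N.
exists (\sum_i cabs (c 0 i) * b).
  by apply: sumr_ge0 => i _; rewrite mulr_ge0 ?cabs_ge0 // ltW.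
move=> x; apply: le_trans (ler_cabs_sum _ _ _) _.
rewrite mulr_suml; apply: ler_sum => i _.
by rewrite cabsM -mulrA ler_wpM2l ?cabs_ge0.
Qed.

Lemma homog_bound j P : homog_poly j P ->
  exists2 B : R, 0 <= B & forall x, cabs (P x) <= B * N x ^+ j.
Proof.
move=> [p hp EP]; have [b b0 hb] := cnorm_coord_bound N.
exists (\sum_(m <- msupp p) cabs (mcoeff m p) * b ^+ j).
  by apply: sumr_ge0 => i _; rewrite mulr_ge0 ?cabs_ge0 // exprn_ge0 // ltW.
move=> x; rewrite EP mevalE; apply: le_trans (ler_cabs_sum _ _ _) _.
rewrite mulr_suml big_seq [leRHS]big_seq; apply: ler_sum => m mp.
have <- : mdeg m = j by move/dhomogP: hp; apply.
rewrite cabsM -mulrA ler_wpM2l ?cabs_ge0 // -exprMn mdegE -prodrXr.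
elim/big_rec2 : _ => [|i u v _ h]; first by rewrite cabs1.
rewrite cabsM cabsX; apply: ler_pM; rewrite ?exprn_ge0 ?cabs_ge0 //.
by rewrite lerXn2r ?nnegrE ?cabs_ge0 // mulr_ge0 ?cnorm_ge0 // ltW.
Qed.

Lemma hnorm_le j P (B : R) : 0 <= B -> (forall x, cabs (P x) <= B * N x ^+ j) ->
  (hnorm N P <= B%:E)%E.
Proof.
move=> B0 hP; apply: ge_ereal_sup => _ [x /= x1 <-]; rewrite lee_fin.
apply: le_trans (hP x) _; rewrite ler_piMr // exprn_ile1 //.
exact: cnorm_ge0.
Qed.

Lemma hnorm_fin j P : homog_poly j P -> (hnorm N P < +oo)%E.
Proof.
move=> /homog_bound[B B0 hB]; apply: le_lt_trans (hnorm_le B0 hB) _.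
exact: ltry.
Qed.

(** By homogeneity, the values on the unit ball determine all the others. *)
Lemma hnorm_eq0 j P : homog_poly j P -> hnorm N P = 0%E -> P = 0.
Proof.
move=> hP h0; apply/funext => x.
have Nx : 0 < N x + 1 by rewrite ltr_wpDl ?cnorm_ge0.
pose t : R := (N x + 1)^-1; have t0 : 0 < t by rewrite invr_gt0.
have : ((cabs (P (t%:C%C *: x)))%:E <= 0)%E.
  rewrite -h0; apply: ereal_sup_ubound; exists (t%:C%C *: x) => //=.
  rewrite cnormZ cabs_real ?(ltW t0) // /t mulrC ler_pdivrMr // mul1r lerDl //.
rewrite lee_fin (homog_polyZ _ _ hP) cabsM cabsX cabs_real ?(ltW t0) //.
rewrite pmulr_rle0 ?exprn_gt0 // => h.
by apply/eqP; rewrite -cabs_eq0 eq_le h cabs_ge0.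
Qed.

End Homogeneous.

(** * Taylor expansions of polynomials times exponentials *)

Section Exponentials.
Context (R : realType) (n : nat) (N : cnorm R n).
Local Notation C := R[i].
Local Notation V := 'rV[C]_n.
Implicit Types (P : V -> C) (b c x y : V).

Definition mexp P c x : C := P x * cexp (phi c x).

(** The homogeneous term of degree [l] of [mexp P c] at 0, for [P] homogeneous
    of degree [d]. *)
Definition mexp_taylor P (d : nat) c (l : nat) x : C :=
  if (d <= l)%N then P x * (phi c x ^+ (l - d) / (l - d)`!%:R) else 0.

Lemma mexp_taylor_homog P d c l : homog_poly d P ->
  homog_poly l (mexp_taylor P d c l).
Proof.
move=> hP; rewrite /mexp_taylor; have [dl|_] := leqP d l; last exact: homog_poly0.
have h := homog_polyM hP (homog_poly_scale ((l - d)`!%:R)^-1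
   (homog_polyX (l - d) (homog_phi c))).
rewrite mul1n subnKC // in h; apply: homog_poly_ext _ h => x.
by congr (_ * _); rewrite mulrC.
Qed.

Lemma sum_shift (F : nat -> C) d m :
  \sum_(j < m) (if (d <= j)%N then F (j - d)%N else 0) = \sum_(j < m - d) F j.
Proof.
elim: m => [|m IH]; first by rewrite sub0n !big_ord0.
rewrite big_ord_recr /= IH; have [dm|md] := leqP d m.
  by rewrite subSn // big_ord_recr.
have -> : (m.+1 - d = 0)%N by apply/eqP; rewrite subn_eq0.
have -> : (m - d = 0)%N by apply/eqP; rewrite subn_eq0 ltnW.
by rewrite !big_ord0 addr0.
Qed.

Lemma mexp_taylor0 P d c : homog_poly d P ->
  taylor_expansion N (mexp P c) 0 (mexp_taylor P d c).
Proof.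
move=> hP; split=> [j|]; first exact: mexp_taylor_homog.
exists 1 => //; apply/uniform_cabsP => e e0.
have [B B0 hB] := homog_bound N hP.
have [T T0 hT] := phi_bound N c.
pose K := B * (2 * expR (2 * T) * 2 ^+ d) + 1.
have K0 : 0 < K.
  by rewrite ltr_wpDl // !mulr_ge0 ?exprn_ge0 // ltW // expR_gt0.
near=> m => x /=; rewrite subr0 => x1.
have -> : \sum_(j < m) mexp_taylor P d c j x =
    P x * \sum_(j < m - d) phi c x ^+ j / j`!%:R.
  rewrite -(sum_shift (fun j => phi c x ^+ j / j`!%:R)) mulr_sumr.
  by apply: eq_bigr => j _; rewrite /mexp_taylor; case: ifP; rewrite ?mulr0.
rewrite -mulrBr cabsM.
have PB : cabs (P x) <= B.
  apply: le_trans (hB x) _; rewrite ler_piMr // exprn_ile1 ?cnorm_ge0 //.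
  exact: ltW.
have fT : cabs (phi c x) <= T.
  by apply: le_trans (hT x) _; rewrite ler_piMr // ltW.
have hm : (2^-1 : R) ^+ m < e / K by near: m; apply: half_small; rewrite divr_gt0.
have dm : (d <= m)%N by near: m; exact: nbhs_infty_ge.
apply: le_lt_trans (_ : B * (2 * expR (2 * T) * 2^-1 ^+ (m - d)) < _).
  by apply: ler_pM; rewrite ?cabs_ge0 // cexp_tail.
have -> : (2^-1 : R) ^+ (m - d) = 2 ^+ d * 2^-1 ^+ m.
  rewrite -[in RHS](subnKC dm) exprD mulrA -exprMn mulfV // expr1n mul1r //.
apply: le_lt_trans (_ : K * 2^-1 ^+ m < _).
  rewrite !mulrA ler_wpM2r ?half_ge0 // -!mulrA /K !mulrA lerDl //.
by rewrite mulrC -ltr_pdivlMr.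
Unshelve. all: by end_near. Qed.

Lemma taylor_expansion_shift f a (Q : nat -> V -> C) :
  taylor_expansion N f 0 Q -> taylor_expansion N (fun x => f (x - a)) a Q.
Proof.
move=> [hQ [r r0 /uniform_cabsP H]]; split => //; exists r => //.
apply/uniform_cabsP => e /H; apply: filterS => m Hm x /= xr.
have := Hm (x - a); rewrite /= subr0; exact.
Qed.

Lemma taylor_expansion_local f g a (Q : nat -> V -> C) : (exists2 r : R, 0 < r &
    forall x, N (x - a) < r -> f x = g x) ->
  taylor_expansion N f a Q -> taylor_expansion N g a Q.
Proof.
move=> [s s0 fg] [hQ [r r0 /uniform_cabsP H]]; split => //.
exists (Num.min r s); first by rewrite lt_min r0.
apply/uniform_cabsP => e /H; apply: filterS => m Hm x /=.
by rewrite lt_min => /andP[xr /fg <-]; exact: Hm.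
Qed.

Lemma taylor_expansion_sum I (s : seq I) (u : I -> C) (f : I -> V -> C) a
    (Q : I -> nat -> V -> C) :
  (forall i, taylor_expansion N (f i) a (Q i)) ->
  taylor_expansion N (fun x => \sum_(i <- s) u i * f i x) a
    (fun j x => \sum_(i <- s) u i * Q i j x).
Proof.
move=> h; elim: s => [|i s IH].
  have := taylor_expansion0 N a; congr taylor_expansion.
    by apply/funext => x; rewrite big_nil.
  by apply/funext => j; apply/funext => x; rewrite big_nil.
have := taylor_expansion_lin (u i) (h i) IH; congr taylor_expansion.
  by apply/funext => x; rewrite big_cons.
by apply/funext => j; apply/funext => x; rewrite big_cons.
Qed.

(** Translation by [a] expresses [mexp (phi b ^ j) c] by finitely many functions
    of the same kind, so that expansions at 0 give expansions at all points. *)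
Lemma mexp_powD b j c a y : mexp (fun x => phi b x ^+ j) c (a + y) =
  \sum_(i < j.+1) cexp (phi c a) * (phi b a ^+ (j - i) *+ 'C(j, i)) *
    mexp (fun x => phi b x ^+ i) c y.
Proof.
rewrite /mexp !phiD cexpD exprDn big_distrl /=; apply: eq_bigr => i _.
rewrite mulrnAr !mulrnAl; congr (_ *+ _).
move: (cexp _) (cexp _) (_ ^+ _) (_ ^+ _) => z1 z2 z3 z4; ring.
Qed.

Lemma mexp_pow_taylor b j c a :
  exists Q, taylor_expansion N (mexp (fun x => phi b x ^+ j) c) a Q.
Proof.
pose u (i : 'I_j.+1) := cexp (phi c a) * (phi b a ^+ (j - i) *+ 'C(j, i)).
pose f (i : 'I_j.+1) (x : V) := mexp (fun x => phi b x ^+ i) c (x - a).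
pose Q (i : 'I_j.+1) := mexp_taylor (fun x => phi b x ^+ i) i c.
exists (fun l x => \sum_(i <- enum 'I_j.+1) u i * Q i l x).
have := @taylor_expansion_sum _ (enum 'I_j.+1) u f a Q.
have -> : (fun x => \sum_(i <- enum 'I_j.+1) u i * f i x) =
    mexp (fun x => phi b x ^+ j) c.
  by apply/funext => x; rewrite big_enum /= -[in RHS](subrKC a x) mexp_powD.
apply=> i; apply: taylor_expansion_shift; apply: mexp_taylor0.
by have := homog_polyX i (homog_phi b); rewrite mul1n.
Qed.

Lemma mexp1_taylor c a :
  taylor_expansion N (mexp (fun=> 1) c) a
    (fun l x => cexp (phi c a) * mexp_taylor (fun=> 1) 0 c l x).
Proof.
have h := taylor_expansion_shift a (mexp_taylor0 c (homog_poly_cst n (1 : C))).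
have := taylor_expansion_lin (cexp (phi c a)) h (taylor_expansion0 N a).
congr taylor_expansion.
  apply/funext => x; rewrite addr0 /mexp mul1r -[in RHS](subrKC a x) phiD.
  by rewrite cexpD /GRing.scale /= mul1r.
by apply/funext => l; rewrite addr0.
Qed.

End Exponentials.

(** * Growth of the weights *)

Section Weights.
Context (R : realType).
Implicit Types (k : \bar R) (T rho : R).

(** [l^l / l!] is a term of the series of [e^l]. *)
Lemma pow_le_fact l : (l%:R / expR 1 : R) ^+ l <= l`!%:R.
Proof.
have f0 : 0 < (l`!%:R : R) by rewrite ltr0n fact_gt0.
have := @pow_fact_le R l%:R l (ler0n _ _); rewrite ler_pdivrMr // => h.
rewrite expr_div_n ler_pdivrMr ?exprn_gt0 ?expR_gt0 //.
by rewrite -expRM_natl mulr1 mulrC.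
Qed.

(** This is where [1 < k] matters.  For finite [k] put [y = l / e]: the weight
    is at most [y^(l / k)] and [l!] is at least [y^l], so the product is at most
    [(T y^(1/k - 1))^l], where the exponent of [y] is negative. *)
Lemma exp_weight_fact k T : (1 < k)%E -> 0 <= T ->
  exists2 K : R, 0 <= K & forall l, exp_weight k l * (T ^+ l / l`!%:R) <= K.
Proof.
case: k => [r| |] //= k1 T0; last first.
  exists (expR T); first exact: expR_ge0.
  by move=> l; rewrite /exp_weight mul1r pow_fact_le.
have r1 : 1 < r by rewrite lte_fin in k1.
have r0 : 0 < r by apply: lt_trans r1.
pose d := 1 - r^-1.
have d0 : 0 < d by rewrite subr_gt0 invf_lt1.
(* For l >= M one has T <= y `^ d, and the product is at most 1. *)
pose M := Num.bound (expR 1 * T `^ d^-1).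
have M0 : expR 1 * T `^ d^-1 < M%:R.
  by apply: archi_boundP; rewrite mulr_ge0 ?expR_ge0 ?powR_ge0.
pose F l := exp_weight r%:E l * (T ^+ l / l`!%:R).
have F0 l : 0 <= F l.
  by rewrite mulr_ge0 ?exp_weight_ge0 // divr_ge0 ?exprn_ge0.
exists (\sum_(i < M) F i + 1); first by rewrite addr_ge0 // sumr_ge0.
move=> l; rewrite -/(F l); have [lM|Ml] := ltnP l M.
  by rewrite (bigD1 (Ordinal lM)) //= -addrA lerDl addr_ge0 // sumr_ge0.
apply: le_trans (_ : 1 <= _); last by rewrite lerDr sumr_ge0.
have l0 : 0 < (l%:R : R).
  apply: lt_le_trans (_ : M%:R <= _); last by rewrite ler_nat.
  by apply: le_lt_trans M0; rewrite mulr_ge0 ?expR_ge0 ?powR_ge0.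
pose y := l%:R / expR 1 : R.
have y0 : 0 < y by rewrite divr_gt0 // expR_gt0.
have Ty : T <= y `^ d.
  have : T `^ d^-1 <= y.
    rewrite /y ler_pdivlMr ?expR_gt0 // mulrC; apply: le_trans (ltW M0) _.
    by rewrite ler_nat.
  move/(ge0_ler_powR (ltW d0) (powR_ge0 _ _) (ltW y0)).
  by rewrite -powRrM mulVf ?lt0r_neq0 // powRr1.
have wy : exp_weight r%:E l <= y `^ (l%:R / r).
  rewrite /exp_weight; apply: ge0_ler_powR.
  - by rewrite divr_ge0 // ltW.
  - by rewrite nnegrE divr_ge0 // mulr_ge0 ?expR_ge0 // ltW.
  - by rewrite nnegrE ltW.
  - rewrite /y ler_pM2l // lef_pV2 ?posrE ?mulr_gt0 ?expR_gt0 //.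
    by rewrite ler_peMl ?expR_ge0 // ltW.
have Tl : T ^+ l <= y `^ (d * l%:R).
  rewrite powRrM powR_mulrn ?powR_ge0 // lerXn2r ?nnegrE ?powR_ge0 //.
rewrite /F mulrA ler_pdivrMr ?ltr0n ?fact_gt0 // mul1r.
apply: le_trans (pow_le_fact l); rewrite -/y.
apply: le_trans (_ : y `^ (l%:R / r) * y `^ (d * l%:R) <= _).
  by apply: ler_pM; rewrite ?exp_weight_ge0 ?exprn_ge0.
rewrite -powRD; last by rewrite (gt_eqF y0) implybT.
have -> : l%:R / r + d * l%:R = l%:R by rewrite /d; ring.
by rewrite powR_mulrn // ltW.
Qed.

(** The binomial coefficient of [l] and [d] is at most [2^l]. *)
Lemma fact_shift (d l : nat) : (d <= l)%N ->
  ((l - d)`!%:R : R)^-1 <= d`!%:R * 2 ^+ l / l`!%:R.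
Proof.
move=> dl; have f0 j : 0 < (j`!%:R : R) by rewrite ltr0n fact_gt0.
rewrite -[leLHS]mul1r ler_pdivrMr // mulrAC ler_pdivlMr // mul1r.
have hC : ('C(l, d) <= 2 ^ l)%N.
  have -> : (2 ^ l = \sum_(i < l.+1) 'C(l, i))%N.
    by rewrite -[2%N]/(1 + 1)%N expnDn; apply: eq_bigr => i _;
        rewrite !exp1n !muln1.
  have dl' : (d < l.+1)%N by [].
  by rewrite (bigD1 (Ordinal dl')) //= leq_addr.
rewrite -natrX -!natrM ler_nat -(bin_fact dl) mulnA leq_mul2r; apply/orP; right.
by rewrite mulnC leq_mul2l hC orbT.
Qed.

(** One factor [2^-l] makes sums over [l] converge, the other makes their tails
    small. *)
Lemma exp_weight_shift k T rho (d : nat) : (1 < k)%E -> 0 <= T -> 0 < rho ->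
  exists2 K : R, 0 <= K & forall l, (d <= l)%N ->
    rho ^- l * exp_weight k l * (T ^+ (l - d) / (l - d)`!%:R) <=
      K * 2^-1 ^+ l * 2^-1 ^+ l.
Proof.
move=> k1 T0 rho0.
pose T1 := T + 1; have T10 : 0 < T1 by rewrite ltr_wpDl.
have T2 : 0 <= 8 * T1 / rho by rewrite divr_ge0 ?mulr_ge0 // ltW.
have [K K0 HK] := exp_weight_fact k1 T2.
exists (d`!%:R * K); first by rewrite mulr_ge0.
move=> l dl.
have h1 : T ^+ (l - d) / (l - d)`!%:R <= T1 ^+ l * (d`!%:R * 2 ^+ l / l`!%:R).
  apply: ler_pM; rewrite ?exprn_ge0 ?invr_ge0 ?fact_shift //.
  apply: le_trans (_ : T1 ^+ (l - d) <= _).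
    by rewrite lerXn2r ?nnegrE ?(ltW T10) // /T1 lerDl.
  by rewrite ler_weXn2l ?leq_subr // /T1 lerDr.
have w0 : 0 <= rho ^- l * exp_weight k l.
  by rewrite mulr_ge0 ?exp_weight_ge0 // invr_ge0 exprn_ge0 // ltW.
apply: le_trans (ler_wpM2l w0 h1) _.
rewrite -[_ * _ * 2^-1 ^+ l]mulrA -exprMn -[leRHS]mulrA.
apply: le_trans (_ : d`!%:R * ((exp_weight k l * ((8 * T1 / rho) ^+ l /
    l`!%:R)) * (2^-1 * 2^-1) ^+ l) <= _); last first.
  by rewrite ler_wpM2l // ler_wpM2r ?HK // exprn_ge0.
have r0 : rho ^+ l != 0 by rewrite expf_neq0 // lt0r_neq0.
have -> : (2^-1 * 2^-1 : R) ^+ l = 2 ^- l * 2 ^- l by rewrite exprMn exprVn.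
have -> : (8 : R) = 2 * 2 * 2 by ring.
rewrite !exprMn exprVn.
have n0 : (2 : R) ^+ l != 0 by rewrite expf_neq0.
have f0 : (l`!%:R : R) != 0 by rewrite pnatr_eq0 -lt0n fact_gt0.
move: r0 n0 f0;
    move: (rho ^+ l) (2 ^+ l) (l`!%:R) (d`!%:R) (T1 ^+ l) (exp_weight k l).
move=> a b c e f g r0 n0 f0.
by rewrite le_eqVlt; apply/orP; left; apply/eqP; field; rewrite r0 n0 f0.
Qed.

End Weights.

(** * Seminorms of sequences of homogeneous polynomials *)

Section SeqNorm.
Context (R : realType) (n : nat) (N : cnorm R n) (k : \bar R).
Local Notation C := R[i].
Local Notation V := 'rV[C]_n.
Implicit Types (Q S : nat -> V -> C) (rho : R).

(** [expnorm] of a function is [snorm] of its Taylor sequence at 0.  On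
    sequences it also applies to the expansions [mexp_taylor P d c] for
    arbitrary homogeneous [P]. *)
Definition snorm rho Q : \bar R :=
  (\sum_(0 <= j <oo) (rho ^- j * exp_weight k j)%:E * hnorm N (Q j))%E.

Lemma weight_ge0 rho j : 0 <= rho -> 0 <= rho ^- j * exp_weight k j.
Proof. by move=> r0; rewrite mulr_ge0 ?exp_weight_ge0 // invr_ge0 exprn_ge0. Qed.

Lemma snorm_term_ge0 rho (P : V -> C) j : 0 <= rho ->
  (0 <= (rho ^- j * exp_weight k j)%:E * hnorm N P)%E.
Proof. by move=> r0; rewrite mule_ge0 ?hnorm_ge0 // lee_fin weight_ge0. Qed.

Lemma snorm_ge0 rho Q : 0 <= rho -> (0 <= snorm rho Q)%E.
Proof. by move=> r0; apply: nneseries_ge0 => j _ _; exact: snorm_term_ge0. Qed.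

Lemma snorm_lin rho (a : C) Q S : 0 <= rho ->
  (snorm rho (fun j => a *: Q j + S j)%R
    <= (cabs a)%:E * snorm rho Q + snorm rho S)%E.
Proof.
move=> rho0; rewrite /snorm.
rewrite -nneseriesZl; last by move=> *; exact: snorm_term_ge0.
rewrite -nneseriesD; first last.
- by move=> *; exact: snorm_term_ge0.
- by move=> *; rewrite mule_ge0 ?lee_fin ?cabs_ge0 // snorm_term_ge0.
apply: lee_nneseries => [j _ _|j _]; first exact: snorm_term_ge0.
rewrite muleCA -ge0_muleDr ?mule_ge0 ?hnorm_ge0 ?lee_fin ?cabs_ge0 //.
by rewrite lee_wpmul2l ?lee_fin ?weight_ge0 // hnorm_lin.
Qed.

Lemma snorm_le_geometric rho Q (u : nat -> R) (a x : R) : 0 <= rho ->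
  0 <= x < 1 -> (forall j, (hnorm N (Q j) <= (u j)%:E)%E) ->
  (forall j, rho ^- j * exp_weight k j * u j <= a * x ^+ j) ->
  (snorm rho Q <= (a / (1 - x))%:E)%E.
Proof.
move=> r0 /andP[x0 x1] hQ hu.
have a0 : 0 <= a.
  have := hu 0%N; rewrite [x ^+ 0]expr0 mulr1; apply: le_trans.
  apply: mulr_ge0; first exact: weight_ge0.
  by rewrite -lee_fin; exact: le_trans (hnorm_ge0 _ _) (hQ 0%N).
apply: lime_le.
  by apply: is_cvg_nneseries => j _ _; exact: snorm_term_ge0.
apply: nearW => m; rewrite big_mkord.
apply: le_trans (_ : (\sum_(j < m) (a * x ^+ j)%:E <= _)%E).
  apply: lee_sum => j _;
      apply: le_trans (_ : ((rho ^- j * exp_weight k j)%:E * (u j)%:E)%E <= _)%E.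
    by rewrite lee_wpmul2l ?lee_fin ?weight_ge0.
  by rewrite -EFinM lee_fin.
rewrite sumEFin lee_fin -mulr_sumr ler_wpM2l //.
have y0 : 0 < 1 - x by rewrite subr_gt0.
rewrite -[leRHS]mul1r ler_pdivlMr // mulrC.
have -> : (1 - x) * (\sum_(i < m) x ^+ i) = 1 - x ^+ m.
  by rewrite -opprB mulNr -subrX1 opprB.
by rewrite gerBl exprn_ge0.
Qed.

Lemma snorm_le rho Q (u : nat -> R) (a : R) : 0 <= rho ->
  (forall j, (hnorm N (Q j) <= (u j)%:E)%E) ->
  (forall j, rho ^- j * exp_weight k j * u j <= a * 2^-1 ^+ j) ->
  (snorm rho Q <= (2 * a)%:E)%E.
Proof.
move=> r0 hQ hu; have -> : 2 * a = a / (1 - 2^-1) by field.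
by apply: (snorm_le_geometric r0 _ hQ hu); lra.
Qed.

Lemma hnorm_le_snorm rho Q j : 0 < rho -> 0 < exp_weight k j ->
  ((rho ^- j * exp_weight k j)%:E * hnorm N (Q j) <= snorm rho Q)%E.
Proof.
move=> r0 w0.
have := @nneseries_lim_ge R (fun j => (rho ^- j * exp_weight k j)%:E * hnorm N
    (Q j))%E
  xpredT 0 j.+1 (fun j _ _ => snorm_term_ge0 _ j (ltW r0)).
apply: le_trans; rewrite big_nat_recr //= leeDr //.
by apply: sume_ge0 => i _; exact: snorm_term_ge0 (ltW r0).
Qed.

(** For [Q] dominated by the expansion of [B N^d e^(T N)] and without terms of
    degree less than [M].  The constant [K] does not depend on [B]
    and [M], so the bound is small both for large [M] and for small [B]. *)
Lemma snorm_tail rho (T : R) (d : nat) : (1 < k)%E -> 0 < rho -> 0 <= T ->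
  exists2 K : R, 0 <= K & forall Q (B : R) M, 0 <= B ->
    (forall l, (d <= l)%N -> (M <= l)%N ->
      forall x, cabs (Q l x) <= B * (T ^+ (l - d) / (l - d)`!%:R) * N x ^+ l) ->
    (forall l, ~~ ((d <= l) && (M <= l))%N -> Q l = 0) ->
    (snorm rho Q <= (B * K * 2^-1 ^+ M)%:E)%E.
Proof.
move=> k1 r0 T0; have [K K0 HK] := exp_weight_shift d k1 T0 r0.
exists (2 * K) => [|Q B M B0 hQ Q0]; first by rewrite mulr_ge0.
pose u l := if ((d <= l) && (M <= l))%N
  then B * (T ^+ (l - d) / (l - d)`!%:R) else 0.
have := @snorm_le rho Q u (B * K * 2^-1 ^+ M) (ltW r0).
rewrite (mulrA 2) (mulrA 2) (mulrCA B 2) mulrA => -> //.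
  move=> l; rewrite /u; case: ifPn => [/andP[dl Ml]|/Q0 ->]; last by rewrite hnorm0.
  apply: hnorm_le (hQ l dl Ml).
  by rewrite mulr_ge0 // divr_ge0 ?exprn_ge0.
move=> l; rewrite /u; case: ifP => [/andP[dl Ml]|_]; last first.
  by rewrite mulr0 !mulr_ge0 ?half_ge0.
rewrite mulrCA -(mulrA B) -(mulrA B) ler_wpM2l //.
apply: le_trans (HK l dl) _; rewrite ler_wpM2r ?half_ge0 // ler_wpM2l //.
by rewrite ler_wiXn2l ?invr_ge0 //; lra.
Qed.

End SeqNorm.

(** * Taylor expansions along complex lines *)

Section TaylorLine.
Context (R : realType) (n : nat) (N : cnorm R n).
Local Notation C := R[i].
Local Notation V := 'rV[C]_n.
Implicit Types (f : V -> C) (P : nat -> V -> C).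

Lemma taylor_line f a P : taylor_expansion N f a P -> exists2 r : R, 0 < r &
  forall b (t : C), cabs t * N b < r -> csum (fun j => P j b * t ^+ j) (f (a +
      t *: b)).
Proof.
move=> [hP [r r0 /uniform_cabsP H]]; exists r => // b t tb e e0.
apply: filterS (H e e0) => m /(_ (a + t *: b)) /=.
rewrite addrAC subrr add0r cnormZ => /(_ tb).
by under eq_bigr do rewrite (homog_polyZ _ _ (hP _)) mulrC.
Qed.

Lemma taylor_value f a P b : taylor_expansion N f a P -> P 0%N b = f a.
Proof.
move=> /taylor_line[r r0 /(_ b 0)]; rewrite cabs0 mul0r r0 scale0r addr0.
move=> /(_ isT) h; apply: csum_unique h.
have := @csum_finite _ (fun j => P j b * 0 ^+ j) 1; rewrite big_ord1 mulr1.
by apply => -[//|j] _; rewrite expr0n mulr0.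
Qed.

End TaylorLine.

(** * Seminorms and topology of Exp *)

Section ExpSpace.
Context (R : realType) (n : nat) (N : cnorm R n) (k : \bar R) (A : {nonneg R}).
Local Notation C := R[i].
Local Notation V := 'rV[C]_n.
Local Notation X := (Exp N k A).
Implicit Types (f g : X) (rho : R).

Lemma rho_gt0 rho : A%:num < rho -> 0 < rho.
Proof. by apply: le_lt_trans. Qed.

Lemma exp_expset f : expset N k A f.
Proof. by case: f => f /= /asboolP. Qed.

Lemma exp_local f x : expdom N k A x -> exists P, taylor_expansion N f x P.
Proof. by move=> hx; have [h _ _] := exp_expset f; exact: h. Qed.

Lemma exp_taylor f : taylor_expansion N f 0 (taylor N f 0).
Proof. by apply: taylorP; apply: exp_local; exact: expdom0. Qed.

Lemma exp_taylor_homog f j : homog_poly j (taylor N f 0 j).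
Proof. by have [h _] := exp_taylor f. Qed.

Lemma exp_taylor_lin (a : C) f g :
  taylor N (a *: f + g)%R 0 = (fun j => a *: taylor N f 0 j + taylor N g 0 j).
Proof. exact: taylorE (taylor_expansion_lin a (exp_taylor f) (exp_taylor g)). Qed.

Lemma expnorm_snorm rho f : expnorm N k rho f = snorm N k rho (taylor N f 0).
Proof. by []. Qed.

Lemma exp_taylor0 : taylor N (0 : X) 0 = (fun=> 0).
Proof. exact: taylorE (taylor_expansion0 N 0). Qed.

Lemma expnorm_ge0 rho f : A%:num < rho -> (0 <= expnorm N k rho f)%E.
Proof. by move=> /rho_gt0 /ltW; exact: snorm_ge0. Qed.

Lemma expnorm0 rho : expnorm N k rho (0 : X) = 0%E.
Proof.
by rewrite expnorm_snorm exp_taylor0; apply: eseries0 => j _ _;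
    rewrite hnorm0 mule0.
Qed.

Lemma expnorm_linX rho (a : C) f g : A%:num < rho ->
  (expnorm N k rho (a *: f + g)%R
    <= (cabs a)%:E * expnorm N k rho f + expnorm N k rho g)%E.
Proof.
by move=> /rho_gt0/ltW r0; exact: expnorm_lin (exp_taylor f) (exp_taylor g).
Qed.

Lemma expnormD rho f g : A%:num < rho ->
  (expnorm N k rho (f + g)%R <= expnorm N k rho f + expnorm N k rho g)%E.
Proof.
by move=> r0; have := expnorm_linX 1 f g r0; rewrite scale1r cabs1 mul1e.
Qed.

Lemma root_le (x : \bar R) (j : nat) (d : R) : (0 <= x)%E -> (0 < j)%N ->
  0 <= d -> (x `^ (j%:R^-1) <= d%:E)%E <-> (x <= (d ^+ j)%:E)%E.
Proof.
move=> x0 j0 d0; have jn0 : (j%:R : R) != 0 by rewrite pnatr_eq0 -lt0n.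
have EX : ((d ^+ j)%:E = d%:E `^ (j%:R))%E by rewrite poweR_EFin powR_mulrn.
split=> h.
  rewrite -[x]poweRe1 // -(mulVf jn0) poweRrM EX.
  apply: gt0_ler_poweR => //; rewrite ?ler0n // in_itv /= ?poweR_ge0 ?leey //.
  by rewrite lee_fin d0.
have -> : (d%:E = (d ^+ j)%:E `^ (j%:R^-1))%E.
  by rewrite EX -poweRrM mulfV // poweRe1 // lee_fin.
apply: gt0_ler_poweR => //; rewrite ?invr_ge0 ?ler0n // in_itv /= ?leey ?x0 //.
by rewrite lee_fin exprn_ge0.
Qed.

(** Beyond some index the terms are at most [b ^+ j]; the constant [K] takes
    care of the others. *)
Lemma root_growth_bound (u : nat -> \bar R) (a b : R) : 0 <= a < b ->
  (forall j, 0 <= u j)%E -> (forall j, u j < +oo)%E ->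
  (limn_esup (fun j => u j `^ (j%:R^-1)) <= a%:E)%E ->
  exists2 K : R, 0 <= K & forall j, (u j <= (K * b ^+ j)%:E)%E.
Proof.
move=> /andP[a0 ab] u0 uoo /limn_esup_leP /(_ b ab) [M _ HM].
have b0 : 0 < b by apply: le_lt_trans ab.
have uE j : u j = (fine (u j))%:E by rewrite fineK // ge0_fin_numE.
pose F j := fine (u j) / b ^+ j.
have F0 j : 0 <= F j by rewrite divr_ge0 ?fine_ge0 // exprn_ge0 // ltW.
exists (\sum_(i < M.+1) F i + 1); first by rewrite addr_ge0 // sumr_ge0.
move=> j; have [jM|Mj] := ltnP j M.+1.
  rewrite uE lee_fin -ler_pdivrMr ?exprn_gt0 // -/(F j).
  by rewrite (bigD1 (Ordinal jM)) //= -addrA lerDl addr_ge0 // sumr_ge0.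
have j0 : (0 < j)%N by apply: leq_ltn_trans Mj.
have /(root_le (u0 j) j0 (ltW b0)) := HM j (ltnW Mj); move/le_trans; apply.
rewrite lee_fin ler_peMl ?exprn_ge0 ?(ltW b0) // lerDr sumr_ge0 //.
Qed.

(** For [k = +oo] this is the root test; otherwise it is the growth condition. *)
Lemma expnorm_fin rho f : (1 < k)%E -> A%:num < rho -> (expnorm N k rho f < +oo)%E.
Proof.
move=> k1 Arho; have [_ _] := exp_expset f.
have hfin j : (hnorm N (taylor N f 0 j) < +oo)%E.
  exact: hnorm_fin (exp_taylor_homog f j).
rewrite /exp_growth; move: (f : V -> C) hfin => F hfin.
case: k k1 => [r| |] // k1 H; first exact: H.
(* Root test with ratio b / rho. *)
pose b := (A%:num + rho) / 2.
have A0 : 0 <= A%:num by [].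
have Ab : A%:num < b by rewrite /b; lra.
have br : b < rho by rewrite /b; lra.
have r0 := rho_gt0 Arho.
have [|j|j|K K0 HK] := root_growth_bound _ _ _ H (b := b).
- by rewrite A0.
- exact: hnorm_ge0.
- exact: hfin.
have hx : 0 <= b / rho < 1.
  by rewrite ltr_pdivrMr // mul1r br andbT divr_ge0 // ltW // (le_lt_trans A0).
apply: le_lt_trans (snorm_le_geometric (ltW r0) hx HK (a := K) _) (ltry _) => j.
rewrite /exp_weight mulr1 mulrCA ler_wpM2l //.
by rewrite mulrC [leRHS]exprMn exprVn.
Qed.

Lemma exp_ball_open f rho (e : R) : A%:num < rho -> 0 < e ->
  open [set g : X | (expnorm N k rho (g - f)%R < e%:E)%E].
Proof.
move=> Arho e0; exists [set [set g : X | (expnorm N k rho (g - f)%R < e%:E)%E]].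
  move=> _ ->; exists (finmap.fset1 ((f, rho, e) : X * R * R)).
    by move=> i; rewrite finmap.in_fset1 => /eqP -> /=; rewrite inE.
  rewrite predeqE => g; split=> [/(_ (f, rho, e)) /= |h i /=].
    by apply; rewrite finmap.in_fset1.
  by rewrite finmap.in_fset1 => /eqP ->.
by rewrite bigcup_set1.
Qed.

Lemma expnorm_decr rho rho' f : A%:num < rho -> rho <= rho' ->
  (expnorm N k rho' f <= expnorm N k rho f)%E.
Proof.
move=> Arho rr; have r0 := rho_gt0 Arho; have r0' := lt_le_trans r0 rr.
apply: lee_nneseries => [j _ _|j _]; first exact: snorm_term_ge0 (ltW _).
rewrite lee_wpmul2r ?hnorm_ge0 // lee_fin ler_wpM2r ?exp_weight_ge0 //.
rewrite lef_pV2 ?posrE ?exprn_gt0 // lerXn2r ?nnegrE // ltW //.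
Qed.

(** The seminorms decrease with [rho], so that the least of finitely many [rho]
    serves for all the balls, whatever their centers. *)
Lemma exp_ball_inter f (s : seq (X * R * R)) : (1 < k)%E ->
  (forall i, i \in s -> (expnorm N k i.1.2 (f - i.1.1)%R < i.2%:E)%E) ->
  (forall i, i \in s -> A%:num < i.1.2 /\ 0 < i.2) ->
  exists rho e, [/\ A%:num < rho, 0 < e &
    forall g, (expnorm N k rho (g - f)%R < e%:E)%E -> forall i, i \in s ->
      (expnorm N k i.1.2 (g - i.1.1)%R < i.2%:E)%E].
Proof.
move=> k1; elim: s => [|[[h r] e] s IH] Bf sF.
  exists (A%:num + 1), 1; split; [by rewrite ltrDl|exact: ltr01|].
  by move=> g _ i; rewrite in_nil.
have [||r1 [e1 [Ar1 e10 H1]]] := IH.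
- by move=> i si; apply: Bf; rewrite inE si orbT.
- by move=> i si; apply: sF; rewrite inE si orbT.
have [/= Ar e0] := sF (h, r, e) (mem_head _ _).
have /= fh := Bf (h, r, e) (mem_head _ _).
have fin : expnorm N k r (f - h)%R \is a fin_num.
  by rewrite ge0_fin_numE ?expnorm_fin // expnorm_ge0.
pose d := e - fine (expnorm N k r (f - h)%R).
have d0 : 0 < d by rewrite subr_gt0 -lte_fin fineK.
exists (Num.min r r1), (Num.min d e1); split.
- by rewrite lt_min Ar.
- by rewrite lt_min d0.
have Am : A%:num < Num.min r r1 by rewrite lt_min Ar.
move=> g gm i; rewrite inE => /predU1P[->|si] /=.
  have := expnormD (g - f) (f - h) Ar; rewrite subrKA => /le_lt_trans; apply.
  have mr : Num.min r r1 <= r by rewrite ge_min lexx.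
  have h1 : (expnorm N k r (g - f)%R < d%:E)%E.
    apply: le_lt_trans (expnorm_decr (g - f) Am mr) (lt_le_trans gm _).
    by rewrite lee_fin ge_min lexx.
  have -> : e%:E = (d%:E + expnorm N k r (f - h)%R)%E.
    by rewrite -(fineK fin) -EFinD subrK.
  by rewrite lte_leD.
have mr1 : Num.min r r1 <= r1 by rewrite ge_min lexx orbT.
apply: (H1 g _ i si).
apply: le_lt_trans (expnorm_decr (g - f) Am mr1) (lt_le_trans gm _).
by rewrite lee_fin ge_min lexx orbT.
Qed.

Lemma exp_nbhs_ball f (U : set X) : (1 < k)%E -> open U -> U f ->
  exists rho e, [/\ A%:num < rho, 0 < e &
  forall g, (expnorm N k rho (g - f)%R < e%:E)%E -> U g].
Proof.
move=> k1 [D' sD <-] [B D'B Bf].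
have [F sF EB] := sD _ D'B; rewrite -EB in Bf.
have [|i|rho [e [Ar e0 H]]] := @exp_ball_inter f (finmap.enum_fset F) k1.
- by move=> i iF; exact: Bf.
- by move=> iF; have := sF i iF; rewrite inE.
exists rho, e; split=> // g /H hg; exists B; first exact: D'B.
by rewrite -EB; move=> i iF; exact: (hg i iF).
Qed.

Lemma continuous_linear_bound (L : X -> X) rho (e : R) : (1 < k)%E ->
  linear L -> continuous L -> A%:num < rho -> 0 < e ->
  exists rho' d, [/\ A%:num < rho', 0 < d & forall f,
    (expnorm N k rho' f < d%:E)%E -> (expnorm N k rho (L f) < e%:E)%E].
Proof.
move=> k1 linL contL Ar e0.
have L0 : L 0 = 0.
  by have := linL (-1) 0 0; rewrite !scaleN1r !addNr.
have oB := exp_ball_open 0 Ar e0.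
have := open_comp (fun x _ => contL x) oB.
move=> /(exp_nbhs_ball k1) /(_ (_ : _ 0)).
case=> [|rho' [d [Ar' d0 H]]].
  by rewrite /= L0 subrr expnorm0 lte_fin.
exists rho', d; split => // f fd; have := H f; rewrite /= !subr0; exact.
Qed.

Lemma expnorm_eval0 rho f : A%:num < rho -> ((cabs (f 0))%:E <= expnorm N k rho
    f)%E.
Proof.
move=> Ar; have r0 := rho_gt0 Ar.
have w1 : exp_weight k 0 = 1.
  by rewrite /exp_weight; case: k => [r| |] //; rewrite !mul0r powRr0.
have := @hnorm_le_snorm R n N k rho (taylor N f 0) 0%N r0.
rewrite w1 ltr01 expr0 invr1 mulr1 mul1e => /(_ isT); apply: le_trans.
apply: ereal_sup_ubound; exists 0; first by rewrite /= cnorm0.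
by rewrite (taylor_value _ (exp_taylor f)).
Qed.

Lemma expdom_nbhs (x : V) : expdom N k A x -> exists2 r : R, 0 < r &
  forall y, N (y - x) < r -> expdom N k A y.
Proof.
rewrite /expdom; case: k => [r _||_]; [by exists 1| |by exists 1].
case: eqP => _; first by exists 1.
move=> /= xA; exists (A%:num^-1 - N x); first by rewrite subr_gt0.
move=> y yx; rewrite -(subrK x y); apply: le_lt_trans (cnormD _ _ _) _.
by rewrite -ltrBrDr.
Qed.

Lemma expdom_scale (x : V) (t : R) : 0 <= t <= 1 -> expdom N k A x ->
  expdom N k A (t%:C%C *: x).
Proof.
move=> /andP[t0 t1]; rewrite /expdom; case: k => [r //||//].
case: eqP => // _ /=; rewrite cnormZ cabs_real //; apply: le_lt_trans.
by rewrite ler_piMl ?cnorm_ge0.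
Qed.

End ExpSpace.

(** * A differential equation for power series *)

Section PowerSeriesODE.
Context (R : realType).
Local Notation C := R[i].

Lemma pow_incr_le (u v h : C) m : cabs h <= 1 ->
  cabs ((u + h * v) ^+ m - u ^+ m) <= cabs h * (cabs u + cabs v) ^+ m.
Proof.
move=> h1; rewrite exprDn big_ord_recl subn0 expr0 mulr1 bin0 mulr1n addrAC
    subrr add0r.
rewrite exprDn mulr_sumr [leRHS]big_ord_recl.
rewrite ler_wpDl ?mulr_ge0 ?cabs_ge0 ?mulrn_wge0 ?mulr_ge0 ?exprn_ge0 ?cabs_ge0 //.
apply: le_trans (ler_cabs_sum _ _ _) _; apply: ler_sum => i _.
rewrite -mulr_natr cabsM cabs_nat mulr_natr mulrnAr lerMn2r; apply/orP; right.
rewrite cabsM !cabsX cabsM exprMn mulrCA.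
rewrite ler_wpM2r ?mulr_ge0 ?exprn_ge0 ?cabs_ge0 // lift0 exprS.
by rewrite ler_piMr ?cabs_ge0 // exprn_ile1 ?cabs_ge0.
Qed.

(** Only the terms of degree at least 2 in [h] of the binomial expansion remain. *)
Lemma pow_incr2_le (u v h : C) m : cabs h <= 1 ->
  cabs ((u + h * v) ^+ m - u ^+ m - h * (m%:R * v * u ^+ m.-1)) <=
    cabs h ^+ 2 * (cabs u + cabs v) ^+ m.
Proof.
move=> h1; case: m => [|m].
  by rewrite !expr0 subrr mul0r mul0r mulr0 subr0 cabs0 mulr1 exprn_ge0 ?cabs_ge0.
rewrite exprDn big_ord_recl subn0 expr0 mulr1 bin0 mulr1n.
rewrite [X in cabs (X - _)]addrAC subrr add0r big_ord_recl lift0 bin1 subn1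
    expr1 /= addrAC.
have -> : u ^+ m * (h * v) *+ m.+1 - h * (m.+1%:R * v * u ^+ m) = 0.
  by rewrite -mulr_natl; move: (m.+1%:R) => z; ring.
rewrite add0r exprDn mulr_sumr [leRHS]big_ord_recl [X in _ + X]big_ord_recl addrA.
rewrite ler_wpDl ?addr_ge0 ?mulr_ge0 ?exprn_ge0 ?cabs_ge0 ?mulrn_wge0 ?mulr_ge0
    ?exprn_ge0 ?cabs_ge0 //.
apply: le_trans (ler_cabs_sum _ _ _) _; apply: ler_sum => i _.
rewrite -mulr_natr cabsM cabs_nat mulr_natr mulrnAr lerMn2r; apply/orP; right.
rewrite cabsM !cabsX cabsM exprMn mulrCA.
rewrite !lift0 -[bump 0 (bump 0 i)]/(i.+2).
apply: ler_wpM2r; first by rewrite mulr_ge0 ?exprn_ge0 ?cabs_ge0.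
by apply: ler_wiXn2l; rewrite ?cabs_ge0.
Qed.

Lemma csum_sub (c d : nat -> C) w z : csum c w -> csum d z ->
  csum (fun j => c j - d j) (w - z).
Proof.
move=> hw hz; have := csum_lin 1 (-1) hw hz; rewrite mul1r mulN1r.
by under eq_fun do rewrite mul1r mulN1r.
Qed.

(** It suffices to differentiate the series term by term and to compare
    coefficients.  For small [s], the difference quotient of [u] between [z] and
    [z + s] is within [O(|s|) + O(2^-m)] of the partial sum of length [m] of the
    differentiated series; letting [s] tend to 0 shows that these partial sums
    converge to [lam * u z]. *)
Lemma csum_ode (q : nat -> C) (lam : C) (u : C -> C) (r : R) : 0 < r ->
  (forall t, cabs t < r -> csum (fun j => q j * t ^+ j) (u t)) ->
  (forall t, cabs t < r -> exists K d : R, 0 < d /\ forall s, cabs s <= d ->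
     cabs (u (t + s) - u t - s * (lam * u t)) <= K * cabs s ^+ 2) ->
  forall j, j.+1%:R * q j.+1 = lam * q j.
Proof.
move=> r0 hq hu j.
pose r1 := r / 2; have r10 : 0 < r1 by rewrite divr_gt0.
have r1r : r1 < r by rewrite /r1; lra.
have cr1 : cabs (r1%:C%C) = r1 by rewrite cabs_real // ltW.
have [K0 [K00 HK0]] : exists K0, 0 <= K0 /\ forall j, cabs (q j) * r1 ^+ j <= K0.
  by rewrite -cr1; apply: (@csum_pow_bounded _ _ _ (u r1%:C%C)); apply: hq;
      rewrite cr1.
(* Increments are multiples h * sg, |h| <= 1; for |z| < sg this gives
   |z| + sg <= r1 / 2, whence the factor 2^-j. *)
pose sg := r1 / 4; have sg0 : 0 < sg by rewrite divr_gt0.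
suff H t : 0 < t < sg ->
    csum (fun j => (j.+1%:R * q j.+1 - lam * q j) * t%:C%C ^+ j) 0.
  by apply/eqP; rewrite -subr_eq0; apply/eqP; move: j; exact: csum_zero_coef sg0 H.
move=> /andP[t0 tsg]; set z := t%:C%C.
have cz : cabs z = t by rewrite cabs_real // ltW.
have zr : cabs z < r by rewrite cz; move: tsg; rewrite /sg /r1; lra.
suff {j} D : csum (fun j => j.+1%:R * q j.+1 * z ^+ j) (lam * u z).
  have := csum_sub D (csumZ lam (hq z zr)); rewrite subrr.
  by under eq_fun do rewrite mulrA -mulrBl.
set d := lam * u z.
have csg : cabs sg%:C%C = sg by rewrite cabs_real // ltW.
have qb j x : 0 <= x -> cabs (q j) * (x * (cabs z + cabs sg%:C%C) ^+ j) <= x *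
    (K0 * 2^-1 ^+ j).
  move=> x0; rewrite mulrCA ler_wpM2l // csg cz.
  apply: le_trans (_ : cabs (q j) * (r1 / 2) ^+ j <= _).
    rewrite ler_wpM2l ?cabs_ge0 // lerXn2r ?nnegrE ?addr_ge0 ?divr_ge0 ?ltW //.
    by move: tsg; rewrite /sg; lra.
  by rewrite exprMn mulrA ler_wpM2r ?half_ge0.
have key m : cabs (d - \sum_(j < m) j.+1%:R * q j.+1 * z ^+ j) * sg <=
    2 * K0 * 2^-1 ^+ m.
  set S := \sum_(j < m) _.
  have [K [dd [dd0 HK]]] := hu z zr.
  pose W := `|K| * sg ^+ 2 + 2 * K0.
  have W0 : 0 <= W by rewrite addr_ge0 ?mulr_ge0 ?exprn_ge0 // ltW.
  apply/ler_addgt0Pr => e e0.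
  pose h := Num.min (Num.min 1 (dd / sg)) (e / (W + 1)).
  have h0 : 0 < h.
    by rewrite !lt_min ltr01 !divr_gt0 // ltr_wpDl.
  have h1 : h <= 1 by rewrite !ge_min lexx.
  have hd : h * sg <= dd by rewrite -ler_pdivlMr // !ge_min lexx orbT.
  have hW : W * h <= e.
    apply: le_trans (_ : W * (e / (W + 1)) <= _).
      by rewrite ler_wpM2l // !ge_min lexx orbT.
    by rewrite mulrA ler_pdivrMr ?ltr_wpDl // mulrC ler_wpM2l ?lerDl // ltW.
  pose H := h%:C%C; have cH : cabs H = h by rewrite cabs_real // ltW.
  have cH1 : cabs H <= 1 by rewrite cH.
  pose s := H * sg%:C%C.
  have cs : cabs s = h * sg by rewrite /s cabsM cH csg.
  have zs : cabs (z + s) < r.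
    apply: le_lt_trans (ler_cabsD _ _) _; rewrite cs cz.
    have : h * sg <= sg by rewrite ler_piMl // ltW.
    by move: tsg; rewrite /sg /r1; lra.
  have hD := csum_sub (hq _ zs) (hq _ zr).
  pose g j := q j * ((z + s) ^+ j - z ^+ j).
  have {}hD : csum g (u (z + s) - u z).
    by move: hD; under eq_fun do rewrite -mulrBr.
  have g1 j : cabs (g j) <= h * K0 * 2^-1 ^+ j.
    rewrite cabsM -mulrA -cH; apply: le_trans (qb j _ (cabs_ge0 H)).
    by rewrite ler_wpM2l ?cabs_ge0 // pow_incr_le.
  have T1 := csum_le hD (fun j (_ : (m.+1 <= j)%N) => g1 j).
  have T2 : cabs (\sum_(j < m.+1) g j - s * S) <= 2 * (h ^+ 2 * K0).
    have -> : s * S = \sum_(j < m.+1) q j * (H * (j%:R * sg%:C%C * z ^+ j.-1)).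
      rewrite big_ord_recl mul0r mul0r mulr0 mulr0 add0r mulr_sumr.
      apply: eq_bigr => i _; rewrite !lift0 /= /s.
      by move: (i.+1%:R) => y; ring.
    rewrite -sumrB; apply: le_trans (ler_cabs_sum _ _ _) _.
    apply: le_trans (_ : \sum_(j < m.+1) h ^+ 2 * (K0 * 2^-1 ^+ j) <= _).
      apply: ler_sum => j _; rewrite /g -mulrBr cabsM.
      apply: le_trans (qb j (h ^+ 2) _); last by rewrite exprn_ge0 // ltW.
      by rewrite ler_wpM2l ?cabs_ge0 // -cH pow_incr2_le.
    rewrite -mulr_sumr -mulr_sumr mulrA (mulrC 2).
    apply: ler_wpM2l; last exact: sum_half_ord.
    by rewrite mulr_ge0 ?exprn_ge0 // ltW.
  have T3 := HK s; rewrite cs in T3; have {}T3 := T3 hd.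
  have T4 : cabs (s * (d - S)) <= h * (2 * K0 * 2^-1 ^+ m + e).
    have -> : s * (d - S) = (u (z + s) - u z - \sum_(j < m.+1) g j)
       + (\sum_(j < m.+1) g j - s * S) - (u (z + s) - u z - s * d) by ring.
    apply: le_trans (ler_cabsB _ _) _.
    apply: le_trans (lerD (ler_cabsD _ _) (lexx _)) _.
    apply: le_trans (lerD (lerD T1 T2) T3) _.
    have a1 : 2 * (h * K0) * 2^-1 ^+ m.+1 <= h * (2 * K0 * 2^-1 ^+ m).
      have -> : h * (2 * K0 * 2^-1 ^+ m) = 2 * (h * K0) * 2^-1 ^+ m by ring.
      rewrite ler_wpM2l ?mulr_ge0 ?(ltW h0) // exprS ler_piMl ?half_ge0 //; lra.
    have a2 : 2 * (h ^+ 2 * K0) + K * (h * sg) ^+ 2 <= h * e.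
      apply: le_trans (_ : h * (W * h) <= _); last by rewrite ler_pM2l.
      have -> : h * (W * h) = 2 * (h ^+ 2 * K0) + `|K| * (h * sg) ^+ 2.
        by rewrite /W; ring.
      by rewrite lerD2l ler_wpM2r ?ler_norm // exprn_ge0 // mulr_ge0 // ltW.
    by rewrite mulrDr -addrA; apply: lerD.
  by move: T4; rewrite cabsM cs -[leLHS]mulrA (ler_pM2l h0) mulrC.
move=> e e0.
have e1 : 0 < e * sg / (2 * K0 + 1) by rewrite !divr_gt0 ?mulr_gt0 // ltr_wpDl
    // mulr_ge0.
apply: filterS (half_small e1) => m;
    rewrite ltr_pdivlMr ?ltr_wpDl ?mulr_ge0 // => hm.
rewrite -(ltr_pM2r sg0); apply: le_lt_trans (key m) _; apply: le_lt_trans hm.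
by rewrite mulrC ler_wpM2l ?half_ge0 // lerDl.
Qed.

End PowerSeriesODE.

(** * Directional derivatives from Taylor expansions *)

Section TaylorDerivative.
Context (R : realType) (n : nat) (N : cnorm R n).
Local Notation C := R[i].
Local Notation V := 'rV[C]_n.
Implicit Types (f : V -> C) (P : nat -> V -> C).

Lemma taylor_line_order2 f a P b : taylor_expansion N f a P ->
  exists K d : R, 0 < d /\ forall s : C, cabs s <= d ->
    cabs (f (a + s *: b) - f a - s * P 1%N b) <= K * cabs s ^+ 2.
Proof.
move=> hP; have [r r0 H] := taylor_line hP.
have Nb : 0 < N b + 1 by rewrite ltr_wpDl ?cnorm_ge0.
have r1 : 0 < r / 2 / (N b + 1) by rewrite !divr_gt0.
have := @csum_leads R (fun j => if j == 0%N then 0 else P j b)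
  (fun s => f (a + s *: b) - f a) 1 _ r1.
case=> [s sr|[|//] //|K [d [d0 hK]]].
  have sN : cabs s * N b < r.
    apply: le_lt_trans (_ : cabs s * (N b + 1) < _).
      by rewrite ler_wpM2l ?cabs_ge0 // lerDl.
    rewrite -ltr_pdivlMr //; apply: le_lt_trans sr _.
    by rewrite mulrAC ltr_pdivrMr // ltr_pMr ?divr_gt0 // ltr1n.
  have h0 := @csum_finite R (fun j => (if j == 0%N then P 0%N b else 0) * s ^+ j) 1.
  have {}h0 := csum_sub (H b s sN) (h0 _).
  have := h0 _; rewrite big_ord1 eqxx mulr1 (taylor_value b hP).
  have -> : (fun j => P j b * s ^+ j - (if j == 0%N then f a else 0) * s ^+ j) =
    (fun j => (if j == 0%N then 0 else P j b) * s ^+ j).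
    apply/funext => -[|j] /=; last by rewrite mul0r subr0.
    by rewrite (taylor_value b hP) mul0r subrr.
  by apply=> -[|j] // _; rewrite mul0r.
by exists K, d; split => // s /hK; rewrite expr1 mulrC.
Qed.

Lemma taylor_derive f a P b : taylor_expansion N f a P -> 'D_b f a = P 1%N b.
Proof.
move=> /(taylor_line_order2 b)[K [d [d0 H]]].
apply: cvg_lim; first exact: norm_hausdorff.
apply/cvgrPdist_lt => e e0.
have e1 : e = (complex.Re e)%:C%C by apply/esym/RRe_real/gtr0_real.
have e2 : 0 < complex.Re e by rewrite -ltcR -e1.
pose t := Num.min d (complex.Re e / (`|K| + 1)).
have t0 : 0 < t by rewrite lt_min d0 divr_gt0 // ltr_wpDl.
have : nbhs (0 : C) (ball (0 : C) t%:C%C) by apply: nbhsx_ballx; rewrite ltcR.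
rewrite /dnbhs /within; apply: filterS => s.
rewrite /ball /= sub0r normrN => sb s0.
have {}sb : cabs s < t by move: sb; rewrite normc_def ltcR; case: (s).
have sn : 0 < cabs s by rewrite cabs_gt0.
rewrite e1 normc_def ltcR.
suff : cabs (P 1%N b - s^-1 *: (f (s *: b + a) - f a)) < complex.Re e.
  by case: (_ - _).
have sd : cabs s <= d by apply: le_trans (ltW sb) _; rewrite ge_min lexx.
have := H s sd; rewrite (addrC a) => hs.
have -> : P 1%N b - s^-1 *: (f (s *: b + a) - f a) =
    - (s^-1 * (f (s *: b + a) - f a - s * P 1%N b)).
  by rewrite /GRing.scale /=; field.
rewrite cabsN cabsM cabsV mulrC ltr_pdivrMr //.
apply: le_lt_trans hs _.
apply: le_lt_trans (_ : `|K| * cabs s ^+ 2 < _).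
  by rewrite ler_wpM2r ?exprn_ge0 ?cabs_ge0 // ler_norm.
rewrite expr2 mulrA ltr_pM2r //.
apply: le_lt_trans (_ : `|K| * (complex.Re e / (`|K| + 1)) < _).
  by rewrite ler_wpM2l // ltW // (lt_le_trans sb) // ge_min lexx orbT.
by rewrite mulrA ltr_pdivrMr ?ltr_wpDl // mulrC ltr_pM2l // ltrDl.
Qed.

End TaylorDerivative.

(** * The identity theorem *)

Section Identity.
Context (R : realType) (n : nat) (N : cnorm R n) (k : \bar R) (A : {nonneg R}).
Local Notation C := R[i].
Local Notation V := 'rV[C]_n.
Local Notation X := (Exp N k A).

(** Let [t0] be the supremum of the times up to which [f] vanishes on the segment
    from 0 to [x].  The expansion of [f] at [t0 x] along the segment vanishes on
    one side of [t0] (at [t0 = 0] it is the Taylor sequence at 0), so its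
    coefficients are 0 and [f] vanishes on both sides of [t0].  Hence [t0 = 1]
    and [f x = 0]. *)
Lemma exp_eq0 (f : X) : (forall j, taylor N f 0 j = 0) -> f = 0.
Proof.
move=> f0; apply/val_inj/funext => x /=.
have [xD|xD] := pselect (expdom N k A x); last first.
  by have [_ h _] := exp_expset f; rewrite h.
pose h (t : R) : C := f (t%:C%C *: x).
pose Z := [set t : R | 0 <= t <= 1 /\ forall s, 0 <= s <= t -> h s = 0].
have fz : f 0 = 0 by rewrite -(taylor_value 0 (exp_taylor f)) f0.
have Z0 : Z 0.
  split; first by rewrite lexx ler01.
  move=> s; rewrite -eq_le => /eqP <-; rewrite /h.
  by rewrite (_ : 0%:C%C = 0) // scale0r.
have hs : has_sup Z by split; [exists 0|exists 1 => t [/andP[]]].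
pose t0 := sup Z.
have t00 : 0 <= t0 by apply: sup_upper_bound.
have t01 : t0 <= 1.
  by apply: (ge_sup (proj1 hs)) => t [/andP[]].
have below s : 0 <= s < t0 -> h s = 0.
  rewrite -(subr_gt0 s) => /andP[s0 st].
  have [z [_ hz]] := sup_adherent st hs; rewrite -/t0 subKr => sz.
  by apply: hz; rewrite s0 ltW.
pose y := t0%:C%C *: x.
have [P hP] : exists P, taylor_expansion N f y P.
  by apply: exp_local; apply: expdom_scale => //; rewrite t00.
have [r r0 H] := taylor_line hP.
pose d := r / (N x + 1).
have Nx : 0 < N x + 1 by rewrite ltr_wpDl ?cnorm_ge0.
have d0 : 0 < d by rewrite divr_gt0.
have {}H (s : R) : `|s| < d -> csum (fun j => P j x * s%:C%C ^+ j) (h (t0 + s)).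
  move=> sd; rewrite /h (rmorphD (real_complex R)) scalerDl; apply: H.
  have cs : cabs (s%:C%C) = `|s| by rewrite /= expr0n addr0 sqrtr_sqr.
  rewrite cs; apply: le_lt_trans (_ : `|s| * (N x + 1) < _).
    by rewrite ler_wpM2l // lerDl.
  by rewrite -ltr_pdivlMr.
have P0 j : P j x = 0.
  have [t00'|t0n] := eqVneq t0 0.
    have -> : P = taylor N f 0; last by rewrite f0.
    apply: taylor_expansion_unique hP _.
    by rewrite /y t00' (_ : 0%:C%C = 0) // scale0r; exact: exp_taylor.
  have tp : 0 < t0 by rewrite lt_neqAle eq_sym t0n.
  have m0 : 0 < Num.min d t0 by rewrite lt_min d0.
  suff : P j x * (-1) ^+ j = 0 by move/eqP; rewrite mulf_eq0 signr_eq0 orbF => /eqP.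
  move: j; apply: (csum_zero_coef m0) => t /andP[tt];
      rewrite lt_min => /andP[td tt0].
  have := H (- t); rewrite normrN gtr0_norm // => /(_ td).
  rewrite below; last by rewrite subr_ge0 (ltW tt0) /= ltrBlDr ltrDl.
  have -> : (- t)%:C%C = -1 * t%:C%C :> C by rewrite mulN1r rmorphN.
  by apply: csum_ext => j; rewrite exprMn mulrA.
have hz s : `|s| < d -> h (t0 + s) = 0.
  move=> /H hh; apply: csum_unique hh _.
  have := @csum_finite R (fun j => P j x * s%:C%C ^+ j) 0; rewrite big_ord0; apply.
  by move=> j _; rewrite P0 mul0r.
pose t1 := Num.min 1 (t0 + d / 2).
have Z1 : Z t1.
  split.
    by rewrite /t1 le_min ler01 ge_min lexx andbT addr_ge0 // divr_ge0 // ltW.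
  move=> s /andP[s0]; rewrite le_min => /andP[_ st].
  have [st0|ts] := ltP s t0; first by apply: below; rewrite s0.
  rewrite -(subrKC t0 s); apply: hz; rewrite ger0_norm ?subr_ge0 //.
  by apply: le_lt_trans (_ : d / 2 < d); lra.
have : t1 <= t0 by apply: sup_upper_bound.
rewrite /t1 ge_min => /orP[t1'|]; last by rewrite gerDl leNgt divr_gt0.
have E1 : t0 = 1 by apply/eqP; rewrite eq_le t01.
have := hz 0; rewrite normr0 d0 addr0 E1 /h (_ : 1%:C%C = 1) // scale1r; exact.
Qed.

Lemma exp_ext (f g : X) : (forall j, taylor N f 0 j = taylor N g 0 j) -> f = g.
Proof.
move=> fg; apply/eqP; rewrite -subr_eq0; apply/eqP; apply: exp_eq0 => j.
by rewrite addrC -scaleN1r exp_taylor_lin fg scaleN1r addNr.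
Qed.

End Identity.

(** * Exponentials as elements of Exp *)

Section Membership.
Context (R : realType) (n : nat) (N : cnorm R n) (k : \bar R) (A : {nonneg R}).
Context (k1 : (1 < k)%E).
Local Notation C := R[i].
Local Notation V := 'rV[C]_n.
Local Notation X := (Exp N k A).
Implicit Types (P : V -> C) (b c x : V).

Lemma mexp_taylor_bound P d c (B T : R) : 0 <= B -> 0 <= T ->
  (forall x, cabs (P x) <= B * N x ^+ d) -> (forall x, cabs (phi c x) <= T * N x) ->
  forall l, (d <= l)%N -> forall x, cabs (mexp_taylor P d c l x) <=
    B * (T ^+ (l - d) / (l - d)`!%:R) * N x ^+ l.
Proof.
move=> B0 T0 hP hc l dl x; rewrite /mexp_taylor dl cabsM cabs_fact.
have -> : N x ^+ l = N x ^+ d * N x ^+ (l - d) by rewrite -exprD subnKC.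
apply: le_trans (_ : B * N x ^+ d * ((T * N x) ^+ (l - d) / (l - d)`!%:R) <= _).
  apply: ler_pM; rewrite ?cabs_ge0 ?divr_ge0 ?exprn_ge0 ?cabs_ge0 //.
  rewrite ler_wpM2r ?invr_ge0 // lerXn2r ?nnegrE ?cabs_ge0 // mulr_ge0 //.
  exact: cnorm_ge0.
by rewrite exprMn le_eqVlt; apply/orP; left; apply/eqP; ring.
Qed.

(** Elements of [Exp] are extended by 0 outside their domain. *)
Definition restrict (F : V -> C) x : C := if `[< expdom N k A x >] then F x else 0.

Lemma restrict_taylor F a Q : expdom N k A a ->
  taylor_expansion N F a Q -> taylor_expansion N (restrict F) a Q.
Proof.
move=> /expdom_nbhs[r r0 hr]; apply: taylor_expansion_local;
    exists r => // x /hr xD.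
by rewrite /restrict asboolT.
Qed.

Lemma homog_phiX b j : homog_poly j (fun x => phi b x ^+ j).
Proof. by have := homog_polyX j (homog_phi b); rewrite mul1n. Qed.

Lemma restrict_mexp_expset b j c :
  expset N k A (restrict (mexp (fun x => phi b x ^+ j) c)).
Proof.
pose P x := phi b x ^+ j.
have hT := taylorE (restrict_taylor (expdom0 N k A)
  (mexp_taylor0 N c (homog_phiX b j))).
have [B B0 hB] := homog_bound N (homog_phiX b j).
have [T T0 hc] := phi_bound N c.
have bd := mexp_taylor_bound B0 T0 hB hc.
have z l : ~~ ((j <= l) && (0 <= l))%N -> mexp_taylor P j c l = 0.
  by rewrite leq0n andbT /mexp_taylor => /negPf ->.
split.
- move=> a aD; have [Q hQ] := mexp_pow_taylor N b j c a.
  by exists Q; exact: restrict_taylor.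
- by move=> x xD; rewrite /restrict asboolF.
rewrite /exp_growth /expnorm hT -/P; move: z bd; rewrite -/P.
move: (mexp_taylor P j c) => Q z bd.
have fin rho : A%:num < rho -> (snorm N k rho Q < +oo)%E.
  move=> /rho_gt0 r0; have [K K0 HK] := snorm_tail N j k1 r0 T0.
  apply: le_lt_trans (HK Q B 0%N B0 _ z) (ltry _) => l jl _; exact: bd.
case: k k1 fin => [r| |] // k2 fin.
apply/limn_esup_leP => e Ae; have e0 : 0 < e by apply: le_lt_trans Ae.
have [K K0 HK] := exp_weight_shift j k2 T0 e0.
have e1 : 0 < (B * K + 1)^-1 by rewrite invr_gt0 ltr_wpDl // mulr_ge0.
near=> l; have l0 : (0 < l)%N by near: l; exact: nbhs_infty_gt.
apply/(root_le (hnorm_ge0 _ _) l0 (ltW e0)).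
have jl : (j <= l)%N by near: l; exact: nbhs_infty_ge.
apply: le_trans (hnorm_le _ (bd l jl)) _.
  by rewrite mulr_ge0 // divr_ge0 ?exprn_ge0.
rewrite lee_fin.
have := HK l jl; rewrite mulr1 mulrC ler_pdivrMr ?exprn_gt0 // => h.
apply: le_trans (ler_wpM2l B0 h) _.
rewrite !mulrA ler_piMl ?exprn_ge0 ?(ltW e0) //.
have hl : (2^-1 : R) ^+ l < (B * K + 1)^-1 by near: l; exact: half_small.
have h2 : B * K * 2^-1 ^+ l <= 1.
  apply: le_trans (_ : (B * K + 1) * (B * K + 1)^-1 <= _).
    by apply: ler_pM; rewrite ?half_ge0 ?lerDl ?(ltW hl) // mulr_ge0.
  by rewrite mulfV // lt0r_neq0 // ltr_wpDl // mulr_ge0.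
apply: le_trans (_ : 1 * 2^-1 ^+ l <= _); first by rewrite ler_wpM2r ?half_ge0.
by rewrite mul1r exprn_ile1 ?invr_ge0 //; lra.
Unshelve. all: by end_near. Qed.

(** [(phi b)^j e^(phi c)].  The positive powers occur as the coefficients of the
    expansion of [e^(phi (c + t b))] in powers of [t]. *)
Definition expo b j c : X := MkExp (asboolT (restrict_mexp_expset b j c)).

Lemma expo_taylor b j c :
  taylor N (expo b j c) 0 = mexp_taylor (fun x => phi b x ^+ j) j c.
Proof.
exact: taylorE (restrict_taylor (expdom0 N k A)
  (mexp_taylor0 N c (homog_phiX b j))).
Qed.

Definition expc c : X := expo 0 0 c.

Lemma expc_taylor c : taylor N (expc c) 0 = mexp_taylor (fun=> 1) 0 c.
Proof. exact: expo_taylor. Qed.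

Lemma expc_derive c b x : expdom N k A x -> 'D_b (expc c) x = phi c b * expc c x.
Proof.
move=> xD; have h := restrict_taylor xD (mexp1_taylor N c x).
have -> : 'D_b (expc c) x = cexp (phi c x) * mexp_taylor (fun=> 1) 0 c 1 b.
  exact: taylor_derive h.
rewrite /expc /= /restrict asboolT // /mexp /mexp_taylor leq0n subn0 expr0 expr1.
by rewrite factE !mul1r divr1 mulrC.
Qed.

Lemma exp_taylor_sum I (s : seq I) (u : I -> C) (f : I -> X) l x :
  taylor N (\sum_(i <- s) u i *: f i : X) 0 l x =
  \sum_(i <- s) u i * taylor N (f i) 0 l x.
Proof.
elim: s => [|i s IH]; first by rewrite !big_nil exp_taylor0.
by rewrite !big_cons exp_taylor_lin -IH.
Qed.

(** Expanding [e^(phi u)], one has [P e^(phi (c + u))] as the sum over [j] of the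
    [P (phi u)^j / j! e^(phi c)], with convergence in the seminorm.  In degree
    [d + m] the difference vanishes for [m < M] by the binomial theorem, and
    otherwise it is at most [|P| (|phi u| + |phi c|)^m / m!]. *)
Lemma mexp_tail rho P d c u : 0 < rho -> homog_poly d P ->
  forall e : R, 0 < e -> \forall M \near \oo,
  (snorm N k rho (fun l x => mexp_taylor P d (c + u) l x -
     \sum_(j < M) mexp_taylor (fun x => P x * (phi u x ^+ j / j`!%:R)) (d + j)
         c l x)%R
   < e%:E)%E.
Proof.
move=> r0 hP e e0.
have [B B0 hB] := homog_bound N hP.
have [T1 T10 hc] := phi_bound N c; have [T2 T20 hu] := phi_bound N u.
pose T := T1 + T2; have T0 : 0 <= T by rewrite addr_ge0.
have [K K0 HK] := snorm_tail N d k1 r0 T0.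
have e1 : 0 < e / (B * K + 1) by rewrite divr_gt0 // ltr_wpDl // mulr_ge0.
apply: filterS (half_small e1) => M;
    rewrite ltr_pdivlMr ?ltr_wpDl ?mulr_ge0 // => hM.
set Q := (Q in snorm _ _ _ Q).
have QE l x : (d <= l)%N -> Q l x = P x * (phi (c + u) x ^+ (l - d) / (l - d)`!%:R -
    \sum_(j < M | (j <= l - d)%N) phi u x ^+ j / j`!%:R *
       (phi c x ^+ (l - d - j) / (l - d - j)`!%:R)).
  move=> dl; rewrite /Q {1}/mexp_taylor dl mulrBr; congr (_ - _).
  rewrite [in RHS]big_mkcond mulr_sumr; apply: eq_bigr => j _ /=.
  rewrite /mexp_taylor -leq_subRL // subnDA; case: ifP; rewrite ?mulr0 //.
  by move=> _; rewrite -[LHS]mulrA.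
have Q0 l : ~~ ((d <= l) && (d + M <= l))%N -> Q l = 0.
  move=> h; apply/funext => x; have [dl|ld] := leqP d l; last first.
    rewrite /Q /mexp_taylor leqNgt ld big1 ?subrr //= => j _.
    by rewrite leqNgt (leq_trans ld) // leq_addr.
  rewrite dl /= -ltnNge in h; rewrite (QE _ _ dl).
  have lM : (l - d < M)%N by rewrite ltn_subLR.
  rewrite phiDl (addrC (phi c x)) exprD_fact.
  rewrite (big_ord_widen M (fun i => phi u x ^+ i / i`!%:R *
    (phi c x ^+ (l - d - i) / (l - d - i)`!%:R))) //.
  rewrite [X in _ * X](_ : _ = 0) ?mulr0 //; apply/eqP; rewrite subr_eq0; apply/eqP.
  by apply: eq_bigl => i; rewrite ltnS.
have := HK Q B (d + M)%N B0 _ Q0; move=> /(_ _)/le_lt_trans; apply; last first.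
  rewrite lte_fin; apply: le_lt_trans hM.
  apply: le_trans (_ : B * K * 2^-1 ^+ M <= _).
    rewrite ler_wpM2l ?mulr_ge0 // ler_wiXn2l ?invr_ge0 ?leq_addl //; lra.
  by rewrite mulrC ler_wpM2l ?half_ge0 // lerDl.
move=> l dl Ml x; rewrite QE // cabsM.
have ml : (M <= l - d)%N by rewrite leq_subRL.
set m := (l - d)%N in ml *.
have -> : N x ^+ l = N x ^+ d * N x ^+ m by rewrite -exprD subnKC.
have -> : B * (T ^+ m / m`!%:R) * (N x ^+ d * N x ^+ m) =
   B * N x ^+ d * ((T * N x) ^+ m / m`!%:R) by rewrite exprMn; ring.
apply: ler_pM; rewrite ?cabs_ge0 //.
pose a j := phi u x ^+ j / j`!%:R * (phi c x ^+ (m - j) / (m - j)`!%:R).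
have -> : phi (c + u) x ^+ m / m`!%:R - \sum_(j < M | (j <= m)%N) a j =
    \sum_(j < m.+1 | (M <= j)%N) a j.
  rewrite phiDl (addrC (phi c x)) exprD_fact -/(a _).
  rewrite [X in X - _](bigID (fun j : 'I_m.+1 => (j < M)%N)) /=.
  rewrite -(big_ord_widen m.+1 a) ?(leqW ml) //.
  rewrite [X in _ - X](eq_bigl xpredT) => [|j]; last first.
    by rewrite (leq_trans (ltnW (ltn_ord j))).
  rewrite addrAC subrr add0r.
  by apply: eq_bigl => j; rewrite -leqNgt.
apply: le_trans (ler_cabs_sum _ _ _) _.
apply: le_trans (_ : \sum_(j < m.+1) cabs (a j) <= _).
  rewrite big_mkcond; apply: ler_sum => j _; case: ifP => // _; exact: cabs_ge0.
apply: le_trans (_ : (cabs (phi u x) + cabs (phi c x)) ^+ m / m`!%:R <= _).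
  have F0 i : (i`!%:R : R) != 0 by rewrite pnatr_eq0 -lt0n fact_gt0.
  rewrite addrC exprDn mulr_suml; apply: ler_sum => i _.
  have im : (i <= m)%N by rewrite -ltnS.
  rewrite /a cabsM !cabs_fact -[X in _ <= X / _]mulr_natr -(bin_fact im) !natrM.
  have B1 : ('C(m, i)%:R : R) != 0 by rewrite pnatr_eq0 -lt0n bin_gt0.
  rewrite le_eqVlt; apply/orP; left; apply/eqP.
  move: (F0 i) (F0 (m - i)%N) B1;
      move: (i`!%:R) ((m - i)`!%:R) ('C(m, i)%:R) => f1 f2 f3.
  by move=> h1 h2 h3; field; rewrite h1 h2 h3.
rewrite ler_wpM2r ?invr_ge0 // lerXn2r ?nnegrE ?addr_ge0 ?cabs_ge0 ?mulr_ge0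
    ?cnorm_ge0 //.
by rewrite /T mulrDl addrC lerD.
Qed.

End Membership.

Section SnormExtra.
Context (R : realType) (n : nat) (N : cnorm R n) (k : \bar R).
Local Notation C := R[i].
Local Notation V := 'rV[C]_n.
Implicit Types (Q S T : nat -> V -> C) (rho : R).

Lemma snorm0 rho : snorm N k rho (fun _ _ => 0) = 0%E.
Proof. by apply: eseries0 => j _ _; rewrite [hnorm _ _]hnorm0 mule0. Qed.

Lemma snorm_linP rho (a : C) Q S : 0 <= rho ->
  (snorm N k rho (fun j x => a * Q j x + S j x)%R
    <= (cabs a)%:E * snorm N k rho Q + snorm N k rho S)%E.
Proof. exact: snorm_lin. Qed.

Lemma snorm_dist_tri rho Q S T (a b : R) : 0 <= rho ->
  (snorm N k rho (fun l x => Q l x - S l x)%R < a%:E)%E ->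
  (snorm N k rho (fun l x => S l x - T l x)%R < b%:E)%E ->
  (snorm N k rho (fun l x => Q l x - T l x)%R < (a + b)%:E)%E.
Proof.
move=> r0 h1 h2; rewrite EFinD.
have := snorm_linP 1 (fun l x => Q l x - S l x) (fun l x => S l x - T l x) r0.
rewrite cabs1 mul1e.
have -> : (fun l x => 1 * (Q l x - S l x) + (S l x - T l x)) = (fun l x => Q l
    x - T l x).
  by apply/funext => l; apply/funext => x; ring.
by move/le_lt_trans; apply; exact: lteD.
Qed.

Lemma exp_weight_gt0 j : (1 < k)%E -> 0 < exp_weight k j.
Proof.
case: k => [r| |] // r1.
rewrite lte_fin in r1; have r0 : 0 < r by apply: lt_trans r1.
rewrite /exp_weight; case: j => [|j]; first by rewrite !mul0r powRr0 ltr01.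
by rewrite powR_gt0 // divr_gt0 // mulr_gt0 // expR_gt0.
Qed.

End SnormExtra.

(** * Density of the exponentials *)

Section Density.
Context (R : realType) (n : nat) (N : cnorm R n) (k : \bar R) (A : {nonneg R}).
Context (k1 : (1 < k)%E).
Local Notation C := R[i].
Local Notation V := 'rV[C]_n.
Local Notation X := (Exp N k A).
Local Notation expc := (@expc R n N k A k1).
Implicit Types (P : V -> C) (c x : V) (Q S : nat -> V -> C) (s : seq (C * V)).

Definition expc_comb s : X := \sum_(p <- s) p.1 *: expc p.2.

Local Notation comb := expc_comb.

Lemma comb_cat s s' : comb (s ++ s') = comb s + comb s'.
Proof. by rewrite /expc_comb big_cat. Qed.

Lemma comb_scale (a : C) s : comb [seq (a * p.1, p.2) | p <- s] = a *: comb s.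
Proof.
by rewrite /expc_comb big_map scaler_sumr; apply: eq_bigr => p _; rewrite scalerA.
Qed.

Section Approximation.
Context (U : set V) (rho : R) (Arho : A%:num < rho).

(** [Q] belongs to the closure of the Taylor sequences of the combinations of
    exponentials with frequencies in [U]. *)
Definition approx Q := forall e : R, 0 < e ->
  exists s, (forall p, p \in s -> U p.2) /\
  (snorm N k rho (fun l x => Q l x - taylor N (comb s) 0 l x)%R < e%:E)%E.

Let r0 : 0 < rho. Proof. exact: rho_gt0 Arho. Qed.

Lemma approx_lim Q : (forall e : R, 0 < e -> exists2 S, approx S &
  (snorm N k rho (fun l x => Q l x - S l x)%R < e%:E)%E) -> approx Q.
Proof.
move=> H e e0; have e2 : 0 < e / 2 by rewrite divr_gt0.
have [S aS QS] := H _ e2; have [s [sU hs]] := aS _ e2.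
exists s; split => //; rewrite (splitr e); exact: snorm_dist_tri (ltW r0) QS hs.
Qed.

Lemma approx_lin (a : C) Q S : approx Q -> approx S ->
  approx (fun l x => a * Q l x + S l x).
Proof.
move=> aQ aS e e0; have a1 : 0 < cabs a + 1 by rewrite ltr_wpDl ?cabs_ge0.
have e1 : 0 < e / 2 / (cabs a + 1) by rewrite !divr_gt0.
have e2 : 0 < e / 2 by rewrite divr_gt0.
have [s [sU hs]] := aQ _ e1; have [s' [sU' hs']] := aS _ e2.
exists ([seq (a * p.1, p.2) | p <- s] ++ s'); split.
  by move=> p; rewrite mem_cat => /orP[/mapP[q /sU qU ->]|/sU'].
have := snorm_linP N k a (fun l x => Q l x - taylor N (comb s) 0 l x)
  (fun l x => S l x - taylor N (comb s') 0 l x) (ltW r0).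
rewrite comb_cat comb_scale exp_taylor_lin.
have -> : (fun l x => a * (Q l x - taylor N (comb s) 0 l x) +
     (S l x - taylor N (comb s') 0 l x)) = (fun l x => a * Q l x + S l x -
     (a *: taylor N (comb s) 0 l + taylor N (comb s') 0 l) x).
  apply/funext => l; apply/funext => x.
  have -> : (a *: taylor N (comb s) 0 l + taylor N (comb s') 0 l) x =
    a * taylor N (comb s) 0 l x + taylor N (comb s') 0 l x by [].
  by ring.
move/le_lt_trans; apply.
have h1 : ((cabs a)%:E * snorm N k rho (fun l x => Q l x - taylor N (comb s) 0
    l x)%R
    <= (e / 2)%:E)%E.
  apply: le_trans (lee_wpmul2l _ (ltW hs)) _; first by rewrite lee_fin cabs_ge0.
  rewrite -EFinM lee_fin mulrCA ler_piMr ?(ltW e2) // ler_pdivrMr // mul1r.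
  by rewrite lerDl.
apply: le_lt_trans (leeD h1 (lexx _)) _.
by rewrite [in ltRHS](splitr e) EFinD lteD2lE.
Qed.

Lemma approx0 : approx (fun _ _ => 0).
Proof.
move=> e e0; exists [::]; split => //.
rewrite /expc_comb big_nil exp_taylor0.
have -> : (fun (l : nat) (x : V) => 0 - (0 : V -> C) x) = (fun _ _ => 0).
  by apply/funext => l; apply/funext => x; rewrite subr0.
by rewrite snorm0.
Qed.

Lemma approx_sum I (t : seq I) (a : I -> C) (F : I -> nat -> V -> C) :
  (forall i, approx (F i)) -> approx (fun l x => \sum_(i <- t) a i * F i l x).
Proof.
move=> H; elim: t => [|i t IH].
  have := approx0; congr approx; apply/funext => l; apply/funext => x.
  by rewrite big_nil.
have := approx_lin (a i) (H i) IH; congr approx; apply/funext => l.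
by apply/funext => x; rewrite big_cons.
Qed.

Lemma approx_expc c : U c -> approx (mexp_taylor (fun=> 1) 0 c).
Proof.
move=> Uc e e0; exists [:: (1, c)]; split; first by move=> p;
    rewrite inE => /eqP ->.
rewrite /expc_comb big_seq1 /= scale1r (@expc_taylor R n N k A k1).
set F := mexp_taylor _ _ _.
have -> : (fun (l : nat) x => F l x - F l x) = (fun _ _ => 0).
  by apply/funext => l; apply/funext => x; rewrite subrr.
by rewrite snorm0.
Qed.

Context (U_line_open : forall c b, U c ->
  exists2 d : R, 0 < d & forall h : C, cabs h <= d -> U (c + h *: b)).

(** [x_i P e^(phi c)] is the limit, as [h] tends to 0, of the quotients
    [(P e^(phi (c + h e_i)) - P e^(phi c)) / h]. *)
Lemma approx_mul_coord P d (i : 'I_n) c : homog_poly d P -> U c ->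
  (forall c', U c' -> approx (mexp_taylor P d c')) ->
  approx (mexp_taylor (fun x => x 0 i * P x) d.+1 c).
Proof.
move=> hP Uc H; apply: approx_lim => e e0.
have [B B0 hB] := homog_bound N hP.
have [T1 T10 hc] := phi_bound N c; have [T2 T20 hi] := phi_bound N (delta_mx 0 i).
have [K K0 HK] := snorm_tail N d k1 r0 (addr_ge0 T10 T20).
have [dl dl0 hU] := U_line_open (delta_mx 0 i) Uc.
pose t := Num.min (Num.min 1 dl) (e / 2 / (B * K + 1)).
have BK1 : 0 < B * K + 1 by rewrite ltr_wpDl // mulr_ge0.
have t0 : 0 < t by rewrite !lt_min ltr01 dl0 !divr_gt0.
pose h : C := t%:C%C; have ch : cabs h = t by rewrite cabs_real // ltW.
have h0 : h != 0 by rewrite -cabs_eq0 ch lt0r_neq0.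
have t1 : t <= 1 by rewrite !ge_min lexx.
have tdl : t <= dl by rewrite !ge_min lexx orbT.
pose S l x := h^-1 * mexp_taylor P d (c + h *: delta_mx 0 i) l x +
   (- h^-1 * mexp_taylor P d c l x + 0).
exists S.
  apply: approx_lin; first by apply: H; apply: hU; rewrite ch.
  by apply: approx_lin; [exact: H|exact: approx0].
set D := (D in snorm _ _ _ D).
have DE l x : (d <= l)%N -> D l x = - (P x * (((phi c x + h * x 0 i) ^+ (l - d)
    - phi c x ^+ (l - d) - h * ((l - d)%:R * x 0 i * phi c x ^+ (l - d).-1)) /
        (h * (l - d)`!%:R))).
  move=> dl'; rewrite /D /S /mexp_taylor dl' addr0 phiDl phiZl phi_delta.
  have [ld|ld] := ltnP d l; last first.
    have -> : (l - d = 0)%N by apply/eqP; rewrite subn_eq0.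
    by rewrite !expr0 factE !mul0r mulr0 !divr1 !mulr1 subrr subr0 mul0r mulr0
        mulNr subrr subrr oppr0.
  rewrite -(subnSK ld) /= factS natrM.
  have f0 : ((l - d.+1)`!%:R : C) != 0 by rewrite pnatr_eq0 -lt0n fact_gt0.
  have s0 : ((l - d.+1).+1%:R : C) != 0 by rewrite pnatr_eq0.
  move: f0 s0;
      move: (_`!%:R) (_.+1%:R) (_ ^+ _.+1) (_ ^+ _.+1) (_ ^+ _) => a b p q r f0 s0.
  by field; rewrite h0 f0 s0.
have D0 l : ~~ ((d <= l) && (0 <= l))%N -> D l = 0.
  rewrite leq0n andbT => ld; apply/funext => x; rewrite /D /S /mexp_taylor.
  rewrite (negPf ld); have -> : (d < l)%N = false.
    by apply/negP => /ltnW; apply/negP.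
  by rewrite !mulr0 !addr0 subr0.
have := HK D (B * t) 0%N (mulr_ge0 B0 (ltW t0)) _ D0.
move=> /(_ _)/le_lt_trans; apply; last first.
  rewrite expr0 mulr1 lte_fin mulrAC.
  apply: le_lt_trans (_ : B * K * (e / 2 / (B * K + 1)) < _).
    by rewrite ler_wpM2l ?mulr_ge0 // !ge_min lexx orbT.
  apply: le_lt_trans (_ : e / 2 < _);
      last by rewrite ltr_pdivrMr // ltr_pMr // ltr1n.
  rewrite mulrCA ler_piMr ?divr_ge0 ?(ltW e0) // ler_pdivrMr // mul1r lerDl //.
move=> l dl' _ x; rewrite DE // cabsN.
set m := (l - d)%N.
have -> : N x ^+ l = N x ^+ d * N x ^+ m by rewrite -exprD subnKC.
have -> : B * t * ((T1 + T2) ^+ m / m`!%:R) * (N x ^+ d * N x ^+ m) =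
   B * N x ^+ d * (t * (((T1 + T2) * N x) ^+ m / m`!%:R)) by rewrite exprMn; ring.
rewrite cabsM; apply: ler_pM; rewrite ?cabs_ge0 //.
rewrite cabsM cabsV cabsM cabs_nat ch.
have f0 : 0 < (m`!%:R : R) by rewrite ltr0n fact_gt0.
rewrite ler_pdivrMr ?mulr_gt0 //.
have := @pow_incr2_le R (phi c x) (x 0 i) h m; rewrite ch => /(_ t1) hp.
apply: le_trans hp _.
have -> : t * (((T1 + T2) * N x) ^+ m / m`!%:R) * (t * m`!%:R) =
   t ^+ 2 * ((T1 + T2) * N x) ^+ m by field; exact: lt0r_neq0.
rewrite ler_wpM2l ?exprn_ge0 ?(ltW t0) //.
rewrite lerXn2r ?nnegrE ?addr_ge0 ?cabs_ge0 ?mulr_ge0 ?addr_ge0 ?cnorm_ge0 //.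
by rewrite mulrDl; apply: lerD => //; rewrite -phi_delta.
Qed.

Lemma approx_monomial (t : seq 'I_n) c : U c ->
  approx (mexp_taylor (fun x => \prod_(i <- t) x 0 i) (size t) c).
Proof.
elim: t c => [|i t IH] c Uc.
  have -> : (fun x : V => \prod_(i <- [::]) x 0 i) = (fun=> 1).
    by apply/funext => x; rewrite big_nil.
  exact: approx_expc.
have -> : (fun x : V => \prod_(j <- i :: t) x 0 j) =
    (fun x : V => x 0 i * \prod_(j <- t) x 0 j).
  by apply/funext => x; rewrite big_cons.
apply: approx_mul_coord => // {IH}.
elim: t => [|j t IH].
  by apply: homog_poly_ext _ (homog_poly_cst n (1 : C)) => x; rewrite big_nil.
have := homog_polyM (homog_coord R j) IH; apply: homog_poly_ext => x.
by rewrite big_cons.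
Qed.

Lemma approx_homog P d c : homog_poly d P -> U c -> approx (mexp_taylor P d c).
Proof.
move=> [p hp EP] Uc.
(* The variables of the monomial m, with multiplicities. *)
pose t (m : multinom n) := flatten [seq nseq (m i) i | i <- enum 'I_n].
have tE (m : multinom n) (x : V) : \prod_(i <- t m) x 0 i = \prod_i x 0 i ^+ m i.
  rewrite big_flatten big_map big_enum /=; apply: eq_bigr => i _.
  by rewrite big_nseq iter_mulr_1.
have tS (m : multinom n) : size (t m) = mdeg m.
  rewrite size_flatten /shape -map_comp sumnE big_map mdegE big_enum /=.
  by apply: eq_bigr => i _; rewrite size_nseq.
pose F (m : multinom n) := if mdeg m == d
  then mexp_taylor (fun x => \prod_(i <- t m) x 0 i) d c else fun _ _ => 0.
have aF m : approx (F m).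
  rewrite /F; case: eqP => [<-|_]; last exact: approx0.
  by rewrite -tS; exact: approx_monomial.
have := @approx_sum _ (msupp p) (fun m => mcoeff m p) F aF.
congr approx; apply/funext => l; apply/funext => x.
rewrite /mexp_taylor EP mevalE; case: leqP => dl; last first.
  rewrite big1 // => m _; rewrite /F; case: eqP => _; rewrite ?mulr0 //.
  by rewrite /mexp_taylor leqNgt dl mulr0.
rewrite mulr_suml big_seq [RHS]big_seq; apply: eq_bigr => m mp.
have md : mdeg m = d by move/dhomogP: hp; apply.
by rewrite /F md eqxx /mexp_taylor dl tE mulrA.
Qed.

(** [P] is the product of [P e^(phi (- c))] and of [e^(phi c)] for [c] in [U],
    and [e^(phi (- c))] is expanded into powers of [phi (- c)]. *)
Lemma approx_homog0 P d : (exists c, U c) -> homog_poly d P ->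
  approx (mexp_taylor P d 0).
Proof.
move=> [c Uc] hP; apply: approx_lim => e e0.
have [M _ HM] := mexp_tail N k1 c (- c) r0 hP e0.
have := HM M (leqnn _); rewrite subrr /= => h.
exists (fun l x => \sum_(j < M) mexp_taylor
  (fun x => P x * (phi (- c) x ^+ j / j`!%:R)) (d + j) c l x) => //.
have aF (j : 'I_M) : approx (mexp_taylor
    (fun x => P x * (phi (- c) x ^+ j / j`!%:R)) (d + j) c).
  apply: approx_homog => //; apply: homog_polyM => //.
  by apply: homog_poly_ext _ (homog_poly_scale (j`!%:R)^-1 (homog_phiX (- c)
      j)) => x; rewrite mulrC.
have := @approx_sum _ (index_enum 'I_M) (fun=> 1) _ aF; congr approx.
apply/funext => l; apply/funext => x; apply: eq_bigr => j _; exact: mul1r.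
Qed.

Lemma mexp_taylor_at0 P d l x : mexp_taylor P d 0 l x = if l == d then P x else 0.
Proof.
have z : phi 0 x = 0 by rewrite /phi big1 // => i _; rewrite mxE mul0r.
rewrite /mexp_taylor z expr0n subn_eq0 eqn_leq; case: (leqP d l) => dl; last first.
  by rewrite andbF.
rewrite andbT; case: leqP => ld; last by rewrite mul0r mulr0.
have -> : (l - d = 0)%N by apply/eqP; rewrite subn_eq0.
by rewrite factE divr1 mulr1.
Qed.

(** The Taylor polynomials of [f] tend to [f], and their homogeneous terms are
    limits of combinations of exponentials. *)
Lemma expc_dense (f : X) (e : R) : (exists c, U c) -> 0 < e ->
  exists s, (forall p, p \in s -> U p.2) /\
    (expnorm N k rho (f - comb s)%R < e%:E)%E.
Proof.
move=> exU e0; suff /(_ e e0)[s [sU hs]] : approx (taylor N f 0).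
  exists s; split => //; rewrite addrC -scaleN1r expnorm_snorm exp_taylor_lin.
  move: hs; congr (snorm _ _ _ _ < _)%E; apply/funext => l; apply/funext => x.
  have -> : (-1 *: taylor N (comb s) 0 l + taylor N f 0 l) x =
    -1 * taylor N (comb s) 0 l x + taylor N f 0 l x by [].
  by rewrite mulN1r addrC.
apply: approx_lim => {e0}e e0.
pose T m l x : C := \sum_(j < m) mexp_taylor (taylor N f 0 j) j 0 l x.
have aT m : approx (T m).
  have aF (j : 'I_m) : approx (mexp_taylor (taylor N f 0 j) j 0).
    by apply: approx_homog0 => //; exact: exp_taylor_homog.
  have := @approx_sum _ (index_enum 'I_m) (fun=> 1) _ aF; congr approx.
  apply/funext => l; apply/funext => x; apply: eq_bigr => j _; exact: mul1r.
have TE m l x : T m l x = if (l < m)%N then taylor N f 0 l x else 0.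
  rewrite /T; under eq_bigr do rewrite mexp_taylor_at0.
  case: ltnP => lm.
    rewrite (bigD1 (Ordinal lm)) //= eqxx big1 ?addr0 // => j.
    by rewrite -val_eqE /= eq_sym => /negPf ->.
  by rewrite big1 // => j _; rewrite gtn_eqF // (leq_trans _ lm).
pose u l := ((rho ^- l * exp_weight k l)%:E * hnorm N (taylor N f 0 l))%E.
have u0 l : (0 <= u l)%E by exact: snorm_term_ge0 (ltW r0).
have fin : (\sum_(0 <= l <oo) u l < +oo)%E by exact: (expnorm_fin f k1 Arho).
have := nneseries_tail_cvg fin (fun l _ => u0 l).
case/fine_cvgP => ffin /cvgrPdist_lt/(_ e e0) fe.
near \oo => m; exists (T m) => //.
set D := (D in snorm _ _ _ D).
have DE l : D l = if (l < m)%N then (fun=> 0) else taylor N f 0 l.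
  by apply/funext => x; rewrite /D TE; case: ltnP => _; rewrite ?subrr ?subr0.
have DT : (snorm N k rho D <= \sum_(m <= l <oo) u l)%E.
  rewrite /snorm (nneseries_split 0 m) => [|l _];
      last exact: snorm_term_ge0 (ltW r0).
  rewrite big_nat_cond big1 ?add0e ?add0n => [|l /andP[/andP[_ lm] _]].
    apply: lee_nneseries => [l _ _|l _]; first exact: snorm_term_ge0 (ltW r0).
    rewrite DE; case: ltnP => // _; rewrite [hnorm _ _]hnorm0 mule0; exact: u0.
  by rewrite DE lm [hnorm _ _]hnorm0 mule0.
have mfin : (\sum_(m <= l <oo) u l)%E \is a fin_num by near: m.
have mlt : `|0 - fine (\sum_(m <= l <oo) u l)%E| < e by near: m.
apply: le_lt_trans DT _; rewrite -(fineK mfin) lte_fin; move: mlt;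
    rewrite sub0r normrN.
exact: le_lt_trans (ler_norm _).
Unshelve. all: by end_near. Qed.

End Approximation.
End Density.

(** * Convolution operators *)

Section Convolution.
Context (R : realType) (n : nat) (N : cnorm R n) (k : \bar R) (A : {nonneg R}).
Context (k1 : (1 < k)%E).
Local Notation C := R[i].
Local Notation V := 'rV[C]_n.
Local Notation X := (Exp N k A).
Local Notation expc := (@expc R n N k A k1).
Local Notation comb := (@expc_comb R n N k A k1).
Context (L : X -> X) (hL : convolution_operator L).
Implicit Types (c b x : V) (s : seq (C * V)).

Let linL : linear L. Proof. by case: hL. Qed.

Lemma conv_sum I (t : seq I) (u : I -> C) (f : I -> X) :
  L (\sum_(i <- t) u i *: f i) = \sum_(i <- t) u i *: L (f i).
Proof.
have L0 : L 0 = 0 by have := linL (-1) 0 0; rewrite !scaleN1r !addNr.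
by elim: t => [|i t IH]; rewrite ?big_nil // !big_cons linL IH.
Qed.

Lemma convZ (a : C) (f : X) : L (a *: f) = a *: L f.
Proof. by have := @conv_sum _ [:: tt] (fun=> a) (fun=> f); rewrite !big_seq1. Qed.

Lemma exp_sum_val I (t : seq I) (u : I -> C) (f : I -> X) x :
  (\sum_(i <- t) u i *: f i : X) x = \sum_(i <- t) u i * f i x.
Proof. by elim: t => [|i t IH]; rewrite ?big_nil // !big_cons -IH. Qed.

(** The eigenvalue of [L] at the exponential of frequency [c]. *)
Definition symbol c : C := L (expc c) 0.

(** Along each line through 0, [h = L e^(phi c)] satisfies [h' = phi c b * h],
    which determines its Taylor sequence at 0 from [h 0]. *)
Lemma conv_expc c : L (expc c) = symbol c *: expc c.
Proof.
case: hL => _ _ hD; set h := L (expc c).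
have D b x : expdom N k A x -> 'D_b h x = phi c b * h x.
  move=> xD; rewrite -(hD b (expc c) (phi c b *: expc c)) => [||//].
    by rewrite convZ.
  by move=> y yD; rewrite expc_derive.
apply: exp_ext => j; apply/funext => b.
pose Q := taylor N h 0; have hQ : taylor_expansion N h 0 Q := exp_taylor h.
have [r r0 H] := taylor_line hQ.
have [r' r'0 H'] := expdom_nbhs (expdom0 N k A).
pose q := Num.min r r' / (N b + 1).
have Nb : 0 < N b + 1 by rewrite ltr_wpDl ?cnorm_ge0.
have q0 : 0 < q by rewrite divr_gt0 // lt_min r0.
have qr t : cabs t < q -> cabs t * N b < Num.min r r'.
  rewrite ltr_pdivlMr // => /(le_lt_trans _); apply.
  by rewrite ler_wpM2l ?cabs_ge0 // lerDl.
have ode := @csum_ode R (fun j => Q j b) (phi c b) (fun t => h (t *: b)) q q0.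
have {}ode i : i.+1%:R * Q i.+1 b = phi c b * Q i b.
  apply: ode => t /qr; rewrite lt_min => /andP[tr tr'].
    by have := H b t tr; rewrite add0r.
  have tD : expdom N k A (t *: b) by apply: H'; rewrite subr0 cnormZ.
  have [P hP] := exp_local h tD.
  have [K [d [d0 Hd]]] := taylor_line_order2 b hP.
  exists K, d; split => // s /Hd.
  by rewrite -(taylor_derive b hP) D // scalerDl.
have E i : Q i b = symbol c * (phi c b ^+ i / i`!%:R).
  elim: i => [|i IH].
    by rewrite (taylor_value b hQ) expr0 factE divr1 mulr1.
  have i0 : (i.+1%:R : C) != 0 by rewrite pnatr_eq0.
  apply: (mulfI i0); rewrite ode IH exprS factS natrM.
  have f0 : (i`!%:R : C) != 0 by rewrite pnatr_eq0 -lt0n fact_gt0.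
  move: i0 f0; move: (i.+1%:R) (i`!%:R) (_ ^+ _) => u v w u0 v0.
  by field; rewrite u0 v0.
rewrite -/(Q j b) E; have := exp_taylor_lin (symbol c) (expc c) 0.
rewrite addr0 => ->; rewrite exp_taylor0 (@expc_taylor R n N k A k1).
have -> : (symbol c *: mexp_taylor (fun=> 1) 0 c j + 0) b =
  symbol c * mexp_taylor (fun=> 1) 0 c j b + 0 by [].
by rewrite /mexp_taylor leq0n subn0 mul1r addr0.
Qed.

Lemma conv_eps (rho e : R) : A%:num < rho -> 0 < e ->
  exists rho' d, [/\ A%:num < rho', 0 < d & forall f : X,
    (expnorm N k rho' f < d%:E)%E -> (expnorm N k rho (L f) < e%:E)%E].
Proof. by case: hL => _ cL _ ; exact: continuous_linear_bound. Qed.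

(** Apply [L] and the evaluation at 0, which are continuous, to the expansion
    of [e^(phi (c + s b))] in powers of [s]. *)
Lemma symbol_csum c b (s : C) :
  csum (fun j => (L (expo N A k1 b j c) 0 / j`!%:R) * s ^+ j) (symbol (c + s *: b)).
Proof.
move=> e e0; have A1 : A%:num < A%:num + 1 by rewrite ltrDl.
have [rho [d [Ar d0 H]]] := conv_eps A1 e0.
have := mexp_tail N k1 c (s *: b) (rho_gt0 Ar) (homog_poly_cst n (1 : C)) d0.
apply: filterS => M hM.
pose w (j : nat) : C := s ^+ j / j`!%:R.
pose g : X := \sum_(j < M) w j *: expo N A k1 b j c.
have := H ((-1) *: g + expc (c + s *: b)).
have -> : expnorm N k rho ((-1) *: g + expc (c + s *: b))%R =
    snorm N k rho (fun l x => mexp_taylor (fun=> 1) 0 (c + s *: b) l x -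
     \sum_(j < M) mexp_taylor (fun x => 1 * (phi (s *: b) x ^+ j / j`!%:R)) (0
         + j) c l x)%R.
  rewrite expnorm_snorm exp_taylor_lin (@expc_taylor R n N k A k1).
  congr snorm; apply/funext => l; apply/funext => x.
  have -> : (-1 *: taylor N g 0 l + mexp_taylor (fun=> 1) 0 (c + s *: b) l) x =
    -1 * taylor N g 0 l x + mexp_taylor (fun=> 1) 0 (c + s *: b) l x by [].
  rewrite mulN1r addrC; congr (_ - _); rewrite /g exp_taylor_sum.
  apply: eq_bigr => j _; rewrite expo_taylor /mexp_taylor add0n phiZl exprMn.
  case: ifP => _; rewrite ?mulr0 // /w mul1r; ring.
move=> /(_ hM); apply: contraLR => /=; rewrite -leNgt -leNgt => he.
apply: le_trans (expnorm_eval0 _ A1); rewrite lee_fin; apply: le_trans he _.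
have -> : L ((-1) *: g + expc (c + s *: b)) 0 =
   symbol (c + s *: b) - \sum_(j < M) L (expo N A k1 b j c) 0 / j`!%:R * s ^+ j.
  rewrite linL /g conv_sum.
  have -> : ((-1 : C) *: (\sum_(i <- index_enum 'I_M) w i *: L (expo N A k1 b i
      c)) + L (expc (c + s *: b)) : X) 0
    = -1 * (\sum_(i <- index_enum 'I_M) w i *: L (expo N A k1 b i c) : X) 0 +
        symbol (c + s *: b) by [].
  rewrite exp_sum_val mulN1r addrC; congr (_ - _).
  by apply: eq_bigr => j _; rewrite /w mulrC mulrA mulrAC.
exact: lexx.
Qed.

Lemma symbol_expands c b (a : C) : expands (fun t : C => symbol (c + t *: b)) a.
Proof.
exists (fun j => L (expo N A k1 b j (c + a *: b)) 0 / j`!%:R) => s.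
by rewrite scalerDl addrA; exact: symbol_csum.
Qed.

Lemma symbol_line_cont c b (e : R) : 0 < e -> exists2 d : R, 0 < d &
  forall h : C, cabs h <= d -> cabs (symbol (c + h *: b) - symbol c) < e.
Proof.
move=> e0; have [K [d d0 H]] := expands_lip (symbol_expands c b 0).
exists (Num.min d (e / (`|K| + 1))).
  by rewrite lt_min d0 divr_gt0 // ltr_wpDl.
move=> h; rewrite le_min => /andP[/H]; rewrite add0r scale0r addr0 => hK he.
apply: le_lt_trans hK _; apply: le_lt_trans (_ : `|K| * (e / (`|K| + 1)) < _).
  apply: le_trans (ler_wpM2r (cabs_ge0 h) (ler_norm K)) _.
  exact: ler_wpM2l.
by rewrite mulrA ltr_pdivrMr ?ltr_wpDl // mulrC ltr_pM2l // ltrDl.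
Qed.

(** [L f] and [z *: f] are continuous in [f] and agree on the span of the
    exponentials, which is dense; so all the seminorms of their difference are 0. *)
Lemma conv_scalar (z : C) : (forall c, symbol c = z) -> forall f, L f = z *: f.
Proof.
move=> hz f; apply/eqP; rewrite -subr_eq0; apply/eqP; apply: exp_eq0 => j.
set g := L f - z *: f.
have A1 : A%:num < A%:num + 1 by rewrite ltrDl.
pose rho := A%:num + 1.
apply: (hnorm_eq0 (N := N) (exp_taylor_homog g j)).
suff g0 : (expnorm N k rho g <= 0)%E.
  have w0 := exp_weight_gt0 j k1.
  have := le_trans (hnorm_le_snorm N (taylor N g 0) (rho_gt0 A1) w0) g0.
  have c0 : 0 < rho ^- j * exp_weight k j.
    by rewrite mulr_gt0 // invr_gt0 exprn_gt0 // (rho_gt0 A1).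
  move=> h; apply/eqP; rewrite eq_le hnorm_ge0 andbT.
  by move: h; rewrite pmule_rle0 ?lte_fin.
apply/lee_addgt0Pr => e e0; rewrite add0e.
have e2 : 0 < e / 2 by rewrite divr_gt0.
have [rho' [d [Ar' d0 H]]] := conv_eps A1 e2.
(* The seminorm of m dominates those of rho and of rho'. *)
pose m := Num.min rho rho'; have Am : A%:num < m by rewrite lt_min A1.
have cz : 0 < cabs z + 1 by rewrite ltr_wpDl ?cabs_ge0.
have d1 : 0 < Num.min d (e / 2 / (cabs z + 1)) by rewrite lt_min d0 !divr_gt0.
have lo c b : [set: V] c -> exists2 d : R, 0 < d & forall h : C, cabs h <= d ->
    [set: V] (c + h *: b).
  by exists 1.
have [s [_ hs]] := expc_dense k1 Am lo f (ex_intro _ 0 I) d1.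
have Lc : L (comb s) = z *: comb s.
  rewrite conv_sum scaler_sumr; apply: eq_bigr => p _.
  by rewrite conv_expc hz !scalerA mulrC.
pose u := f - comb s.
have gE : g = (- z) *: u + L u.
  have uE : u = (-1) *: comb s + f by rewrite scaleN1r addrC.
  have -> : L u = (-1) *: (z *: comb s) + L f by rewrite uE linL Lc.
  rewrite uE scalerDr !scalerA mulrN1 opprK mulN1r !scaleNr.
  by rewrite addrACA subrr add0r addrC.
have h1 : (expnorm N k rho' u < d%:E)%E.
  apply: le_lt_trans (expnorm_decr u Am _) (lt_le_trans hs _).
    by rewrite ge_min lexx orbT.
  by rewrite lee_fin ge_min lexx.
have h2 : (expnorm N k rho u < (e / 2 / (cabs z + 1))%:E)%E.
  apply: le_lt_trans (expnorm_decr u Am _) (lt_le_trans hs _).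
    by rewrite ge_min lexx.
  by rewrite lee_fin ge_min lexx orbT.
rewrite gE; apply: le_trans (expnorm_linX _ _ _ A1) _.
rewrite (splitr e) EFinD; apply: leeD; last exact: ltW (H u h1).
rewrite cabsN; apply: le_trans (lee_wpmul2l _ (ltW h2)) _;
    first by rewrite lee_fin cabs_ge0.
rewrite -EFinM lee_fin mulrCA ler_piMr ?(ltW e2) // ler_pdivrMr // mul1r.
by rewrite lerDl.
Qed.

Lemma iter_comb (m : nat) (u : V -> C) s :
  iter m L (\sum_(p <- s) (u p.2 * p.1) *: expc p.2) =
  \sum_(p <- s) (symbol p.2 ^+ m * u p.2 * p.1) *: expc p.2.
Proof.
elim: m => [|m IH] /=; first by apply: eq_bigr => p _; rewrite expr0 mul1r.
rewrite IH conv_sum; apply: eq_bigr => p _.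
by rewrite conv_expc scalerA exprS; congr (_ *: _); ring.
Qed.

Lemma comb_pow_small (rho e : R) (u : V -> C) s : A%:num < rho -> 0 < e ->
  (forall p, p \in s -> cabs (u p.2) < 1) ->
  \forall m \near \oo, (expnorm N k rho
     (\sum_(p <- s) (u p.2 ^+ m * p.1) *: expc p.2)%R < e%:E)%E.
Proof.
move=> Ar; elim: s e => [|p s IH] e e0 hs.
  by near=> m; rewrite big_nil expnorm0.
have e2 : 0 < e / 2 by rewrite divr_gt0.
have fin : expnorm N k rho (expc p.2) \is a fin_num.
  by rewrite ge0_fin_numE ?expnorm_fin // expnorm_ge0.
set E := fine (expnorm N k rho (expc p.2)).
have E0 : 0 <= E by rewrite fine_ge0 // expnorm_ge0.
have q0 : 0 < cabs p.1 * E + 1 by rewrite ltr_wpDl // mulr_ge0 ?cabs_ge0.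
have up : cabs (u p.2) < 1 by apply: hs; rewrite mem_head.
have uc : `|cabs (u p.2)| < 1 by rewrite ger0_norm ?cabs_ge0.
have /cvgrPdist_lt /(_ (e / 2 / (cabs p.1 * E + 1))) := cvg_expr uc.
rewrite !divr_gt0 // => /(_ isT) h1.
have hs' q : q \in s -> cabs (u q.2) < 1 by move=> qs; apply: hs;
    rewrite inE qs orbT.
have h2 := IH _ e2 hs'.
near=> m; rewrite big_cons.
have a1 : `|0 - cabs (u p.2) ^+ m| < e / 2 / (cabs p.1 * E + 1) by near: m.
have a2 : (expnorm N k rho
     (\sum_(p <- s) (u p.2 ^+ m * p.1) *: expc p.2)%R < (e / 2)%:E)%E by near: m.
apply: le_lt_trans (expnorm_linX _ _ _ Ar) _.
rewrite -(fineK fin) -/E cabsM cabsX -EFinM.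
rewrite sub0r normrN ger0_norm ?exprn_ge0 ?cabs_ge0 // in a1.
have a3 : cabs (u p.2) ^+ m * cabs p.1 * E <= e / 2.
  rewrite -mulrA; apply: le_trans (ler_wpM2r _ (ltW a1)) _.
    by rewrite mulr_ge0 ?cabs_ge0.
  by rewrite mulrAC -mulrA ler_piMr ?(ltW e2) // ler_pdivrMr // mul1r lerDl.
apply: le_lt_trans (leeD (_ : _ <= (e / 2)%:E)%E (lexx _)) _;
    first by rewrite lee_fin.
by rewrite [in ltRHS](splitr e) EFinD lteD2lE.
Unshelve. all: by end_near. Qed.

Lemma exp_dist_lt (rho e : R) (f g h : X) : A%:num < rho ->
  (expnorm N k rho (f - g)%R < (e / 2)%:E)%E ->
  (expnorm N k rho h < (e / 2)%:E)%E ->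
  (expnorm N k rho (g + h - f)%R < e%:E)%E.
Proof.
move=> Ar fg hh; have h1 := expnorm_linX (-1) (f - g) h Ar.
have h2 := lteD fg hh; rewrite -EFinD -splitr in h2.
rewrite cabsN cabs1 mul1e in h1; have := le_lt_trans h1 h2.
by rewrite scaleN1r opprB addrAC.
Qed.

(** A preimage of [y] by [L^m] is obtained by dividing the coefficient of each
    exponential by the power of its eigenvalue. *)
Lemma conv_mixing : nontrivial_operator L -> mixing L.
Proof.
move=> nt U W oU [f0 Uf] oW [g0 Wg].
have [c hc] : exists c, symbol c <> symbol 0.
  apply/existsNP => h; apply: nt; exists (symbol 0) => f; exact: conv_scalar.
have ex : exists z : C, symbol (0 + z *: c) <> symbol (0 + 0 *: c).
  by exists 1; rewrite scale1r scale0r addr0 add0r.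
have [z1 hz1] := entire_value_lt1 (symbol_expands 0 c) ex.
have [z2 hz2] := entire_value_gt1 (symbol_expands 0 c) ex.
have [r1 [e1 [Ar1 e10 H1]]] := exp_nbhs_ball k1 oU Uf.
have [r2 [e2 [Ar2 e20 H2]]] := exp_nbhs_ball k1 oW Wg.
pose U1 := [set c | cabs (symbol c) < 1]; pose U2 := [set c | 1 < cabs (symbol c)].
have lo1 c' b : U1 c' -> exists2 d : R, 0 < d & forall h : C, cabs h <= d -> U1
    (c' + h *: b).
  rewrite /U1 /= -subr_gt0 => /(symbol_line_cont c' b)[d d0 H];
      exists d => // h /H hh.
  have := ler_cabs_tri (symbol (c' + h *: b)) (symbol c'); lra.
have lo2 c' b : U2 c' -> exists2 d : R, 0 < d & forall h : C, cabs h <= d -> U2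
    (c' + h *: b).
  rewrite /U2 /= -subr_gt0 => /(symbol_line_cont c' b)[d d0 H];
      exists d => // h /H hh.
  have := ler_cabs_tri (symbol c') (symbol (c' + h *: b)); rewrite cabsBC; lra.
have h1 : 0 < e1 / 2 by rewrite divr_gt0.
have h2 : 0 < e2 / 2 by rewrite divr_gt0.
have [s1 [sU1 hs1]] := expc_dense k1 Ar1 lo1 f0 (ex_intro U1 _ hz1) h1.
have [s2 [sU2 hs2]] := expc_dense k1 Ar2 lo2 g0 (ex_intro U2 _ hz2) h2.
have n1 := comb_pow_small Ar2 h2 (u := symbol) sU1.
have sU2' p : p \in s2 -> cabs (symbol p.2)^-1 < 1.
  by move=> /sU2; rewrite /U2 /= cabsV => h; rewrite invf_lt1 // (lt_trans _ h).
have n2 := comb_pow_small Ar1 h1 (u := fun c => (symbol c)^-1) sU2'.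
have [m0 _ Hm] : \forall m \near \oo,
   (expnorm N k r2 (\sum_(p <- s1) (symbol p.2 ^+ m * p.1) *: expc p.2)%R < (e2
       / 2)%:E)%E /\
   (expnorm N k r1 (\sum_(p <- s2) ((symbol p.2)^-1 ^+ m * p.1) *: expc p.2)%R
       < (e1 / 2)%:E)%E.
  by near=> m; split; near: m.
exists m0 => m /Hm /= [b1 b2].
set x := comb s1 in hs1; set y := comb s2 in hs2.
pose Sy : X := \sum_(p <- s2) ((symbol p.2)^-1 ^+ m * p.1) *: expc p.2.
have iterD (f g : X) i : iter i L (f + g) = iter i L f + iter i L g.
  elim: i => //= i ->; have := linL 1 (iter i L f) (iter i L g).
  by rewrite !scale1r.
have Ey : iter m L Sy = y.
  rewrite /Sy (iter_comb m (fun c => (symbol c)^-1 ^+ m)) /y.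
  rewrite /expc_comb big_seq [RHS]big_seq; apply: eq_bigr => p ps.
  have p0 : symbol p.2 != 0.
    by rewrite -cabs_gt0; apply: lt_trans (sU2 p ps).
  by rewrite -exprMn mulfV // expr1n mul1r.
have Ex : iter m L x = \sum_(p <- s1) (symbol p.2 ^+ m * p.1) *: expc p.2.
  have := iter_comb m (fun=> 1) s1.
  rewrite /x /expc_comb; under eq_bigr do rewrite mul1r.
  by move=> ->; apply: eq_bigr => p _; rewrite mulr1.
exists (iter m L (x + Sy)); split.
  exists (x + Sy); last exact: erefl.
  by apply: H1; exact: (exp_dist_lt Ar1 hs1 b2).
apply: H2; rewrite iterD Ey Ex [X in (X - _)%R]addrC.
exact: (exp_dist_lt Ar2 hs2 b1).
Unshelve. all: by end_near. Qed.

End Convolution.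

Theorem mainTheorem6 (R : realType) (n : nat) (N : cnorm R n)
    (k : \bar R) (A : {nonneg R}) (L : Exp N k A -> Exp N k A) :
  (0 < n)%N -> (1 < k)%E ->
  convolution_operator L -> nontrivial_operator L -> mixing L.
Proof. move=> _ k1 hL nt; exact: (conv_mixing k1 hL nt). Qed.
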